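(* For every integer $\ell\geq 2$ and every integer $r\geq 4$, asymptotically almost surely $$ \mathrm{ex}\left(G_{n,p}^{(r)}, C_{2\ell}^{(r)}\right) = \begin{cases} (1-o(1))pn^r, & \text{if } n^{-r} \ll p\ll n^{-(r-1)+\frac{1}{2\ell-1}}, \\ n^{1+\frac{1}{2\ell-1}+o(1)}, & \text{if } n^{-(r-1)+\frac{1}{2\ell-1}+o(1)}\leq p\leq n^{-(r-2)+\frac{1}{2\ell-1}+o(1)}, \\ pn^{r-1+o(1)}, & \text{if } p \geq n^{-(r-2)+\frac{1}{2\ell-1}+o(1)}. \end{cases}$$
   Context: An $r$-graph is an $r$-uniform hypergraph. $G_{n,p}^{(r)}$ is the random $r$-graph on $n$ labelled vertices in which each of the $\binom{n}{r}$ possible edges is present independently with probability $p=p(n)$. For $r$-graphs $G,H$, $\mathrm{ex}(G,H)$ is the maximum number of edges of a subgraph of $G$ containing no (not necessarily induced) copy of $H$. The linear cycle $C_k^{(r)}$ is the $r$-graph obtained from the graph cycle $C_k$ by adding, to each of its $k$ edges, $r-2$ new vertices of degree one. ''Asymptotically almost surely'' means with probability tending to $1$ as $n\to\infty$. We write $f\ll g$ if $f(n)/g(n)\to 0$. Every $o(1)$ term appearing in an exponent is a function of order $O(\log\log n/\log n)$ (depending only on $\ell,r$).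
   Formalization: In the first case (1-o(1))pn^r is replaced by (1±o(1))p·binom(n,r), two-sided: the random r-graph has only about p·n^r/r! edges, so the formula with pn^r and constant 1 is false as written. *)

(* Defs.v *)
From HB Require Import structures.
From mathcomp Require Import all_boot all_order all_algebra.

Set Implicit Arguments.
Unset Strict Implicit.
Unset Printing Implicit Defensive.

(* A hypergraph on a finite vertex type is identified with its edge set; the
   r-graphs on T are the subsets of [complete_rgraph T r]. *)
Definition complete_rgraph (T : finType) (r : nat) : {set {set T}} :=
  [set e : {set T} | #|e| == r].

Definition contains_copy (T V : finType) (G : {set {set T}})
    (H : {set {set V}}) : bool :=
  [exists f : {ffun V -> T}, injectiveb f && [forall e in H, f @: e \in G]].

(* The maximum is 0 if no subgraph is H-free, which requires H to have no
   edge. *)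
Definition ex (T V : finType) (G : {set {set T}}) (H : {set {set V}}) : nat :=
  \max_(F : {set {set T}} | (F \subset G) && ~~ contains_copy F H) #|F|.

(* Vertices of the linear cycle: [inl i] are those of the graph cycle C_k, and
   [inr (i, j)], j < r - 2, are the new ones added to the edge {i, i+1 mod k}.
   This is an r-graph with k edges when 3 <= k and 2 <= r. *)
Definition linear_cycle_vertex (k r : nat) : finType :=
  ('I_k + 'I_k * 'I_(r - 2))%type.

Definition linear_cycle_edge (k r : nat) (i : 'I_k) :
    {set linear_cycle_vertex k r} :=
  [set inl i; inl (ordS i)] :|: [set inr (i, j) | j : 'I_(r - 2)].

Definition linear_cycle (k r : nat) : {set {set linear_cycle_vertex k r}} :=
  [set linear_cycle_edge r i | i : 'I_k].

Lemma linear_cycle_uniform (k r : nat) : 3 <= k -> 2 <= r ->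
  linear_cycle k r \subset complete_rgraph (linear_cycle_vertex k r) r.
Proof.
move=> k3 r2; apply/subsetP => _ /imsetP[i _ ->]; rewrite inE.
rewrite /linear_cycle_edge cardsU cards2 card_imset; last first.
  by move=> a b [].
have -> : [set inl i; inl (ordS i)] :&: [set inr (i, j) | j : 'I_(r - 2)]
    = set0 :> {set linear_cycle_vertex k r}.
  apply/setP => x; rewrite in_setI in_set0.
  apply/negbTE/andP => -[+ /imsetP[j _ xE]].
  by rewrite xE !inE.
have nei : inl i != inl (ordS i) :> linear_cycle_vertex k r.
  apply/eqP => -[] /(congr1 val) /= E; case: (ltngtP i.+1 k) (ltn_ord i) => // h _.
    by move: E; rewrite modn_small // => /n_Sn.
  by move: E; rewrite h modnn => E; move: k3; rewrite -h E.
by rewrite nei cards0 subn0 cardT size_enum_ord subnKC.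
Qed.

Import Order.TTheory GRing.Theory Num.Theory.
From mathcomp Require Import all_classical all_reals all_analysis.
Import numFieldNormedType.Exports.
Local Open Scope ring_scope.

Definition Gnp_weight (R : realType) (n r : nat) (p : R)
    (G : {set {set 'I_n}}) : R :=
  \prod_(e in complete_rgraph 'I_n r) (if e \in G then p else 1 - p).

(* Probability that the random r-graph on n vertices has property A. *)
Definition Gnp_Pr (R : realType) (n r : nat) (p : R)
    (A : pred {set {set 'I_n}}) : R :=
  \sum_(G : {set {set 'I_n}} | (G \subset complete_rgraph 'I_n r) && A G)
    Gnp_weight r p G.

Lemma Gnp_Pr_total (R : realType) (n r : nat) (p : R) :
  Gnp_Pr r p (fun G : {set {set 'I_n}} => true) = 1.
Proof.
pose K := complete_rgraph 'I_n r.
have := @bigA_distr R 0 1 *%R +%R {set 'I_n}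
  (fun e => if e \in K then p else 0)
  (fun e => if e \in K then 1 - p else 1).
rewrite big1 => [->|e _]; last first.
  by case: ifP => _ /=; rewrite ?subrKC ?add0r.
rewrite (bigID (fun J : {set {set 'I_n}} => J \subset K)) /=.
rewrite [X in _ = _ + X]big1 ?addr0 => [|J /subsetPn[e eJ eK]]; last first.
  by rewrite (bigD1 e) //= eJ (negbTE eK) mul0r.
apply: eq_big => [J|J]; first by rewrite andbT.
rewrite andbT => JK; rewrite /Gnp_weight big_mkcond /=; apply: eq_bigr => e _.
case: (boolP (e \in J)) => eJ; last by [].
by rewrite (fintype.subsetP JK).
Qed.

Definition aas (R : realType) (r : nat) (p : nat -> R)
    (A : forall n, pred {set {set 'I_n}}) : Prop :=
  ((fun n => Gnp_Pr r (p n) (A n)) @ \oo --> (1 : R))%classic.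

(* f(n)/g(n) -> 0.  The first conjunct makes the quotient meaningful: with the
   convention x/0 = 0, f << 0 would otherwise hold for every f. *)
Definition much_less (R : realType) (f g : nat -> R) : Prop :=
  ((\forall n \near \oo, g n != 0) /\
   (fun n => f n / g n) @ \oo --> (0 : R))%classic.

(* The o(1) terms which are allowed in exponents. *)
Definition loglog_small (R : realType) (e : nat -> R) : Prop :=
  (e =O_\oo (fun n => ln (ln n%:R) / ln n%:R : R))%classic.

(* Main.v *)
(** The lower bounds come from three H-free subgraphs of the random r-graph:
    a random thinning with one edge deleted from every copy of the cycle, the
    unthinned version of it when p is small, and the star of all edges through
    a fixed vertex when p is large.

    The upper bounds come from hypergraph containers: up to polylogarithmic
    factors in the exponent, exp(n^(1 + 1/(2l-1))) sets of O(n^(r-1)) edges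
    cover all C_{2l}-free r-graphs, and then a union bound controls the
    number of random edges in every container at once.

    Containers need balanced supersaturation: an r-graph G with e >= C n^(r-1)
    edges carries a measure on copies of C_{2l} in which no set of j edges has
    too large codegree.  To build it, designate in almost every edge a pair
    {low, mate}, where low is a vertex of minimum degree and the pair has
    codegree at most n^(-2/3) times that degree (up to constants); this is
    possible because r >= 4.  The designated pairs form a weighted graph.
    Closed walks of length 2l in this graph, with weights 1 / mu on the
    vertices for mu comparable to the degree, are counted from below by
    log-convexity of the walk numbers.  Passing to a subgraph that minimises
    (number of closed walks) / (number of edges)^A, with A of order log n,
    bounds the number of walks through each edge, and log-convexity turns this
    bound into the required codegree bounds.  Walks that do not lift to linear
    cycles, by revisiting a joint or because the expansions intersect, have
    negligible weight. *)

(* The weight W of closed walks is bounded below but may be far larger than in a random-like graph,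
   so all bounds are relative to W. With V = W^(1/(2l)) and y = n^(1/(2l-1)), walks of length g < 2l
   - 1 between two given vertices weigh at most F (V/y)^g, where F = C n V / e. Fixing j >= 2 edges
   of a closed walk leaves j gaps of total length 2l - j. In the product of the gap bounds the
   powers of V combine to W, and dividing by W leaves (2C)^j tau^(j-1) / e up to a constant, with
   tau = y^(2l) / e. Hence tau e = n^(1 + 1/(2l-1)), the exponent in the number of containers. The
   exponent 2/3 balances two demands on h = n^a, the factor by which the codegree of a designated
   pair stays below the degree. Edges without a designated pair number at most n h^(r-1), which must
   be O(n^(r-1)): at r = 4 this says a <= 2/3. The bounds for the shortest gaps need n / h <=
   y^(l-1) up to constants: at l = 2 this says a >= 2/3. *)
Require Import Defs.
From HB Require Import structures.
From mathcomp Require Import all_boot all_order all_algebra.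
From mathcomp Require Import ring lra zify.
Import Order.TTheory GRing.Theory Num.Theory.
Set Implicit Arguments.
Unset Strict Implicit.
Unset Printing Implicit Defensive.
Local Open Scope ring_scope.

(** * Containers *)

Section PatternSum.
Variables (R : realFieldType) (X : finType).
Implicit Types (p : seq (option X)) (w : seq X -> R) (x : seq X) (s : seq bool).

(** Hypergraphs are encoded as weights on ordered tuples: the link of a vertex is then obtained by
    prefixing it, and a codegree is a sum over the tuples that extend a partially filled pattern. *)
Fixpoint psum p w : R :=
  match p with
  | [::] => w [::]
  | Some v :: p' => psum p' (fun x => w (v :: x))
  | None :: p' => \sum_v psum p' (fun x => w (v :: x))
  end.

Fixpoint pattern_of s x : seq (option X) :=
  match s, x with
  | b :: s', v :: x' => (if b then Some v else None) :: pattern_of s' x'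
  | _, _ => [::]
  end.

Definition nfixed p : nat := count isSome p.
Definition shape_of p : seq bool := map isSome p.
Definition pmatch p x : bool := (size x == size p) && (pattern_of (shape_of p) x == p).

Fixpoint shapes k : seq (seq bool) :=
  if k is k'.+1 then map (cons true) (shapes k') ++ map (cons false) (shapes k')
  else [:: [::]].

Lemma size_shapes k : size (shapes k) = (2 ^ k)%N.
Proof. by elim: k => //= k IH; rewrite size_cat !size_map IH expnS mul2n addnn. Qed.

Lemma mem_shapes s : s \in shapes (size s).
Proof.
elim: s => [|b s IH] //=; rewrite mem_cat.
by case: b; rewrite (map_f _ IH) ?orbT.
Qed.

Lemma shapes_size k s : s \in shapes k -> size s = k.
Proof.
elim: k s => [|k IH] s /=; first by rewrite inE => /eqP ->.
by rewrite mem_cat => /orP[] /mapP[t /IH <- ->].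
Qed.

Lemma eq_psum p w1 w2 : (forall x, pmatch p x -> w1 x = w2 x) -> psum p w1 = psum p w2.
Proof.
elim: p w1 w2 => [|[v|] p IH] w1 w2 h /=; first by apply: h.
  by apply: IH => x /andP[sx px]; apply: h; rewrite /pmatch /= eqSS sx /= (eqP px) eqxx.
apply: eq_bigr => v _; apply: IH => x /andP[sx px]; apply: h.
by rewrite /pmatch /= eqSS sx /= (eqP px) eqxx.
Qed.

Lemma le_psum p w1 w2 : (forall x, pmatch p x -> w1 x <= w2 x) -> psum p w1 <= psum p w2.
Proof.
elim: p w1 w2 => [|[v|] p IH] w1 w2 h /=; first by apply: h.
  by apply: IH => x /andP[sx px]; apply: h; rewrite /pmatch /= eqSS sx /= (eqP px) eqxx.
apply: ler_sum => v _; apply: IH => x /andP[sx px]; apply: h.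
by rewrite /pmatch /= eqSS sx /= (eqP px) eqxx.
Qed.

Lemma psum0 p : psum p (fun=> 0) = 0.
Proof. by elim: p => [|[v|] p IH] //=; rewrite big1. Qed.

Lemma psum_ge0 p w : (forall x, 0 <= w x) -> 0 <= psum p w.
Proof. by move=> h; rewrite -(psum0 p); apply: le_psum. Qed.

Lemma psumD p w1 w2 : psum p (fun x => w1 x + w2 x) = psum p w1 + psum p w2.
Proof.
elim: p w1 w2 => [|[v|] p IH] w1 w2 //=.
by rewrite -big_split; apply: eq_bigr => v _; rewrite IH.
Qed.

Lemma psumZ p c w : psum p (fun x => c * w x) = c * psum p w.
Proof.
elim: p w => [|[v|] p IH] w //=.
by rewrite mulr_sumr; apply: eq_bigr => v _; rewrite IH.
Qed.

Lemma psum_sum (I : Type) (r : seq I) (P : pred I) p (w : I -> seq X -> R) :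
  psum p (fun x => \sum_(i <- r | P i) w i x) = \sum_(i <- r | P i) psum p (w i).
Proof.
elim: r => [|i r IH].
  by rewrite big_nil -[RHS](psum0 p); apply: eq_psum => x _; rewrite big_nil.
rewrite big_cons -IH; case: ifP => Pi; last first.
  by apply: eq_psum => x _; rewrite big_cons Pi.
by rewrite -psumD; apply: eq_psum => x _; rewrite big_cons Pi.
Qed.

(* Every x extends exactly one pattern of a given shape. *)
Lemma psum_shape_le c (S : pred (seq (option X))) s w1 w2 :
  (forall x, 0 <= w2 x) -> 0 <= c ->
  (forall p, shape_of p = s -> S p -> psum p w1 <= c * psum p w2) ->
  psum (nseq (size s) None) (fun x => if S (pattern_of s x) then w1 x else 0)
    <= c * psum (nseq (size s) None) w2.
Proof.
move=> w20 c0.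
elim: s S w1 w2 w20 => [|[|] s IH] S w1 w2 w20 h /=.
- case: ifP => Sn; first exact: (h [::]).
  exact: mulr_ge0.
- rewrite mulr_sumr; apply: ler_sum => v _.
  apply: (IH (fun p => S (Some v :: p))) => // p sp Sp.
  by apply: (h (Some v :: p)) => //; rewrite /shape_of /= -/(shape_of p) sp.
- rewrite -!psum_sum; under eq_psum => x _ do rewrite -big_mkcond /=.
  rewrite (_ : psum _ _ = psum (nseq (size s) None) (fun x =>
    if S (None :: pattern_of s x) then \sum_v w1 (v :: x) else 0)); last first.
    apply: eq_psum => x _; case: ifP => Sx; first by [].
    by rewrite big1.
  apply: (IH (fun p => S (None :: p))) => [x|p sp Sp]; first exact: sumr_ge0.
  rewrite !psum_sum; apply: (h (None :: p)) => //.
  by rewrite /shape_of /= -/(shape_of p) sp.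
Qed.

End PatternSum.

(** * The container algorithm for weighted tuples *)

Section Container.
Variables (R : realFieldType) (X : finType) (V : {set X}) (tau : R) (m0 : nat).
Hypothesis tau0 : 0 < tau.
Hypothesis V0 : (0 < #|V|)%N.
Local Notation N := (#|V|%:R : R).
Hypothesis m0_ge : tau * N <= m0%:R.
Hypothesis m0_le : m0%:R <= 2 * (tau * N).

Definition independent k (w : seq X -> R) (I : {set X}) : Prop :=
  forall x, size x = k -> all (mem I) x -> w x = 0.

(** One fixed entry may carry the average share 1 / N up to the factor [K]; each further fixed entry
    must gain a factor [tau]. *)
Definition spread k K (w : seq X -> R) : Prop :=
  [/\ forall x, 0 <= w x,
      forall x, ~~ all (mem V) x -> w x = 0,
      1 <= psum (nseq k None) w &
      forall p, size p = k -> (0 < nfixed p)%N ->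
        psum p w <= K * tau ^+ (nfixed p).-1 / N].

Definition covered (F : {set X} -> Prop) (B : nat) (q : R) : Prop :=
  exists C : seq {set X}, [/\ (size C <= B)%N,
    forall c, c \in C -> c \subset V /\ #|c|%:R <= q * N &
    forall I, F I -> exists2 c, c \in C & I \subset c].

Lemma coveredU (F F1 F2 : {set X} -> Prop) B1 B2 q :
  (forall I, F I -> F1 I \/ F2 I) ->
  covered F1 B1 q -> covered F2 B2 q -> covered F (B1 + B2) q.
Proof.
move=> FF [C1 [s1 c1 h1]] [C2 [s2 c2 h2]]; exists (C1 ++ C2); split.
- by rewrite size_cat leq_add.
- by move=> c; rewrite mem_cat => /orP[/c1|/c2].
- by move=> I /FF[/h1|/h2] [c cC Ic]; exists c => //; rewrite mem_cat cC ?orbT.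
Qed.

Lemma covered_le (F F' : {set X} -> Prop) B B' q q' :
  (forall I, F I -> F' I) -> (B' <= B)%N -> q' <= q -> covered F' B' q' -> covered F B q.
Proof.
move=> FF BB qq [C [s c h]]; exists C; split.
- exact: leq_trans BB.
- move=> d /c[dV dq]; split=> //; apply: le_trans dq _.
  exact: ler_wpM2r.
- by move=> I /FF /h.
Qed.

(** Passing from tuples of length k' + 1 to length k' replaces the spread constant [K] by 2^(k'+6)
    K^2; this is the constant after all levels. *)
Fixpoint shrink_const (k : nat) (K : R) : R :=
  if k is k'.+1 then shrink_const k' (2 ^+ (k' + 6) * K ^+ 2) else K.

Lemma shrink_const_ge k K : 1 <= K -> K <= shrink_const k K.
Proof.
elim: k K => [|k IH] K K1 //=.
have h : K <= 2 ^+ (k + 6) * K ^+ 2.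
  rewrite expr2 mulrA ler_peMl ?(le_trans ler01 K1) //.
  by rewrite mulr_ege1 // exprn_ege1 // ler1n.
by apply: (le_trans h); apply: IH; apply: le_trans h.
Qed.

(** * One level of the algorithm: from tuples of length k + 1 to tuples of length k *)

Section Level.
Variables (k : nat) (K : R) (w : seq X -> R).
Hypothesis K1 : 1 <= K.
Hypothesis w_spread : spread k.+1 K w.
(** Chosen so that in [sum_links] the saturated patterns of all 2^k shapes cost 2^k (K / (K' tau))
    (2 tau K) = 1/4. *)
Let K' := 2 ^+ (k + 3) * K ^+ 2.
Let theta a := K' * tau ^+ a / N.
Variables (B : nat) (q : R).
Hypothesis B0 : (0 < B)%N.
Hypothesis q_ge : 1 - (4 * K)^-1 <= q.
Hypothesis IHk : forall w', spread k (2 ^+ (k + 6) * K ^+ 2) w' ->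
  covered (fun I => I \subset V /\ independent k w' I) B q.

Let N0 : 0 < N. Proof. by rewrite ltr0n. Qed.
Let K0 : 0 < K. Proof. exact: lt_le_trans K1. Qed.
Let K'0 : 0 < K'. Proof. by rewrite mulr_gt0 ?exprn_gt0. Qed.

Let w0 : forall x, 0 <= w x. Proof. by case: w_spread. Qed.
Let wV : forall x, ~~ all (mem V) x -> w x = 0. Proof. by case: w_spread. Qed.
Let wd p : size p = k.+1 -> (0 < nfixed p)%N -> psum p w <= K * tau ^+ (nfixed p).-1 / N.
Proof. by case: w_spread => _ _ _; apply. Qed.

(** The weight [w'] accumulates the links of the vertices found to lie in the independent set.
    Tuples through a saturated pattern are no longer added, which keeps the codegrees of [w']
    bounded. *)
Let sat (w' : seq X -> R) p := (0 < nfixed p)%N && (theta (nfixed p) < psum p w').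
Let clean w' x := ~~ has (fun s => sat w' (pattern_of s x)) (shapes k).
Let link w' v x := if clean w' x then w (v :: x) else 0.

(** In the last clause the summand K tau^a / N, with a fixed entries, is the overshoot of the single
    step that carries a pattern past its threshold. *)
Let state (m : nat) (w' : seq X -> R) :=
  [/\ forall x, 0 <= w' x,
      forall x, ~~ all (mem V) x -> w' x = 0,
      m%:R / (4 * N) <= psum (nseq k None) w',
      psum (nseq k None) w' <= m%:R * K / N &
      forall p, size p = k -> (0 < nfixed p)%N ->
        psum p w' <= theta (nfixed p) + K * tau ^+ (nfixed p) / N].

(** An unclean tuple contains a saturated pattern, and a saturated pattern is heavy in [w'].
    Comparing the degree of each such pattern in [w] with its weight in [w'], shape by shape, bounds
    the lost mass by 1/4. *)
Lemma sum_links w' : (forall x, 0 <= w' x) ->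
  psum (nseq k None) w' <= 2 * tau * K ->
  3 / 4 <= \sum_v psum (nseq k None) (link w' v).
Proof.
move=> w'0 w'le.
have tot : 1 <= psum (nseq k None) (fun x => \sum_v w (v :: x)).
  by rewrite psum_sum; case: w_spread.
rewrite -psum_sum.
pose W x := \sum_v w (v :: x).
have W0 x : 0 <= W x by exact: sumr_ge0.
have step : psum (nseq k None) W <= psum (nseq k None) (fun x =>
   (\sum_v link w' v x) + \sum_(s <- shapes k) if sat w' (pattern_of s x) then W x else 0).
  apply: le_psum => x _; rewrite /link; case: (boolP (clean w' x)) => cx.
    by rewrite lerDl sumr_ge0 // => s _; case: ifP.
  rewrite big1 // add0r; move: cx; rewrite /clean negbK => /hasP[s sk ss].
  rewrite (perm_big _ (perm_to_rem sk)) big_cons ss lerDl sumr_ge0 // => s' _.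
  by case: ifP.
have bad : psum (nseq k None) (fun x => \sum_(s <- shapes k)
    if sat w' (pattern_of s x) then W x else 0) <= 1 / 4.
  rewrite psum_sum.
  have one s : s \in shapes k -> psum (nseq k None) (fun x =>
      if sat w' (pattern_of s x) then W x else 0) <= K / (K' * tau) * (2 * tau * K).
    move=> sk; have sz := shapes_size sk.
    have c0 : 0 <= K / (K' * tau) by rewrite ltW // divr_gt0 // mulr_gt0.
    apply: (@le_trans _ _ (K / (K' * tau) * psum (nseq k None) w')); last exact: ler_wpM2l.
    rewrite -sz; apply: (psum_shape_le (S := sat w')) => // p sp /andP[f0 fs].
    have szp : size p = k by rewrite -sz -sp size_map.
    have := wd (p := None :: p); rewrite /= szp => /(_ erefl f0).
    rewrite -psum_sum => /le_trans; apply.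
    have -> : K * tau ^+ (nfixed (None :: p)).-1 / N = K / (K' * tau) * theta (nfixed p).
      rewrite /theta (_ : nfixed (None :: p) = nfixed p) //.
      have -> : tau ^+ nfixed p = tau * tau ^+ (nfixed p).-1 by rewrite -exprS prednK.
      by field; rewrite !gt_eqF.
    by apply: ler_wpM2l => //; apply: ltW.
  rewrite big_seq; apply: le_trans (ler_sum _ one) _.
  rewrite -big_seq big_const_seq count_predT size_shapes iter_addr_0.
  rewrite -[leLHS]mulr_natr natrX.
  have e0 : (2%:R : R) ^+ k != 0 by rewrite expf_neq0 // pnatr_eq0.
  rewrite le_eqVlt; apply/orP; left; apply/eqP; rewrite /K' exprD.
  by field; rewrite e0 !gt_eqF.
rewrite psumD in step; lra.
Qed.

(** The vertices of [U] carry at most 1/4 of the link mass, vertices outside [V] none. If all others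
    had less than 1 / (4N), the total would be at most 1/2, below the 3/4 of [sum_links]. *)
Lemma choose_vertex w' (U : {set X}) : (forall x, 0 <= w' x) ->
  psum (nseq k None) w' <= 2 * tau * K ->
  #|U|%:R <= N / (4 * K) ->
  exists2 v, v \in V :\: U & 1 / (4 * N) <= psum (nseq k None) (link w' v).
Proof.
move=> w'0 w'le UN; have tot := sum_links w'0 w'le.
have lw v x : link w' v x <= w (v :: x) by rewrite /link; case: ifP.
have lw0 v x : 0 <= link w' v x by rewrite /link; case: ifP.
have [/existsP[v /andP[vVU ?]]|none] :=
    boolP [exists v, (v \in V :\: U) && (1 / (4 * N) <= psum (nseq k None) (link w' v))].
  by exists v.
suff : \sum_v psum (nseq k None) (link w' v) <= 1 / 2 by lra.
have lU v : psum (nseq k None) (link w' v) <= psum (Some v :: nseq k None) w by exact: le_psum.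
rewrite (bigID (mem U)) /= (_ : 1 / 2 = 1 / 4 + 1 / 4); last by field.
apply: lerD.
  apply: (@le_trans _ _ (\sum_(v in U) K / N)).
    apply: ler_sum => v _; apply: le_trans (lU v) _.
    have f1 : nfixed (Some v :: nseq k None) = 1%N by rewrite /nfixed /= count_nseq /= mul0n.
    have := @wd (Some v :: nseq k None); rewrite f1 expr0 mulr1; apply => //.
    by rewrite /= size_nseq.
  rewrite sumr_const -[leLHS]mulr_natl.
  apply: (@le_trans _ _ (N / (4 * K) * (K / N))).
    by rewrite ler_wpM2r // ltW // divr_gt0.
  by rewrite le_eqVlt; apply/orP; left; apply/eqP; field; rewrite !gt_eqF.
rewrite (bigID (mem V)) /= [X in _ + X]big1 ?addr0 => [|v /andP[_ vV]]; last first.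
  apply/le_anti/andP; split; last exact: psum_ge0.
  rewrite -(@psum0 R X (nseq k None)); apply: le_psum => x _.
  by apply: le_trans (lw v x) _; rewrite wV //= (negbTE vV).
apply: (@le_trans _ _ (\sum_(v in V) 1 / (4 * N))).
  rewrite big_mkcond [leRHS]big_mkcond; apply: ler_sum => v _.
  case: ifP => [/andP[vU vV]|_]; last by case: ifP => // _; rewrite divr_ge0 // mulr_ge0 ?ltW.
  rewrite vV; move/existsPn: none => /(_ v); rewrite inE vU vV /= -ltNge; exact: ltW.
rewrite sumr_const -[leLHS]mulr_natl.
by rewrite le_eqVlt; apply/orP; left; apply/eqP; field; rewrite gt_eqF.
Qed.

Lemma link_le w' v p : psum p (link w' v) <= psum (Some v :: p) w.
Proof. by apply: le_psum => x _; rewrite /link; case: ifP. Qed.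

Lemma link_saturated w' v p : size p = k -> sat w' p -> psum p (link w' v) = 0.
Proof.
move=> sp ps; rewrite -[RHS](@psum0 R X p); apply: eq_psum => x /andP[_ /eqP px].
rewrite /link /clean (_ : has _ _ = true) //; apply/hasP; exists (shape_of p).
  by rewrite -sp -(size_map isSome p) mem_shapes.
by rewrite px.
Qed.

Lemma state_step m w' v : state m w' ->
  1 / (4 * N) <= psum (nseq k None) (link w' v) ->
  state m.+1 (fun x => w' x + link w' v x).
Proof.
move=> [w'0 w'V lo up sp] lv.
have l0 x : 0 <= link w' v x by rewrite /link; case: ifP.
split.
- by move=> x; rewrite addr_ge0.
- move=> x xV; rewrite w'V // add0r /link; case: ifP => // _.
  by rewrite wV //= (negbTE xV) andbF.
- by rewrite psumD -natr1 mulrDl lerD.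
- rewrite psumD -natr1 !mulrDl lerD //; apply: le_trans (link_le _ _ _) _.
  have f1 : nfixed (Some v :: nseq k None) = 1%N by rewrite /nfixed /= count_nseq /= mul0n.
  have := @wd (Some v :: nseq k None); rewrite f1 expr0 mulr1 mul1r; apply => //.
  by rewrite /= size_nseq.
- move=> p pk p0; rewrite psumD; case: (boolP (sat w' p)) => [ps|].
    by rewrite link_saturated // addr0 sp.
  rewrite /sat p0 /= -leNgt => h; apply: lerD => //.
  apply: le_trans (link_le _ _ _) _.
  have := @wd (Some v :: p); rewrite (_ : nfixed (Some v :: p) = (nfixed p).+1) //.
  by apply; rewrite //= pk.
Qed.

(** The factor 4 / tau normalises: m0 links have mass at least m0 / (4N) >= tau / 4. *)
Lemma state_done w' : state m0 w' ->
  spread k (2 ^+ (k + 6) * K ^+ 2) (fun x => 4 / tau * w' x).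
Proof.
move=> [w'0 w'V lo up sp].
have t0 : 0 < 4 / tau by rewrite divr_gt0.
split.
- by move=> x; rewrite mulr_ge0 // ltW.
- by move=> x xV; rewrite w'V // mulr0.
- rewrite psumZ; apply: (@le_trans _ _ (4 / tau * (m0%:R / (4 * N)))); last by rewrite ler_pM2l.
  rewrite (_ : _ / _ * _ = m0%:R / (tau * N)); last by field; rewrite !gt_eqF.
  by rewrite ler_pdivlMr ?mul1r // mulr_gt0.
- move=> p pk p0; rewrite psumZ.
  apply: (@le_trans _ _ (4 / tau * (theta (nfixed p) + K * tau ^+ nfixed p / N))).
    by rewrite ler_pM2l // sp.
  have -> : tau ^+ nfixed p = tau * tau ^+ (nfixed p).-1 by rewrite -exprS prednK.
  rewrite /theta; have -> : tau ^+ nfixed p = tau * tau ^+ (nfixed p).-1 by rewrite -exprS prednK.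
  rewrite (_ : _ / _ * _ = 4 * (K' + K) * (tau ^+ (nfixed p).-1 / N)); last first.
    by field; rewrite !gt_eqF.
  rewrite -[leRHS]mulrA ler_wpM2r //; first by rewrite ltW // divr_gt0 ?exprn_gt0.
  rewrite /K' (_ : (k + 6)%N = (k + 3 + 3)%N) ?exprD; last by rewrite -addnA.
  have e1 : 1 <= (2 : R) ^+ k * 2 ^+ 3 by rewrite mulr_ege1 ?exprn_ege1 // ler1n.
  have K2 : K <= K ^+ 2 by rewrite expr2 ler_peMl // ltW.
  have h : K <= 2 ^+ k * 2 ^+ 3 * K ^+ 2.
    by apply: le_trans K2 _; rewrite ler_peMl // exprn_ge0 // ltW.
  by rewrite [(2 : R) ^+ 3 in X in _ <= X]exprS; nra.
Qed.

(** The algorithm asks whether a vertex of large link lies in [I]. [U] collects the vertices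
    answered no, and [m] yes answers are still to come. The bound on the number of containers
    follows the two branches: (u+1)^(m+1) + (u+2)^m <= (u+2)^(m+1). *)
Lemma level_loop m u m1 w' (U : {set X}) :
  (m1 + m = m0)%N -> state m1 w' -> U \subset V -> (#|V :\: U| <= u)%N ->
  covered (fun I => [/\ I \subset V :\: U, independent k w' I & independent k.+1 w I])
    (u.+1 ^ m * B) q.
Proof.
elim: m u m1 w' U => [|m IHm] u m1 w' U.
  rewrite addn0 => -> /state_done sp _ _.
  apply: covered_le (IHk sp) => //; last by rewrite mul1n.
  move=> I [IVU I1 _]; split; first exact: subset_trans IVU (subsetDl _ _).
  by move=> x xk xI; rewrite I1 // mulr0.
elim: u m1 w' U => [|u IHu] m1 w' U m1m st UV Vu.
all: have [w'0 w'V lo up sp] := st.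
all: have UVN : #|V :\: U|%:R = N - #|U|%:R :> R
  by rewrite cardsDS // natrB // subset_leq_card.
(* Once more than N / (4K) vertices are excluded, V minus U is itself a container. *)
all: have [big|small] := ltP (N / (4 * K)) #|U|%:R.
1,3: exists [:: V :\: U]; split => [|c|I [IVU _ _]];
  [by rewrite muln_gt0 B0 expn_gt0
  |rewrite inE => /eqP ->; split; first (by rewrite subsetDl);
   rewrite UVN; apply: (@le_trans _ _ ((1 - (4 * K)^-1) * N));
     [by rewrite mulrBl mul1r lerD2l lerN2 mulrC ltW | by rewrite ler_wpM2r]
  |by exists (V :\: U); rewrite // inE].
all: have upK : psum (nseq k None) w' <= 2 * tau * K by
  (apply: le_trans up _; rewrite mulrAC ler_wpM2r ?(ltW K0) // ler_pdivrMr //;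
   rewrite -mulrA; apply: le_trans m0_le; rewrite ler_nat -m1m leq_addr).
all: have [v vVU lv] := choose_vertex w'0 upK small.
  by move: Vu; rewrite leqn0 cards_eq0 => /eqP VU0; rewrite VU0 inE in vVU.
have [vU vV] : v \notin U /\ v \in V by move: vVU; rewrite inE => /andP[].
have no : covered (fun I => [/\ I \subset V :\: (v |: U), independent k w' I &
    independent k.+1 w I]) (u.+1 ^ m.+1 * B) q.
  apply: IHu m1m st _ _; first by rewrite subUset sub1set vV.
  move: Vu; rewrite (cardsD1 v) vVU add1n ltnS; apply: leq_trans.
  by apply: subset_leq_card; apply/subsetP => z; rewrite !inE negb_or -andbA.
have yes := IHm u.+1 m1.+1 _ U (etrans (addSnnS _ _) m1m) (state_step st lv) UV Vu.
suff cov : covered (fun I => [/\ I \subset V :\: U, independent k w' I & independent k.+1 w I])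
    (u.+1 ^ m.+1 * B + u.+2 ^ m * B) q.
  apply: covered_le cov => //.
  rewrite -mulnDl leq_mul2r; apply/orP; right.
  rewrite expnS [leqRHS]expnS [leqRHS]mulSn addnC leq_add2l leq_mul2l.
  by case: (m) => // ?; rewrite leq_exp2r ?leqnSn ?orbT.
apply: coveredU no yes.
move=> I [IVU I1 I2]; case: (boolP (v \in I)) => vI; [right|left]; split => //.
- move=> x xk xI; rewrite I1 // add0r /link; case: ifP => // _.
  by rewrite I2 //= ?xk // vI xI.
- apply/subsetP => z zI; have := fintype.subsetP IVU z zI; rewrite !inE negb_or.
  by move=> /andP[-> ->]; rewrite !andbT; apply: contraNneq vI => <-.
Qed.

Lemma state0 : state 0 (fun=> 0).
Proof.
split=> //; rewrite ?psum0 ?mul0r // => p _ _; rewrite psum0 addr_ge0 //.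
  by rewrite /theta ltW // divr_gt0 ?mulr_gt0 ?exprn_gt0.
by rewrite ltW // divr_gt0 ?mulr_gt0 ?exprn_gt0.
Qed.

End Level.

Theorem container k K w : 1 <= K -> spread k K w ->
  covered (fun I => I \subset V /\ independent k w I) (#|V|.+1 ^ (k * m0))
    (1 - (4 * shrink_const k K)^-1).
Proof.
elim: k K w => [|k IH] K w K1 sp.
  (* For empty tuples [spread] gives w [::] >= 1 and independence gives w [::] = 0, so there is
     nothing to cover. *)
  exists [::]; split=> // I [_ I0]; case: sp => _ _ /=.
  by rewrite I0 //= ler10.
have K2 : 1 <= 2 ^+ (k + 6) * K ^+ 2 by rewrite mulr_ege1 // exprn_ege1 ?ler1n.
have B0 : (0 < #|V|.+1 ^ (k * m0))%N by rewrite expn_gt0.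
have q1 : 1 - (4 * K)^-1 <= 1 - (4 * shrink_const k.+1 K)^-1.
  have Ks := shrink_const_ge k.+1 K1.
  have K0 : 0 < K := lt_le_trans ltr01 K1.
  by rewrite lerD2l lerN2 lef_pV2 ?posrE ?mulr_gt0 ?ler_pM2l // (lt_le_trans K0).
have := level_loop K1 sp B0 q1 (fun w' => IH _ w' K2) (add0n m0) (state0 _ K1) (sub0set V).
rewrite setD0 => /(_ #|V| (leqnn _)).
apply: covered_le => [I [IV Iw]| |//]; first by split.
by rewrite mulSn expnD.
Qed.
End Container.

(** * Walks in weighted graphs *)

Section LogConvex.
Variable R : realFieldType.
Implicit Types (c h : nat -> R) (L : nat).

(** Entries may vanish, so the consequences below are stated with products instead of ratios. *)
Definition log_convex L c := [/\ forall i, 0 <= c i &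
  forall i, (i.+2 <= L)%N -> c i.+1 ^+ 2 <= c i * c i.+2].

Lemma log_convex_shift L c j : log_convex (j + L) c -> log_convex L (fun i => c (j + i)%N).
Proof.
by move=> [c0 cc]; split=> // i iL; rewrite !addnS; apply: cc; rewrite -!addnS leq_add2l.
Qed.

Lemma log_convex_rev L c : log_convex L c -> log_convex L (fun i => c (L - i)%N).
Proof.
move=> [c0 cc]; split=> // i iL.
have -> : (L - i = (L - i.+2).+2)%N by lia.
have -> : (L - i.+1 = (L - i.+2).+1)%N by lia.
by rewrite mulrC; apply: cc; lia.
Qed.

Lemma log_convex_ratio L c i : log_convex L c -> (i.+1 <= L)%N -> c 1%N * c i <= c 0%N * c i.+1.
Proof.
move=> [c0 cc]; elim: i => [|i IH] iL; first by rewrite mulrC.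
have [ci|ci] := ltrP 0 (c i.+1); last first.
  have -> : c i.+1 = 0 by apply/le_anti; rewrite ci c0.
  by rewrite mulr0 mulr_ge0.
rewrite -(ler_pM2r ci).
have h1 := cc i iL; have h2 := IH (ltnW iL).
apply: (@le_trans _ _ (c 1%N * (c i * c i.+2))).
  by rewrite -mulrA -expr2 ler_wpM2l.
by rewrite mulrA [leRHS]mulrAC ler_wpM2r.
Qed.

Lemma log_convex_exp L c i : log_convex L c -> (i.+1 <= L)%N ->
  c 1%N ^+ i.+1 <= c 0%N ^+ i * c i.+1.
Proof.
move=> lc; have [c0 cc] := lc; elim: i => [|i IH] iL; first by rewrite expr1 mul1r.
rewrite exprS; apply: (@le_trans _ _ (c 1%N * (c 0%N ^+ i * c i.+1))).
  by rewrite ler_wpM2l // IH // ltnW.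
rewrite mulrCA exprSr -mulrA ler_wpM2l ?exprn_ge0 //.
exact: log_convex_ratio lc _.
Qed.

(** Moving one unit from the smaller index to the larger does not decrease the product; repeat until
    the smaller index is 1. *)
Lemma log_convex_exchange L c i j : log_convex L c -> (0 < i)%N -> (0 < j)%N -> (i + j <= L)%N ->
  c i * c j <= c 1%N * c (i + j).-1.
Proof.
move=> lc; wlog ij : i j / (i <= j)%N.
  move=> hw i0 j0 ijL; have [ij|/ltnW ji] := leqP i j; first exact: hw.
  by rewrite mulrC addnC; apply: hw; rewrite // addnC.
elim: i j ij => [//|[|i] IH] j ij _ j0 ijL; first by rewrite add1n.
have lcs : log_convex (L - i.+1) (fun m => c (i.+1 + m)%N).
  by apply: log_convex_shift; rewrite subnKC //; lia.
have -> : ((i.+2 + j).-1 = (i.+1 + j.+1).-1)%N by lia.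
apply: le_trans (IH j.+1 _ _ _ _); [|lia|lia|lia|lia].
have := log_convex_ratio (i := (j - i.+1)%N) lcs; rewrite addn0 addn1 !addnS.
rewrite subnKC; last by lia.
by apply; lia.
Qed.

(** A maximum principle: from the first index with a value above 1 the sequence can no longer
    decrease, against h L <= 1. *)
Lemma log_convex_le1 L h i : log_convex L h -> h 0%N <= 1 -> h L <= 1 -> (i <= L)%N -> h i <= 1.
Proof.
move=> [h0 hh] h01 hL iL; rewrite leNgt; apply/negP => hi.
have ex : exists j, (j <= L)%N && (1 < h j) by exists i; rewrite iL.
case: (ex_minnP ex) => j /andP[jL hj] jmin.
case: j => [|j] in jL hj jmin *; first by move: h01; rewrite leNgt hj.
have hj1 : h j <= 1.
  by rewrite leNgt; apply/negP => hj1; have := jmin j; rewrite hj1 (ltnW jL) ltnn => /(_ isT).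
suff inc d : (j.+1 + d <= L)%N -> 1 < h (j.+1 + d)%N /\ h (j + d)%N <= h (j.+1 + d)%N.
  have [] := inc (L - j.+1)%N _; first by rewrite subnKC.
  by rewrite subnKC // ltNge hL.
elim: d => [|d IH] dL; first by rewrite !addn0; split=> //; lra.
have [|h1 h2] := IH; first by lia.
have := hh (j + d)%N; rewrite !addnS !addSn in h1 h2 dL * => /(_ dL) h3.
suff : h (j + d).+1 <= h (j + d).+2 by split=> //; lra.
rewrite -(ler_pM2l (lt_trans ltr01 h1)) -expr2; apply: le_trans h3 _.
exact: ler_wpM2r.
Qed.

(* Either the last ratio is at least lam / del, or by log-convexity all of them
   are smaller and the product is tiny. *)
Lemma log_convex_dichotomy L c lam del : log_convex L.+2 c -> 0 < del -> 0 <= lam -> c 1%N <= lam ->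
  c 1%N * c L.+1 <= del * c L.+2 + lam ^+ L.+2 / del ^+ L.
Proof.
move=> [c0 cc] d0 l0 c1.
have p0 : 0 <= lam ^+ L.+2 / del ^+ L by rewrite divr_ge0 ?exprn_ge0 // ltW.
have [big|small] := lerP (lam * c L.+1) (del * c L.+2).
  apply: le_trans (_ : lam * c L.+1 <= _); first exact: ler_wpM2r.
  by rewrite (le_trans big) // lerDl.
suff h d : (d <= L)%N -> del * c (L - d).+2 <= lam * c (L - d).+1.
  have h2 d : (d <= L)%N -> del ^+ d * c d.+1 <= lam ^+ d * c 1%N.
    elim: d => [|d IH] dL; first by rewrite !mul1r.
    have := h (L - d)%N (leq_subr _ _); rewrite (subKn (ltnW dL)) => h3.
    rewrite !exprSr -mulrA; apply: (@le_trans _ _ (del ^+ d * (lam * c d.+1))).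
      by rewrite ler_wpM2l // exprn_ge0 ?ltW.
    by rewrite mulrCA [leRHS]mulrAC [leRHS]mulrC ler_wpM2l // IH // ltnW.
  have h4 : c L.+1 <= lam ^+ L * c 1%N / del ^+ L.
    by rewrite ler_pdivlMr ?exprn_gt0 // mulrC h2.
  apply: (@le_trans _ _ (lam ^+ L.+2 / del ^+ L)); last by rewrite lerDr mulr_ge0 // ltW.
  apply: (@le_trans _ _ (lam * (lam ^+ L * lam / del ^+ L))); last by rewrite exprS exprSr !mulrA.
  apply: ler_pM => //; apply: le_trans h4 _.
  rewrite ler_wpM2r ?invr_ge0 ?exprn_ge0 ?(ltW d0) //.
  by rewrite ler_wpM2l // exprn_ge0.
elim: d => [|d IH] dL; first by rewrite subn0 ltW.
have := IH (ltnW dL); rewrite (_ : (L - d = (L - d.+1).+1)%N); last by lia.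
set j := (L - d.+1)%N => h1.
have h2 := cc j.+1; have {}h2 := h2 ltac:(lia).
have [ci|ci] := ltrP 0 (c j.+2); last first.
  have -> : c j.+2 = 0 by apply/le_anti; rewrite ci c0.
  by rewrite mulr0 mulr_ge0.
rewrite -(ler_pM2r ci) -mulrA -expr2.
apply: (@le_trans _ _ (del * (c j.+1 * c j.+3))); first by rewrite ler_pM2l.
by rewrite mulrCA mulrC [leRHS]mulrAC ler_wpM2r.
Qed.

End LogConvex.

(** By Lagrange's identity, twice the difference of the two sides is a sum of weighted squares. *)
Lemma weighted_CS (R : realFieldType) (T : finType) (mu f g : T -> R) :
  (forall z, 0 <= mu z) ->
  (\sum_z mu z * f z * g z) ^+ 2 <= (\sum_z mu z * f z ^+ 2) * (\sum_z mu z * g z ^+ 2).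
Proof.
move=> mu0; rewrite -subr_ge0 -(pmulr_rge0 _ (ltr0n R 2)).
suff -> : 2 * ((\sum_z mu z * f z ^+ 2) * (\sum_z mu z * g z ^+ 2) -
    (\sum_z mu z * f z * g z) ^+ 2) =
    \sum_y \sum_z mu y * mu z * (f y * g z - f z * g y) ^+ 2.
  apply: sumr_ge0 => y _; apply: sumr_ge0 => z _.
  exact: mulr_ge0 (mulr_ge0 (mu0 y) (mu0 z)) (sqr_ge0 _).
have pairE (a c : T -> R) : (\sum_z a z) * (\sum_z c z) = \sum_y \sum_z a y * c z.
  by rewrite mulr_suml; apply: eq_bigr => y _; rewrite mulr_sumr.
set A := \sum_z mu z * f z ^+ 2; set C := \sum_z mu z * g z ^+ 2.
set D := \sum_z mu z * f z * g z.
rewrite (_ : 2 * _ = A * C + C * A - 2 * (D * D)); last by ring.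
rewrite /A /C /D !pairE.
rewrite mulr_sumr -big_split -sumrB; apply: eq_bigr => y _ /=.
rewrite mulr_sumr -big_split -sumrB; apply: eq_bigr => z _ /=.
ring.
Qed.

(** * Powers of a symmetric kernel with respect to a measure *)

Section Kernel.
Variables (R : realFieldType) (T : finType) (b : T -> T -> R) (mu : T -> R).
Hypothesis mu0 : forall u, 0 < mu u.
Hypothesis b0 : forall u v, 0 <= b u v.
Hypothesis b_sym : forall u v, b u v = b v u.

(** Composition integrates the middle vertex against [mu], so the identity kernel is the delta
    divided by [mu]. *)
Fixpoint kpow i u v : R :=
  if i is i'.+1 then \sum_z b u z * mu z * kpow i' z v else (u == v)%:R / mu u.

Let mu0' u : 0 <= mu u. Proof. exact: ltW. Qed.

Lemma kpow_ge0 i u v : 0 <= kpow i u v.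
Proof.
elim: i u => [|i IH] u /=; first by rewrite divr_ge0.
by apply: sumr_ge0 => z _; rewrite !mulr_ge0.
Qed.

Lemma kpow0_sum f u : \sum_z kpow 0 u z * mu z * f z = f u.
Proof.
rewrite (bigD1 u) //= eqxx big1 => [|z /negbTE zu]; last by rewrite eq_sym zu !mul0r.
by rewrite addr0 mul1r mulVf ?gt_eqF // mul1r.
Qed.

Lemma kpowD i j u v : kpow (i + j) u v = \sum_z kpow i u z * mu z * kpow j z v.
Proof.
elim: i u => [|i IH] u; first by rewrite kpow0_sum.
rewrite addSn /=; under eq_bigr do rewrite IH mulr_sumr.
rewrite exchange_big; apply: eq_bigr => z _; rewrite !mulr_suml.
by apply: eq_bigr => y _; rewrite !mulrA.
Qed.

Lemma kpow1 u v : kpow 1 u v = b u v.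
Proof.
rewrite /= (bigD1 v) //= eqxx big1 => [|z /negbTE ->]; last by rewrite !mul0r mulr0.
by rewrite addr0 mul1r -mulrA divff ?mulr1 // gt_eqF.
Qed.

Lemma kpow_sym i u v : kpow i u v = kpow i v u.
Proof.
elim: i u v => [|i IH] u v.
  by rewrite /= eq_sym; case: eqP => [->|] //; rewrite !mul0r.
rewrite -[in LHS]addn1 kpowD [RHS](_ : _ = \sum_z b v z * mu z * kpow i z u) //; apply: eq_bigr => z _.
by rewrite kpow1 [b z v]b_sym [kpow i u z]IH; ring.
Qed.

(** Cauchy-Schwarz at the vertex reached after i steps. *)
Lemma kpow_CS i j u v : kpow (i + j) u v ^+ 2 <= kpow (i + i) u u * kpow (j + j) v v.
Proof.
have e k w : kpow (k + k) w w = \sum_z mu z * kpow k w z ^+ 2.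
  by rewrite kpowD; apply: eq_bigr => z _; rewrite [kpow k z w]kpow_sym; ring.
rewrite !e kpowD; apply: le_trans (weighted_CS _ _ mu0').
rewrite le_eqVlt; apply/orP; left; apply/eqP; congr (_ ^+ 2); apply: eq_bigr => z _.
by rewrite [kpow j z v]kpow_sym; ring.
Qed.

Lemma kpow_log_convex L u : log_convex L (fun s => kpow s.*2 u u).
Proof.
split=> [i|i _]; first exact: kpow_ge0.
rewrite (_ : i.+1.*2 = (i + i.+2)%N); last by lia.
by rewrite -[i.+2.*2]addnn -[i.*2]addnn; apply: kpow_CS.
Qed.

Definition closed_walks i : R := \sum_u mu u * kpow i u u.

(** Sidorenko's inequality for the even cycle. The numbers a_i of all walks are log-convex along
    even i, and a_0 is the total mass M; this bounds a_1^(2l) by M^(2l-1) a_(2l), and a_(2l) <= M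
    [closed_walks] by Cauchy-Schwarz. *)
Lemma closed_walks_lower l : (0 < l)%N ->
  (\sum_u \sum_v mu u * mu v * b u v) ^+ l.*2 <= closed_walks l.*2 * (\sum_u mu u) ^+ l.*2.
Proof.
move=> l0; pose M := \sum_u mu u.
pose S i z := \sum_u mu u * kpow i u z.
pose a i := \sum_u \sum_v mu u * mu v * kpow i u v.
have aE i j : a (i + j)%N = \sum_z mu z * S i z * S j z.
  have -> : a (i + j)%N = \sum_u \sum_v \sum_z (mu u * kpow i u z) * mu z * (mu v * kpow j v z).
    apply: eq_bigr => u _; apply: eq_bigr => v _; rewrite kpowD mulr_sumr.
    by apply: eq_bigr => z _; rewrite [kpow j z v]kpow_sym; ring.
  under eq_bigr do rewrite exchange_big.
  rewrite exchange_big; apply: eq_bigr => z _; rewrite /S.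
  rewrite [mu z * \sum_u _]mulr_sumr mulr_suml; apply: eq_bigr => u _.
  by rewrite mulr_sumr; apply: eq_bigr => v _; ring.
have aE2 i : a (i + i)%N = \sum_z mu z * S i z ^+ 2.
  by rewrite aE; apply: eq_bigr => z _; rewrite expr2 mulrA.
have a0 i : 0 <= a i by do 2 (apply: sumr_ge0 => ? _); rewrite !mulr_ge0 // kpow_ge0.
have aCS i j : a (i + j)%N ^+ 2 <= a (i + i)%N * a (j + j)%N.
  by rewrite aE !aE2; apply: weighted_CS.
have lc : log_convex l (fun i => a i.*2).
  split=> // i _; rewrite -[i.+2.*2]addnn -[i.*2]addnn.
  by rewrite (_ : i.+1.*2 = (i + i.+2)%N) ?aCS // -addnn !addSn !addnS.
have aM : a 0%N = M.
  apply: eq_bigr => u _; rewrite (bigD1 u) //= eqxx big1 => [|v /negbTE vu].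
    by rewrite addr0 mul1r -mulrA divff ?mulr1 // gt_eqF.
  by rewrite eq_sym vu mul0r mulr0.
have a1 : a 1%N = \sum_u \sum_v mu u * mu v * b u v.
  by apply: eq_bigr => u _; apply: eq_bigr => v _; rewrite kpow1.
have M0 : 0 <= M by apply: sumr_ge0.
have up : a l.*2 <= M * closed_walks l.*2.
  rewrite -addnn aE2 /closed_walks.
  have -> : \sum_u mu u * kpow (l + l) u u = \sum_z mu z * \sum_u mu u * kpow l u z ^+ 2.
    have -> : \sum_u mu u * kpow (l + l) u u = \sum_u \sum_z mu z * (mu u * kpow l u z ^+ 2).
      apply: eq_bigr => u _; rewrite kpowD mulr_sumr; apply: eq_bigr => z _.
      by rewrite [kpow l z u]kpow_sym; ring.
    by rewrite exchange_big; apply: eq_bigr => z _; rewrite mulr_sumr.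
  rewrite mulr_sumr; apply: ler_sum => z _; rewrite [leRHS]mulrCA ler_wpM2l //.
  have := weighted_CS (fun=> 1) (fun u => kpow l u z) mu0'.
  under eq_bigr do rewrite mulr1.
  by under [in X in _ <= X * _ -> _]eq_bigr do rewrite expr1n mulr1.
have low : a 2%N ^+ l <= M ^+ l.-1 * a l.*2.
  by have := log_convex_exp lc (i := l.-1); rewrite prednK // double0 aM; apply.
have a12 : a 1%N ^+ 2 <= M * a 2%N by have := aCS 0%N 1%N; rewrite aM.
rewrite -a1 (_ : a 1%N ^+ l.*2 = (a 1%N ^+ 2) ^+ l); last by rewrite -exprM mul2n.
apply: (@le_trans _ _ ((M * a 2%N) ^+ l)); first by rewrite lerXn2r ?nnegrE ?sqr_ge0 ?mulr_ge0.
rewrite exprMn (_ : M ^+ l.*2 = M ^+ l * (M ^+ l.-1 * M)); last first.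
  by rewrite -exprSr prednK // -exprD addnn.
rewrite mulrCA ler_wpM2l ?exprn_ge0 //; apply: le_trans low _.
by rewrite [leRHS]mulrCA ler_wpM2l ?exprn_ge0 // mulrC.
Qed.

(** A diagonal entry is a single term of its row sum, and bounds on row sums multiply under
    composition. *)
Lemma closed_walks_upper i (sg : R) : 0 <= sg -> (forall u, \sum_v b u v * mu v <= sg) ->
  closed_walks i <= #|T|%:R * sg ^+ i.
Proof.
move=> sg0 row.
have h u : \sum_v kpow i u v * mu v <= sg ^+ i.
  elim: i u => [|i IH] u.
    by under eq_bigr do rewrite -[_ * mu _]mulr1; rewrite (kpow0_sum (fun=> 1)).
  have -> : \sum_v kpow i.+1 u v * mu v = \sum_z b u z * mu z * \sum_v kpow i z v * mu v.
    under eq_bigr do rewrite /= mulr_suml; rewrite exchange_big.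
    by apply: eq_bigr => z _; rewrite mulr_sumr; apply: eq_bigr => v _; rewrite mulrA.
  rewrite exprS; apply: (@le_trans _ _ (\sum_z b u z * mu z * sg ^+ i)).
    by apply: ler_sum => z _; rewrite ler_wpM2l ?mulr_ge0.
  by rewrite -mulr_suml ler_wpM2r ?exprn_ge0.
rewrite -sum1_card natr_sum mulr_suml; apply: ler_sum => u _; rewrite mul1r.
apply: le_trans (h u); rewrite (bigD1 u) //= mulrC lerDl.
by apply: sumr_ge0 => v _; rewrite mulr_ge0 ?kpow_ge0.
Qed.

(** For even g this is [log_convex_exchange]. For odd g, Cauchy-Schwarz replaces each factor by the
    two neighbouring even lengths, and the four factors regroup into two even cases. *)
Lemma kpow_revisit l u g : (2 <= g)%N -> (g + 2 <= l.*2)%N ->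
  kpow g u u * kpow (l.*2 - g) u u <= kpow 2 u u * kpow l.-1.*2 u u.
Proof.
move=> g2 gl; pose c s := kpow s.*2 u u.
have lc : log_convex l c := kpow_log_convex l u.
have c0 s : 0 <= c s by apply: kpow_ge0.
have ex i j : (0 < i)%N -> (0 < j)%N -> (i + j = l)%N -> c i * c j <= kpow 2 u u * kpow l.-1.*2 u u.
  by move=> i0 j0 ij; have := log_convex_exchange lc i0 j0; rewrite ij; apply.
have [i gE] : exists i, g = (odd g + i.*2)%N by exists g./2; rewrite odd_double_half.
case: (odd g) gE => gE.
  have gi : g = (i + i.+1)%N by lia.
  have lg : (l.*2 - g = (l - i.+1) + (l - i))%N by lia.
  have h1 := kpow_CS i i.+1 u u; have h2 := kpow_CS (l - i.+1) (l - i) u u.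
  rewrite !addnn in h1 h2; rewrite lg {1}gi.
  have e1 := ex i (l - i)%N ltac:(lia) ltac:(lia) ltac:(lia).
  have e2 := ex i.+1 (l - i.+1)%N ltac:(lia) ltac:(lia) ltac:(lia).
  rewrite -ler_sqr ?nnegrE ?mulr_ge0 ?kpow_ge0 // exprMn.
  apply: (@le_trans _ _ ((c i * c i.+1) * (c (l - i.+1)%N * c (l - i)%N))).
    by apply: ler_pM; rewrite ?sqr_ge0.
  rewrite (_ : c i * c i.+1 * (c (l - i.+1)%N * c (l - i)%N) =
    (c i * c (l - i)%N) * (c i.+1 * c (l - i.+1)%N)); last by ring.
  by rewrite expr2 ler_pM // mulr_ge0.
rewrite add0n in gE; rewrite gE (_ : (l.*2 - i.*2 = (l - i).*2)%N); last by lia.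
by apply: ex; lia.
Qed.

End Kernel.

Lemma kpow_le (R : realFieldType) (T : finType) (b b' : T -> T -> R) (mu : T -> R) i u v :
  (forall u, 0 < mu u) -> (forall u v, 0 <= b u v <= b' u v) -> kpow b mu i u v <= kpow b' mu i u v.
Proof.
move=> mu0 bb; elim: i u => [|i IH] u //=.
apply: ler_sum => z _; have /andP[b0 b1] := bb u z; apply: ler_pM => //.
- by rewrite mulr_ge0 // ltW.
- by apply: kpow_ge0 => // x y; case/andP: (bb x y).
- by rewrite ler_wpM2r // ltW.
Qed.

Lemma bernoulli_le (R : realFieldType) (x : R) n : 0 <= x <= 1 -> 1 - n%:R * x <= (1 - x) ^+ n.
Proof.
case/andP=> x0 x1; elim: n => [|n IH]; first by rewrite mul0r subr0 expr0.
rewrite exprS; apply: (@le_trans _ _ ((1 - x) * (1 - n%:R * x))); last by rewrite ler_wpM2l // subr_ge0.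
rewrite -natr1; have : 0 <= n%:R :> R by []. nra.
Qed.

(** * A subgraph whose closed walks are balanced over its edges *)

Section EdgeBalanced.
Variables (R : realFieldType) (T : finType) (B : T -> T -> R) (mu : T -> R).
Variables (e sg : R) (l d : nat).
Hypothesis mu0 : forall u, 0 < mu u.
Hypothesis B0 : forall u v, 0 <= B u v.
Hypothesis B_sym : forall u v, B u v = B v u.
Hypothesis B_irr : forall u, B u u = 0.
Hypothesis sg0 : 0 <= sg.
Hypothesis e0 : 0 < e.
Hypothesis row : forall u, \sum_v B u v <= sg * mu u.
Hypothesis mu_sum : \sum_u mu u <= e / 2.
Hypothesis B_sum : e <= \sum_u \sum_v B u v.
Hypothesis l0 : (0 < l)%N.
Hypothesis d_large : #|T|%:R * sg ^+ l.*2 <= 2 ^+ d.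

(** Both orientations are required, so any [H] gives a symmetric weight and deleting one ordered
    pair removes the whole edge. *)
Definition restrict (H : {set T * T}) u v : R :=
  if ((u, v) \in H) && ((v, u) \in H) then B u v else 0.
Definition density (H : {set T * T}) u v : R := restrict H u v / (mu u * mu v).

Let total H := \sum_u \sum_v restrict H u v.
Let W H := closed_walks (density H) mu l.*2.
Let q H := kpow (density H) mu.

Let mu0' u : 0 <= mu u. Proof. exact: ltW. Qed.

Lemma restrict_ge0 H u v : 0 <= restrict H u v. Proof. by rewrite /restrict; case: ifP. Qed.
Lemma restrict_sym H u v : restrict H u v = restrict H v u.
Proof. by rewrite /restrict andbC B_sym. Qed.
Lemma restrict_le H u v : restrict H u v <= B u v.
Proof. by rewrite /restrict; case: ifP. Qed.
Lemma density_ge0 H u v : 0 <= density H u v.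
Proof. by rewrite divr_ge0 ?restrict_ge0 // mulr_ge0. Qed.
Lemma density_sym H u v : density H u v = density H v u.
Proof. by rewrite /density restrict_sym mulrC [mu v * _]mulrC mulrC. Qed.
Lemma densityK H u v : mu u * mu v * density H u v = restrict H u v.
Proof. by rewrite /density mulrC -mulrA mulVf ?mulr1 // mulf_neq0 ?gt_eqF. Qed.

Lemma W_step H : W H = \sum_u \sum_v restrict H u v * q H l.*2.-1 v u.
Proof.
have [n nE] : exists n, l.*2 = n.+1 by exists l.*2.-1; rewrite prednK // double_gt0.
rewrite /W /closed_walks nE succnK.
apply: eq_bigr => u _; rewrite mulr_sumr.
by apply: eq_bigr => v _; rewrite -densityK mulrA; congr (_ * _); ring.
Qed.

Lemma W_lower H : (2 * total H / e) ^+ l.*2 <= W H.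
Proof.
have t0 : 0 <= total H by do 2 (apply: sumr_ge0 => ? _); apply: restrict_ge0.
have := closed_walks_lower mu0 (density_ge0 H) (density_sym H) l0.
have -> : \sum_u \sum_v mu u * mu v * density H u v = total H.
  by apply: eq_bigr => u _; apply: eq_bigr => v _; rewrite densityK.
rewrite -/(W H) => h.
have W0 : 0 <= W H by apply: sumr_ge0 => u _; rewrite mulr_ge0 ?kpow_ge0 // => *; apply: density_ge0.
have M0 : 0 <= \sum_u mu u by apply: sumr_ge0.
have {}h : total H ^+ l.*2 <= W H * (e / 2) ^+ l.*2.
  apply: le_trans h _; rewrite ler_wpM2l //.
  by rewrite lerXn2r // nnegrE // divr_ge0 // ltW.
rewrite (_ : 2 * total H / e = total H / (e / 2)); last by field; rewrite gt_eqF.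
by rewrite expr_div_n ler_pdivrMr // exprn_gt0 // divr_gt0.
Qed.

Lemma W_upper H : W H <= 2 ^+ d.
Proof.
apply: le_trans d_large; apply: closed_walks_upper; rewrite //; first exact: density_ge0.
move=> u; rewrite (_ : \sum_v _ = (\sum_v restrict H u v) / mu u); last first.
  by rewrite mulr_suml; apply: eq_bigr => v _; rewrite -densityK; field; rewrite gt_eqF.
rewrite ler_pdivrMr //; apply: le_trans (row u).
by apply: ler_sum => v _; apply: restrict_le.
Qed.

Lemma restrict_rem H u v x y : u != v ->
  restrict (H :\ (u, v)) x y = restrict H x y -
    restrict H u v * (((x == u) && (y == v))%:R + ((x == v) && (y == u))%:R).
Proof.
move=> uv; rewrite /restrict !inE !xpair_eqE.
have [->|xu] := eqVneq x u; have [->|yv] := eqVneq y v; rewrite /= ?eqxx ?andbT.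
- by rewrite (negbTE uv) /= addr0 mulr1 subrr.
- by rewrite (negbTE uv) !andbF /= addr0 mulr0 subr0.
- have [->|xv] := eqVneq x v; rewrite /= ?(negbTE uv) ?andbF /= ?addr0 ?mulr0 ?subr0 //.
  by rewrite eq_sym (negbTE uv) addr0 mulr0 subr0.
have [->|xv] := eqVneq x v; have [->|yu] := eqVneq y u; rewrite /= ?andbF /= ?addr0 ?mulr0 ?subr0 //.
by rewrite add0r mulr1 andbC B_sym subrr.
Qed.

Lemma sum_indicator (f : T -> T -> R) u v :
  \sum_x \sum_y ((x == u) && (y == v))%:R * f x y = f u v.
Proof.
rewrite (bigD1 u) //= (bigD1 v) //= !eqxx mul1r !big1 ?addr0 //.
  by move=> x /negbTE xu; rewrite big1 // => y _; rewrite xu mul0r.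
by move=> y /negbTE yv; rewrite yv mul0r.
Qed.

(** The minimiser is compared with two competitors. Against the full graph, [W_upper] and [W_lower]
    force half of the weight to survive; against the deletion of one edge, minimality bounds the
    walks through that edge. *)
Lemma edge_balanced : exists H,
  [/\ e / 2 <= total H, 1 <= W H &
   forall u v, 0 < restrict H u v -> q H l.*2.-1 u v <= 2 * (d + l.*2)%:R * W H / e].
Proof.
pose A := (d + l.*2)%N.
have total0 : total setT = \sum_u \sum_v B u v.
  by apply: eq_bigr => u _; apply: eq_bigr => v _; rewrite /restrict !inE.
have P0 : 0 < total setT by rewrite total0 (lt_le_trans e0).
case: (@arg_minP _ R _ setT (fun H => 0 < total H) (fun H => W H / total H ^+ A) P0) => H tH Hmin.
have W0 H' : 0 <= W H'.
  by apply: sumr_ge0 => u _; rewrite mulr_ge0 ?kpow_ge0 // => *; apply: density_ge0.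
have tot_le H' : total H' <= total setT.
  by rewrite total0; do 2 (apply: ler_sum => ? _); apply: restrict_le.
have half : e / 2 <= total H.
  rewrite leNgt; apply/negP => small.
  have := Hmin _ P0; rewrite ler_pdivrMr ?exprn_gt0 // => h.
  have t1 : total setT >= e by rewrite total0.
  have h1 := W_lower H.
  have h2 : (2 * total H / total setT) ^+ l.*2 <= W H.
    apply: le_trans h1; rewrite lerXn2r ?nnegrE ?divr_ge0 ?mulr_ge0 ?(ltW tH) ?(ltW P0) ?(ltW e0) //.
    by rewrite ler_wpM2l ?mulr_ge0 ?(ltW tH) // lef_pV2.
  set y := total H / total setT.
  have y0 : 0 < y by rewrite divr_gt0.
  have y1 : 2 * y < 1 by rewrite /y mulrA ltr_pdivrMr // mul1r; lra.
  (* Together with W H >= (2y)^(2l) this is impossible for 2y < 1, since 2^d y^(d+2l) = (2y)^(2l)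
     (2y)^d / 2^(2l). *)
  have h3 : W H <= 2 ^+ d * y ^+ A.
    apply: le_trans h _; rewrite mulrAC -mulrA -expr_div_n ler_wpM2r ?W_upper //.
    by rewrite exprn_ge0 // ltW.
  have h4 : (2 * y) ^+ l.*2 <= (2 * y) ^+ l.*2 * (y ^+ d * 2 ^+ d / 2 ^+ l.*2).
    apply: le_trans (_ : W H <= _); first by rewrite /y mulrA.
    apply: le_trans h3 _; rewrite /A exprD [(2 * y) ^+ _]exprMn le_eqVlt; apply/orP; left; apply/eqP.
    by have e2 : (2 : R) ^+ l.*2 != 0 by [rewrite expf_neq0 ?pnatr_eq0]; field; rewrite ?e2.
  have : 1 <= (2 * y) ^+ d / 2 ^+ l.*2.
    have p0 : 0 < (2 * y) ^+ l.*2 by rewrite exprn_gt0 // mulr_gt0.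
    by move: h4; rewrite (ler_pMr _ p0) [(2 * y) ^+ d]exprMn [2 ^+ d * _]mulrC.
  rewrite ler_pdivlMr ?exprn_gt0 // mul1r leNgt => /negP; apply.
  apply: (@le_lt_trans _ _ 1); first by rewrite exprn_ile1 ?(ltW y1) // mulr_ge0 // (ltW y0).
  by rewrite exprn_egt1 ?ltr1n // double_eq0 -lt0n.
exists H; split=> //.
  apply: le_trans (W_lower H); apply: exprn_ege1.
  by rewrite ler_pdivlMr // mul1r; lra.
move=> u v uv0.
have uv : u != v.
  apply: contraTneq uv0 => ->; rewrite /restrict B_irr; case: ifP => _; by rewrite ltxx.
set H' := H :\ (u, v); set x := 2 * restrict H u v / total H.
have tot' : total H' = total H - 2 * restrict H u v.
  rewrite /total (_ : \sum_x \sum_y restrict H' x y = \sum_x \sum_y (restrict H x y -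
     (((x == u) && (y == v))%:R * restrict H u v + ((x == v) && (y == u))%:R * restrict H u v))).
    under eq_bigr do rewrite sumrB big_split /=.
    rewrite sumrB big_split /= !sum_indicator; ring.
  by apply: eq_bigr => a _; apply: eq_bigr => c _; rewrite restrict_rem //; ring.
(* Only the loss in one distinguished step of the walk is counted, in its two orientations; the
   other steps are bounded by those of [H]. *)
have W' : W H' <= W H - 2 * restrict H u v * q H l.*2.-1 u v.
  apply: (@le_trans _ _ (\sum_x \sum_y restrict H' x y * q H l.*2.-1 y x)).
    rewrite W_step; apply: ler_sum => a _; apply: ler_sum => c _.
    rewrite ler_wpM2l ?restrict_ge0 //; apply: kpow_le => // s t; rewrite density_ge0 /=.
    rewrite ler_wpM2r ?invr_ge0 ?mulr_ge0 //; rewrite restrict_rem // lerBlDr lerDl.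
    by rewrite mulr_ge0 ?restrict_ge0 // addr_ge0.
  rewrite W_step (_ : \sum_x \sum_y restrict H' x y * q H l.*2.-1 y x = \sum_x \sum_y
    (restrict H x y * q H l.*2.-1 y x - (((x == u) && (y == v))%:R * (restrict H u v * q H l.*2.-1 y x)
    + ((x == v) && (y == u))%:R * (restrict H u v * q H l.*2.-1 y x)))).
    under eq_bigr do rewrite sumrB big_split /=.
    rewrite sumrB big_split /= !sum_indicator.
    have -> : q H l.*2.-1 v u = q H l.*2.-1 u v by apply: kpow_sym (density_sym H) _ _ _.
    lra.
  by apply: eq_bigr => a _; apply: eq_bigr => c _; rewrite restrict_rem //; ring.
have q_le : 2 * restrict H u v * q H l.*2.-1 u v <= A%:R * x * W H.
  have x01 : 0 <= x <= 1.
    rewrite divr_ge0 ?mulr_ge0 ?restrict_ge0 ?(ltW tH) //= ler_pdivrMr // mul1r.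
    by rewrite -subr_ge0 -tot'; do 2 (apply: sumr_ge0 => ? _); apply: restrict_ge0.
  (* Minimality gives W H (1 - x)^A <= W H', and Bernoulli's inequality makes this linear in x. If
     the deletion leaves no weight, H' is not a competitor, but then x = 1 and W H' >= 0
     suffices. *)
  have [tH'|tH'] := ltrP 0 (total H').
    have := Hmin _ tH'; rewrite ler_pdivlMr ?exprn_gt0 // mulrAC -mulrA -expr_div_n.
    have -> : total H' / total H = 1 - x by rewrite tot' /x; field; rewrite gt_eqF.
    have := ler_wpM2l (W0 H) (bernoulli_le A x01).
    move=> h1 h2; have := le_trans h1 (le_trans h2 W'); rewrite mulrBr mulr1; lra.
  have tz : total H' = 0.
    by apply/le_anti; rewrite tH' /=; do 2 (apply: sumr_ge0 => ? _); apply: restrict_ge0.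
  have -> : x = 1.
    move: tot'; rewrite tz => /eqP; rewrite eq_sym subr_eq0 => /eqP t2.
    by rewrite /x -t2 divff // gt_eqF.
  have A1 : 1 <= A%:R :> R by rewrite ler1n /A; lia.
  rewrite mulr1; apply: (@le_trans _ _ (W H)); first by have := W0 H'; lra.
  by rewrite ler_peMl.
have h5 : q H l.*2.-1 u v <= A%:R * W H / total H.
  rewrite -(ler_pM2l uv0) -(ler_pM2l (ltr0n R 2)) mulrA; apply: le_trans q_le _.
  by rewrite /x le_eqVlt; apply/orP; left; apply/eqP; field; rewrite gt_eqF.
apply: le_trans h5 _; rewrite -[2 * _]mulrC -!mulrA ler_wpM2l //.
rewrite mulrCA ler_wpM2l //.
by rewrite -[leLHS]mul1r ler_pdivrMr // mulrAC ler_pdivlMr // mul1r; lra.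
Qed.

End EdgeBalanced.

Ltac nlia := repeat match goal with
  | H : is_true (@Order.le ?d ?T _ _) |- _ => clear H
  | H : is_true (@Order.lt ?d ?T _ _) |- _ => clear H
  | H : forall _, _ |- _ => clear H
  | H : @eq ?T _ _ |- _ => lazymatch T with nat => fail | bool => fail | _ => clear H end
  end; lia.

(** Compares the powers of [V] on the two sides in [diag_pred_le]. *)
Lemma gap_exponent l : (l.*2 * l.-2 <= l.*2.-1 * l.-1)%N.
Proof. by case: l => [|[|m]] //=; nia. Qed.

(** * Weights of walks across a gap of given length *)

Section KernelBounds.
Variables (R : realFieldType) (T : finType) (b : T -> T -> R) (mu : T -> R).
Variables (e sg kap k1 L y V : R) (l : nat).
Hypothesis mu0 : forall u, 0 < mu u.
Hypothesis b0 : forall u v, 0 <= b u v.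
Hypothesis b_sym : forall u v, b u v = b v u.
Hypothesis l2 : (2 <= l)%N.
Hypothesis e0 : 0 < e.
Hypothesis sg1 : 1 <= sg.
Hypothesis k11 : 1 <= k1.
Hypothesis L1 : 1 <= L.
Hypothesis y1 : 1 <= y.
Hypothesis V1 : 1 <= V.
Hypothesis kap0 : 0 <= kap.
Local Notation n := (#|T|%:R : R).
Local Notation q := (kpow b mu).
Local Notation W := (closed_walks b mu l.*2).
Hypothesis row : forall u, \sum_v b u v * mu v <= sg.
Hypothesis b_le : forall u v, b u v * mu v <= kap.
Hypothesis mu_low : forall u, e <= sg * n * mu u.
Hypothesis yE : y ^+ l.*2.-1 = n.
Hypothesis VE : V ^+ l.*2 = W.
Hypothesis kap_small : kap * n <= k1 * y ^+ l.-1.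
Hypothesis balanced : forall u v, 0 < b u v -> q l.*2.-1 u v <= L * W / e.

Let mu0' u : 0 <= mu u. Proof. exact: ltW. Qed.
Let sg0 : 0 < sg. Proof. exact: lt_le_trans sg1. Qed.
Let k10 : 0 < k1. Proof. exact: lt_le_trans k11. Qed.
Let L0 : 0 < L. Proof. exact: lt_le_trans L1. Qed.
Let y0 : 0 < y. Proof. exact: lt_le_trans y1. Qed.
Let V0 : 0 < V. Proof. exact: lt_le_trans V1. Qed.
Let q0 i u v : 0 <= q i u v. Proof. exact: kpow_ge0. Qed.

Lemma inv_mu_le u : (mu u)^-1 <= sg * n / e.
Proof. by rewrite ler_pdivlMr // mulrC ler_pdivrMr // mu_low. Qed.

Lemma kpow2_le u : mu u * q 2 u u <= kap * sg.
Proof.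
rewrite (_ : q 2 u u = \sum_z b u z * mu z * b z u); last first.
  by rewrite -[2%N]/(1 + 1)%N kpowD //; apply: eq_bigr => z _; rewrite !kpow1.
rewrite mulr_sumr; apply: (@le_trans _ _ (\sum_z kap * (b u z * mu z))).
  apply: ler_sum => z _; rewrite mulrCA mulrC ler_wpM2r ?mulr_ge0 //.
  by rewrite mulrC b_le.
by rewrite -mulr_sumr ler_wpM2l.
Qed.

(** The first step contributes at most [sg]; the remaining 2l - 1 steps join the ends of an edge,
    where balance applies. *)
Lemma kpow_last_le u : q l.*2 u u <= sg * L * W / e.
Proof.
have l0 : l.*2 = l.*2.-1.+1 by rewrite prednK // double_gt0; nlia.
have W0 : 0 <= W by apply: sumr_ge0 => v _; rewrite mulr_ge0.
have h z : b u z * mu z * q l.*2.-1 z u <= b u z * mu z * (L * W / e).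
  have := b0 u z; rewrite le_eqVlt => /orP[/eqP <-|bz]; first by rewrite !mul0r.
  by rewrite ler_wpM2l ?mulr_ge0 // balanced // b_sym.
rewrite {1}l0; apply: (@le_trans _ _ (\sum_z b u z * mu z * (L * W / e))).
  by apply: ler_sum => z _; apply: h.
rewrite -mulr_suml -!mulrA ler_wpM2r ?row // !mulr_ge0 ?invr_ge0 // ltW //.
Qed.

Let C := k1 * sg ^+ 2 * L.
Let F g := C / e * n * V * (V / y) ^+ g.

Let C_ge1 : k1 * sg ^+ 2 <= C.
Proof. by rewrite ler_peMr // mulr_ge0 ?exprn_ge0 // ltW. Qed.
Let C_ge2 : sg * L <= C.
Proof.
rewrite ler_wpM2r ?(ltW L0) // expr2 mulrA ler_peMl ?(ltW sg0) //.
by rewrite mulr_ege1.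
Qed.
Let C0 : 0 < C. Proof. by rewrite !mulr_gt0 ?exprn_gt0. Qed.
Let Ce0 : 0 <= C / e. Proof. by rewrite ltW // divr_gt0. Qed.
Let n0 : 0 < n. Proof. by rewrite -yE exprn_gt0. Qed.
Let F0 g : 0 < F g. Proof. by rewrite !mulr_gt0 ?invr_gt0 ?exprn_gt0 ?divr_gt0. Qed.

Lemma FE g : (g < l.*2)%N -> F g = C / e * y ^+ (l.*2.-1 - g) * V ^+ g.+1.
Proof.
move=> gl; rewrite /F -yE (_ : l.*2.-1 = (l.*2.-1 - g + g)%N) ?addnK ?exprD; last by nlia.
by rewrite expr_div_n exprS; field; rewrite !expf_neq0 ?gt_eqF.
Qed.

Lemma F_lower g (x : R) : (g < l.*2)%N -> x <= C / e * y ^+ (l.*2.-1 - g) -> x <= F g.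
Proof.
move=> gl /le_trans; apply; rewrite FE // ler_peMr ?exprn_ege1 //.
by rewrite !mulr_ge0 ?invr_ge0 ?exprn_ge0 // ltW.
Qed.

Lemma kpow0_le u v : q 0 u v <= F 0.
Proof.
apply: F_lower; first by rewrite double_gt0; nlia.
rewrite subn0 yE /=; apply: (@le_trans _ _ (mu u)^-1).
  by case: eqP => _; rewrite ?mul1r // mul0r invr_ge0.
apply: le_trans (inv_mu_le u) _; rewrite mulrAC ler_wpM2r // ler_wpM2r ?invr_ge0 ?(ltW e0) //.
apply: le_trans C_ge2; exact: ler_peMr (ltW sg0) L1.
Qed.

Lemma kap_inv_mu u (a : R) : 0 <= a -> a <= sg -> kap * a / mu u <= C / e * y ^+ l.-1.
Proof.
move=> a0 asg; apply: (@le_trans _ _ (kap * sg * (sg * n / e))).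
  by apply: ler_pM; rewrite ?mulr_ge0 ?invr_ge0 ?inv_mu_le // ler_wpM2l.
rewrite (_ : kap * sg * (sg * n / e) = (kap * n) * (sg ^+ 2 / e)); last by ring.
apply: (@le_trans _ _ (k1 * y ^+ l.-1 * (sg ^+ 2 / e))).
  by rewrite ler_wpM2r // divr_ge0 ?exprn_ge0 // ltW.
rewrite (_ : k1 * y ^+ l.-1 * (sg ^+ 2 / e) = k1 * sg ^+ 2 / e * y ^+ l.-1); last by ring.
by rewrite ler_wpM2r ?exprn_ge0 ?(ltW y0) // ler_wpM2r ?invr_ge0 ?(ltW e0).
Qed.

Lemma y_mono i j : (i <= j)%N -> C / e * y ^+ i <= C / e * y ^+ j.
Proof. by move=> ij; rewrite ler_wpM2l ?Ce0 // ler_weXn2l. Qed.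

Lemma kpow1_le u v : q 1 u v <= F 1.
Proof.
rewrite kpow1 //; apply: F_lower; first by nlia.
apply: le_trans (y_mono (i := l.-1) _); last by nlia.
apply: le_trans (kap_inv_mu v ler01 sg1); rewrite mulr1.
by rewrite -[leLHS](mulfK (lt0r_neq0 (mu0 v)) (b u v)) ler_wpM2r ?invr_ge0 ?b_le.
Qed.

Lemma diag2_le u : q 2 u u <= C / e * y ^+ l.-1.
Proof.
apply: le_trans (kap_inv_mu u (ltW sg0) (lexx _)).
by rewrite ler_pdivlMr // mulrC kpow2_le.
Qed.

(** Log-convexity read backwards from length 2l gives q_(2l-2)^(l-1) <= q_(2l)^(l-2) q_2; balance
    bounds the first factor and the codegree condition the second. *)
Lemma diag_pred_le u : q l.-1.*2 u u <= F l.-1.*2.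
Proof.
rewrite FE; last by nlia.
rewrite (_ : l.*2.-1 - l.-1.*2 = 1)%N; last by nlia.
rewrite (_ : l.-1.*2.+1 = l.*2.-1)%N; last by nlia.
rewrite expr1.
have lc := log_convex_rev (log_convex_shift (L := l.-1) (j := 1) (kpow_log_convex mu0 b0 b_sym _ u)).
have := log_convex_exp lc (i := l.-2); rewrite (_ : l.-2.+1 = l.-1)%N; last by nlia.
rewrite leqnn subn0 subnn addn0 !add1n (_ : (l.-1 - 1).+1 = l.-1)%N; last by nlia.
rewrite prednK; last by nlia.
move=> /(_ isT) h.
have X0 : 0 <= C / e * y * V ^+ l.*2.-1.
  by rewrite !mulr_ge0 ?invr_ge0 ?exprn_ge0 ?ltW.
rewrite -(@ler_pXn2r _ l.-1) ?nnegrE //; last by nlia.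
apply: le_trans h _.
apply: (@le_trans _ _ ((C / e * V ^+ l.*2) ^+ l.-2 * (C / e * y ^+ l.-1))).
  apply: ler_pM; rewrite ?exprn_ge0 ?diag2_le //.
  rewrite lerXn2r ?nnegrE ?mulr_ge0 ?invr_ge0 ?exprn_ge0 ?(ltW k10) ?(ltW sg0) ?(ltW L0) ?(ltW e0) ?(ltW V0) //.
  apply: le_trans (kpow_last_le u) _; rewrite VE mulrAC ler_wpM2r //.
    by rewrite -VE exprn_ge0 ?(ltW V0).
  by rewrite ler_wpM2r ?invr_ge0 ?(ltW e0).
rewrite [leRHS]exprMn [(C / e * y) ^+ _]exprMn [(C / e * _) ^+ _]exprMn.
have -> : (C / e) ^+ l.-2 * (V ^+ l.*2) ^+ l.-2 * (C / e * y ^+ l.-1) =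
  (C / e) ^+ l.-1 * y ^+ l.-1 * (V ^+ l.*2) ^+ l.-2.
  rewrite (_ : (C / e) ^+ l.-1 = (C / e) ^+ l.-2 * (C / e)); first by ring.
  by rewrite -exprSr; congr (_ ^+ _); nlia.
apply: ler_wpM2l.
  by apply: mulr_ge0; apply: exprn_ge0 => //; apply: ltW.
rewrite -!exprM ler_weXn2l //; exact: gap_exponent.
Qed.

(** Division by the geometric sequence [F] preserves log-convexity, so the lengths 2 and 2l - 2
    suffice. *)
Lemma diag_le s u : (0 < s)%N -> (s < l)%N -> q s.*2 u u <= F s.*2.
Proof.
move=> s0 sl; pose h i := q (1 + i).*2 u u / F (1 + i).*2.
have lc : log_convex l.-2 h.
  have [c0 cc] := log_convex_shift (L := l.-2) (j := 1) (kpow_log_convex mu0 b0 b_sym _ u).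
  split=> [i|i il]; first by rewrite divr_ge0 // ltW.
  rewrite /h expr_div_n [leRHS]mulrACA -invfM.
  have -> : F (1 + i).*2 * F (1 + i.+2).*2 = F (1 + i.+1).*2 ^+ 2.
    rewrite /F; set z := V / y; have -> : z ^+ (1 + i.+2).*2 = z ^+ 4 * z ^+ (1 + i).*2.
      by rewrite -exprD; congr (_ ^+ _); nlia.
    have -> : z ^+ (1 + i.+1).*2 = z ^+ 2 * z ^+ (1 + i).*2.
      by rewrite -exprD; congr (_ ^+ _); nlia.
    ring.
  by rewrite ler_wpM2r ?invr_ge0 ?exprn_ge0 ?(ltW (F0 _)) // cc.
have := log_convex_le1 (i := s.-1) lc; rewrite /h !addn0 !add1n (prednK s0).
rewrite (_ : l.-2.+1 = l.-1)%N; last by nlia.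
rewrite !ler_pdivrMr // !mul1r; apply.
- by apply: F_lower; [nlia | apply: le_trans (diag2_le u) (y_mono _); nlia].
- exact: diag_pred_le.
- by nlia.
Qed.

(** Gaps 0 and 1 are direct. A longer gap is cut near its middle, and Cauchy-Schwarz reduces it to
    closed walks of even length at most 2l - 2. *)
Lemma kpow_gap_le g u v : (g < l.*2.-1)%N -> q g u v <= C / e * n * V * (V / y) ^+ g.
Proof.
rewrite -/(F g); case: g => [|[|g]] gl; [exact: kpow0_le|exact: kpow1_le|].
have [s gE] : exists s, g.+2 = (odd g + s.+1.*2)%N.
  by exists g./2; rewrite doubleS !addnS odd_double_half.
rewrite gE; have sl : (odd g + s.+1 < l)%N by case: (odd g) gE => ? ; nlia.
rewrite -ler_sqr ?nnegrE ?(ltW (F0 _)) //.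
have -> : (odd g + s.+1.*2 = s.+1 + (odd g + s.+1))%N by nlia.
apply: le_trans (kpow_CS mu0 b_sym _ _ u v) _; rewrite !addnn.
apply: (@le_trans _ _ (F s.+1.*2 * F (odd g + s.+1).*2)).
  by apply: ler_pM => //; apply: diag_le; nlia.
rewrite /F; set z := V / y; rewrite (_ : (odd g + s.+1).*2 = odd g + (odd g + s.+1.*2))%N; last by nlia.
rewrite (_ : s.+1 + (odd g + s.+1) = odd g + s.+1.*2)%N; last by nlia.
by rewrite !exprD le_eqVlt; apply/orP; left; apply/eqP; ring.
Qed.

(** At each vertex, [kpow_revisit] followed by [log_convex_dichotomy] for mu(u) times the even
    return weights; the entry at index 1 is at most kap sg by [kpow2_le]. *)
Lemma revisit_le del g : 0 < del -> (2 <= g)%N -> (g + 2 <= l.*2)%N ->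
  \sum_u mu u ^+ 2 * (q g u u * q (l.*2 - g) u u)
    <= del * W + n * ((kap * sg) ^+ l / del ^+ l.-2).
Proof.
move=> d0 g2 gl; rewrite /closed_walks mulr_sumr -sum1_card natr_sum mulr_suml -big_split.
apply: ler_sum => u _ /=; rewrite mul1r.
pose c s := mu u * q s.*2 u u.
have lc : log_convex l.-2.+2 c.
  have [c0 cc] := kpow_log_convex mu0 b0 b_sym l.-2.+2 u.
  split=> [i|i il]; first by rewrite mulr_ge0.
  rewrite /c exprMn [leRHS]mulrACA -expr2 ler_wpM2l ?sqr_ge0 //; exact: cc.
have := log_convex_dichotomy lc d0 (mulr_ge0 kap0 (ltW sg0)) (kpow2_le u).
have l2E : (l.-2.+2 = l)%N by nlia.
have l1E : (l.-2.+1 = l.-1)%N by nlia.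
rewrite l2E l1E.
apply: le_trans; rewrite /c [leRHS]mulrACA -expr2 ler_wpM2l ?sqr_ge0 //.
exact: kpow_revisit.
Qed.

End KernelBounds.

(** * Chains of edges *)

Lemma psum_cat (R : realFieldType) (X : finType) (p1 p2 : seq (option X)) (w : seq X -> R) :
  psum (p1 ++ p2) w = psum p1 (fun x => psum p2 (fun x' => w (x ++ x'))).
Proof.
by elim: p1 w => [|[v|] p IH] w //=; apply: eq_bigr => v _; rewrite IH.
Qed.

Lemma psum_split (R : realFieldType) (X : finType) (p1 p2 : seq (option X)) (w : seq X -> R) :
  psum (p1 ++ None :: p2) w = \sum_v psum (p1 ++ Some v :: p2) w.
Proof.
rewrite psum_cat /= psum_sum; apply: eq_bigr => v _.
by rewrite psum_cat.
Qed.

Lemma pmatch_size (X : finType) (p : seq (option X)) x : pmatch p x -> size x = size p.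
Proof. by case/andP => /eqP. Qed.

Lemma pmatch_nth (X : finType) (p1 p2 : seq (option X)) (v x0 : X) x :
  pmatch (p1 ++ Some v :: p2) x -> nth x0 x (size p1) = v.
Proof.
elim: p1 x => [|a p1 IH] [|z x] //=; rewrite /pmatch /= ?andbF //.
  by move=> /andP[_ /eqP[->]].
move=> /andP[sx /eqP[_ h]]; apply: IH; rewrite /pmatch; rewrite eqSS in sx.
by rewrite sx h eqxx.
Qed.

Section Chains.
Variables (R : realFieldType) (X T : finType) (mu : T -> R) (b : T -> T -> R).
Variables (act : pred X) (s t : X -> T).
Hypothesis mu0 : forall u, 0 < mu u.
Hypothesis st : forall e, act e -> s e != t e.

Definition ends e u v := act e && (((u == s e) && (v == t e)) || ((u == t e) && (v == s e))).
Hypothesis bE : forall u v, b u v = #|[pred e | ends e u v]|%:R / (mu u * mu v).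

Local Notation q := (kpow b mu).

Lemma ends_sym e u v : ends e u v = ends e v u.
Proof. by rewrite /ends; congr (_ && _); rewrite andbC orbC andbC; congr (_ || _); rewrite andbC. Qed.

Let mu0' u : 0 <= mu u. Proof. exact: ltW. Qed.
Let muN u : mu u != 0. Proof. exact: lt0r_neq0. Qed.

Lemma chain_b_ge0 u v : 0 <= b u v.
Proof. by rewrite bE divr_ge0 // mulr_ge0. Qed.
Lemma chain_b_sym u v : b u v = b v u.
Proof.
rewrite !bE; congr (_ / _); last exact: mulrC.
by congr (_%:R); apply: eq_card => e; rewrite !inE ends_sym.
Qed.
Lemma chain_bE u v : b u v * mu v = \sum_e (ends e u v)%:R / mu u.
Proof.
rewrite bE -sum1_card natr_sum big_mkcond -mulr_suml.
rewrite (_ : \sum_e _ = \sum_e (ends e u v)%:R :> R); first by field; rewrite !muN.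
by apply: eq_bigr => e _; rewrite inE; case: ifP.
Qed.

(* [vs] lists the joints after [u]: the i-th edge joins the joint preceding
   [nth vs i] to it. *)
Fixpoint trail u (es : seq X) (vs : seq T) : R :=
  match es, vs with
  | e :: es', v :: vs' => (ends e u v)%:R / mu u * trail v es' vs'
  | [::], [::] => 1
  | _, _ => 0
  end.

Fixpoint vtrail u (vs : seq T) : R :=
  if vs is v :: vs' then b u v * mu v * vtrail v vs' else 1.

Fixpoint chain u (es : seq X) v : R :=
  if es is e :: es' then \sum_z (ends e u z)%:R / mu u * chain z es' v
  else (u == v)%:R / mu v.

Lemma trail_ge0 u es vs : 0 <= trail u es vs.
Proof.
elim: es u vs => [|e es IH] u [|v vs] //=.
by rewrite !mulr_ge0 ?invr_ge0.
Qed.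

Lemma chain_ge0 u es v : 0 <= chain u es v.
Proof.
elim: es u => [|e es IH] u /=; first by rewrite divr_ge0.
by apply: sumr_ge0 => z _; rewrite !mulr_ge0 ?invr_ge0.
Qed.

Lemma sum_trail u vs : psum (nseq (size vs) None) (fun es => trail u es vs) = vtrail u vs.
Proof.
elim: vs u => [|v vs IH] u //=.
under eq_bigr do rewrite psumZ IH.
by rewrite -mulr_suml -chain_bE.
Qed.

Lemma chain_trail u es v : chain u es v * mu v =
  psum (nseq (size es) None) (fun vs => trail u es vs * (last u vs == v)%:R).
Proof.
elim: es u => [|e es IH] u /=; first by rewrite mul1r mulrVK // unitfE.
rewrite mulr_suml; apply: eq_bigr => z _; rewrite -[LHS]mulrA IH -psumZ.
by apply: eq_psum => vs _; rewrite mulrA.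
Qed.

(** The measure on tuples of edges behind the supersaturation; its pattern sums factor into kernel
    powers over the gaps. *)
Definition closed_chain es : R := \sum_u mu u * chain u es u.

Lemma closed_chain_ge0 es : 0 <= closed_chain es.
Proof. by apply: sumr_ge0 => u _; rewrite mulr_ge0 ?chain_ge0. Qed.

Lemma closed_chainE x0 es : (0 < size es)%N -> closed_chain es =
  psum (nseq (size es) None) (fun vs => trail (last x0 vs) es vs).
Proof.
move=> es0; rewrite /closed_chain.
under eq_bigr do rewrite mulrC chain_trail.
rewrite -psum_sum; apply: eq_psum => vs /pmatch_size; rewrite size_nseq => vsz.
case: vs vsz es0 => [<- //|v vs _ _] /=.
rewrite (bigD1 (last v vs)) //= eqxx mulr1 big1 ?addr0 // => u /negbTE ul.
by rewrite eq_sym ul mulr0.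
Qed.

Definition pchain p u v := psum p (fun es => chain u es v).

Lemma pchain_None p u v : pchain (None :: p) u v = \sum_z b u z * mu z * pchain p z v.
Proof.
rewrite /pchain /=.
under eq_bigr do rewrite psum_sum; rewrite exchange_big; apply: eq_bigr => z _.
by rewrite chain_bE mulr_suml; apply: eq_bigr => e _; rewrite psumZ.
Qed.

Lemma pchain_Some e p u v : pchain (Some e :: p) u v =
  (act e)%:R * ((u == s e)%:R / mu (s e) * pchain p (t e) v +
                (u == t e)%:R / mu (t e) * pchain p (s e) v).
Proof.
have -> : pchain (Some e :: p) u v = \sum_z (ends e u z)%:R / mu u * pchain p z v.
  by rewrite /pchain /= psum_sum; apply: eq_bigr => z _; rewrite psumZ.
rewrite /ends; case ae: (act e); last by rewrite [RHS]mul0r; apply: big1 => z _; rewrite /= !mul0r.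
have := st ae => ste; rewrite mul1r.
have pick (w : T) (f : T -> R) : \sum_z (z == w)%:R * f z = f w.
  by rewrite (bigD1 w) //= eqxx mul1r big1 ?addr0 // => z /negbTE ->; rewrite mul0r.
have [->|us] := eqVneq u (s e).
  rewrite (negbTE ste) /= [X in _ = _ + X * _]mul0r [X in _ = _ + X]mul0r addr0 mul1r.
  rewrite -(pick (t e) (fun z => pchain p z v)) mulr_sumr.
  by apply: eq_bigr => z _; rewrite orbF; ring.
rewrite /= [X in _ = X * _ + _]mul0r [X in _ = X + _]mul0r add0r; have [->|ut] := eqVneq u (t e).
  rewrite mul1r -(pick (s e) (fun z => pchain p z v)) mulr_sumr.
  by apply: eq_bigr => z _; ring.
by rewrite [X in _ = X * _]mul0r [RHS]mul0r; apply: big1 => z _; rewrite /= !mul0r.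
Qed.

Lemma pchain_nseq i u v : pchain (nseq i None) u v = q i u v.
Proof.
elim: i u => [|i IH] u; first by rewrite /pchain /=; case: eqP => [->|_] //; rewrite !mul0r.
by rewrite (pchain_None (nseq i None)); apply: eq_bigr => z _; rewrite IH.
Qed.

Lemma pchain_cat p1 p2 u v : pchain (p1 ++ p2) u v = \sum_z pchain p1 u z * mu z * pchain p2 z v.
Proof.
elim: p1 u => [|[e|] p1 IH] u.
- rewrite /= -[LHS](kpow0_sum b mu0 (fun z => pchain p2 z v) u); apply: eq_bigr => z _.
  by congr (_ * _ * _); rewrite /pchain /=; case: eqP => [->|_] //; rewrite !mul0r.
- rewrite cat_cons pchain_Some !IH !mulr_sumr -big_split mulr_sumr; apply: eq_bigr => z _.
  rewrite pchain_Some. rewrite /=; ring.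
- rewrite cat_cons pchain_None; under eq_bigr do rewrite IH mulr_sumr.
  rewrite exchange_big; apply: eq_bigr => z _; rewrite pchain_None !mulr_suml.
  by apply: eq_bigr => y _; ring.
Qed.

Lemma psum_closed_chain p : psum p closed_chain = \sum_u mu u * pchain p u u.
Proof. by rewrite psum_sum; apply: eq_bigr => u _; rewrite psumZ. Qed.

Lemma sum_closed_chain i : psum (nseq i None) closed_chain = closed_walks b mu i.
Proof. by rewrite psum_closed_chain; apply: eq_bigr => u _; rewrite pchain_nseq. Qed.

(** A fixed edge cuts the chain: the free run before it becomes a kernel power, and the two terms
    are the two directions in which [e] is traversed. *)
Lemma pchain_gap i e p u v : pchain (nseq i None ++ Some e :: p) u v =
  (act e)%:R * (q i u (s e) * pchain p (t e) v + q i u (t e) * pchain p (s e) v).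
Proof.
rewrite pchain_cat; under eq_bigr do rewrite pchain_Some pchain_nseq.
have pick (w : T) (f : T -> R) : \sum_z (z == w)%:R * f z = f w.
  by rewrite (bigD1 w) //= eqxx mul1r big1 ?addr0 // => z /negbTE ->; rewrite mul0r.
rewrite -[q i u (s e) * _](pick _ (fun z => q i u z * pchain p (t e) v)).
rewrite -[q i u (t e) * _](pick _ (fun z => q i u z * pchain p (s e) v)).
rewrite -big_split mulr_sumr; apply: eq_bigr => z _ /=.
have inv w : (z == w)%:R / mu w = (z == w)%:R / mu z by case: eqP => [->|_] //; rewrite !mul0r.
by rewrite !inv; field; rewrite muN.
Qed.

Definition nfree (X' : Type) (p : seq (option X')) : nat := count (fun o => ~~ isSome o) p.

Lemma nfixed_free (p : seq (option X)) : (nfixed p + nfree p)%N = size p.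
Proof. exact: count_predC. Qed.

Lemma nseq_None i (p : seq (option X)) : nseq i None ++ None :: p = nseq i.+1 None ++ p :> seq (option X).
Proof. by elim: i => //= i ->. Qed.

Lemma pchain_ge0 p u v : 0 <= pchain p u v.
Proof. by apply: psum_ge0 => x; apply: chain_ge0. Qed.

(** Each fixed edge has two directions, there is one gap more than there are fixed edges, and the
    gap lengths add up to the number of free entries. *)
Lemma pchain_le (F0 rho : R) m p i u v : 0 <= F0 -> 0 <= rho ->
  (forall g u v, (g < m)%N -> q g u v <= F0 * rho ^+ g) -> (i + nfree p < m)%N ->
  pchain (nseq i None ++ p) u v <= 2 ^+ nfixed p * F0 ^+ (nfixed p).+1 * rho ^+ (i + nfree p).
Proof.
move=> F00 rho0 hq; elim: p i u v => [|[e|] p IH] i u v im.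
- by rewrite cats0 pchain_nseq addn0 mul1r expr1 hq // -(addn0 i).
- have nS : nfixed (Some e :: p) = (nfixed p).+1 by [].
  have fS : nfree (Some e :: p) = nfree p by [].
  rewrite pchain_gap nS fS in im *.
  set z := 2 ^+ nfixed p * F0 ^+ (nfixed p).+1 * rho ^+ nfree p.
  have z0 : 0 <= z by rewrite !mulr_ge0 ?exprn_ge0.
  have i0 : (i < m)%N by apply: leq_ltn_trans im; apply: leq_addr.
  have f0 : (0 + nfree p < m)%N by apply: leq_ltn_trans im; apply: leq_addl.
  have h (w w' : T) : q i u w * pchain p w' v <= F0 * rho ^+ i * z.
    apply: ler_pM; rewrite ?pchain_ge0 ?hq //; last exact: (IH 0%N).
    by apply: kpow_ge0 => // *; apply: chain_b_ge0.
  have -> : 2 ^+ (nfixed p).+1 * F0 ^+ (nfixed p).+2 * rho ^+ (i + nfree p) =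
     F0 * rho ^+ i * z + F0 * rho ^+ i * z.
    by rewrite /z exprD exprS [F0 ^+ _.+2]exprS; ring.
  have := lerD (h (s e) (t e)) (h (t e) (s e)).
  have z1 : 0 <= F0 * rho ^+ i * z by rewrite !mulr_ge0 ?exprn_ge0.
  by case: (act e); rewrite ?mul1r // mul0r => _; apply: addr_ge0.
- rewrite nseq_None; have -> : (i + nfree (None :: p) = i.+1 + nfree p)%N by rewrite addSnnS.
  by apply: IH; rewrite addSnnS.
Qed.

(** Rotation puts the first fixed edge in front, so that the free runs at the two ends merge into
    one gap and as many gaps remain as fixed edges. *)
Lemma psum_closed_rotate i e p : psum (nseq i None ++ Some e :: p) closed_chain =
  (act e)%:R * (pchain (p ++ nseq i None) (t e) (s e) + pchain (p ++ nseq i None) (s e) (t e)).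
Proof.
rewrite psum_closed_chain !pchain_cat -big_split mulr_sumr; apply: eq_bigr => u _ /=.
by rewrite pchain_gap !pchain_nseq; ring.
Qed.

Lemma nfixed0 (p : seq (option X)) : nfixed p = 0%N -> p = nseq (size p) None.
Proof. by elim: p => [|[e|] p IH] //= p0; rewrite {1}IH. Qed.

Lemma first_Some (p : seq (option X)) : (0 < nfixed p)%N -> exists i e p', p = nseq i None ++ Some e :: p'.
Proof.
elim: p => [//|[e|] p IH] p0; first by exists 0%N, e, p.
by have [i [e [p' ->]]] := IH p0; exists i.+1, e, p'.
Qed.

Lemma nfixed_cat (p1 p2 : seq (option X)) : nfixed (p1 ++ p2) = (nfixed p1 + nfixed p2)%N.
Proof. exact: count_cat. Qed.

Lemma nfixed_nseq i : nfixed (nseq i (@None X)) = 0%N.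
Proof. by rewrite /nfixed count_nseq mul0n. Qed.

(** A single fixed edge leaves a gap of length k - 1, just outside the range of the geometric bound.
    This gap joins the ends of an edge, so the balanced bound [Q1] takes over. *)
Lemma psum_closed_le (F0 rho Q1 : R) k p : 0 <= F0 -> 0 <= rho ->
  (forall g u v, (g < k.-1)%N -> q g u v <= F0 * rho ^+ g) ->
  (forall u v, 0 < b u v -> q k.-1 u v <= Q1) -> 0 <= Q1 ->
  size p = k -> (0 < nfixed p)%N ->
  psum p closed_chain <= if nfixed p == 1%N then 2 * Q1
    else 2 ^+ nfixed p * F0 ^+ nfixed p * rho ^+ (k - nfixed p).
Proof.
move=> F00 rho0 hq hq1 Q0 pk /first_Some[i [e [p' pE]]].
have nf : nfixed p = (nfixed p').+1 by rewrite pE nfixed_cat nfixed_nseq.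
have sz : (size (p' ++ nseq i None)).+1 = k.
  by rewrite -pk pE !size_cat /= !size_nseq; lia.
have nf' : nfixed (p' ++ nseq i None) = nfixed p' by rewrite nfixed_cat nfixed_nseq addn0.
have fr : (nfree (p' ++ nseq i None) = k - nfixed p)%N.
  by have := nfixed_free (p' ++ nseq i None); lia.
rewrite pE psum_closed_rotate -pE nf eqSS; case: eqP => p'0.
  case ae: (act e); last by rewrite mul0r mulr_ge0.
  have -> : p' ++ nseq i None = nseq k.-1 None by rewrite [LHS]nfixed0 ?nf' // -sz.
  have bp : 0 < b (s e) (t e).
    rewrite bE divr_gt0 ?mulr_gt0 // ltr0n; apply/card_gt0P; exists e.
    by rewrite inE /ends ae !eqxx.
  have bp' : 0 < b (t e) (s e) by rewrite chain_b_sym.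
  by rewrite mul1r !pchain_nseq mulr_natl mulr2n lerD // hq1.
pose z := 2 ^+ nfixed p' * F0 ^+ (nfixed p').+1 * rho ^+ (k - (nfixed p').+1).
have h u v : pchain (p' ++ nseq i None) u v <= z.
  have := @pchain_le F0 rho k.-1 (p' ++ nseq i None) 0%N u v F00 rho0 hq.
  rewrite add0n fr nf' nf; apply.
  by have h1 := nfixed_free p; rewrite nf pk in h1; clear -p'0 h1; lia.
rewrite (_ : 2 ^+ _ * _ * _ = z + z); last by rewrite /z exprS; ring.
have z0 : 0 <= z by rewrite !mulr_ge0 ?exprn_ge0.
by case: (act e); rewrite ?mul1r ?mul0r ?addr_ge0 // addrC lerD.
Qed.

End Chains.

Lemma psum_exchange (R : realFieldType) (X Y : finType) (p : seq (option X)) (p' : seq (option Y))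
    (w : seq X -> seq Y -> R) :
  psum p (fun x => psum p' (w x)) = psum p' (fun y => psum p (w^~ y)).
Proof.
elim: p w => [|[v|] p IH] w //=.
by rewrite psum_sum; apply: eq_bigr => v _; apply: (IH (fun x => w (v :: x))).
Qed.

Lemma nseq_cat i j k (X : Type) (x : X) : (i + j = k)%N -> nseq i x ++ nseq j x = nseq k x.
Proof. by move=> <-; elim: i => //= i ->. Qed.

(** * Closed walks with a repeated joint, and events on a single edge *)

Section Degenerate.
Variables (R : realFieldType) (X T : finType) (mu : T -> R) (b : T -> T -> R).
Variables (act : pred X) (s t : X -> T).
Hypothesis mu0 : forall u, 0 < mu u.
Local Notation ends := (ends act s t).
Hypothesis bE : forall u v, b u v = #|[pred e | ends e u v]|%:R / (mu u * mu v).
Local Notation q := (kpow b mu).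
Local Notation trail := (trail mu act s t).
Local Notation vtrail := (vtrail mu b).
Local Notation W k := (closed_walks b mu k).

Let mu0' u : 0 <= mu u. Proof. exact: ltW. Qed.
Let muN u : mu u != 0. Proof. exact: lt0r_neq0. Qed.
Let b0 : forall u v, 0 <= b u v. Proof. exact: (chain_b_ge0 mu0 bE). Qed.

Lemma vtrail_ge0 u vs : 0 <= vtrail u vs.
Proof. by elim: vs u => //= v vs IH u; rewrite !mulr_ge0. Qed.

Lemma vtrail_cat u vs1 vs2 : vtrail u (vs1 ++ vs2) = vtrail u vs1 * vtrail (last u vs1) vs2.
Proof. by elim: vs1 u => [|v vs IH] u /=; rewrite ?mul1r // IH mulrA. Qed.

Definition ptrail p u v := psum p (fun vs => vtrail u vs * (last u vs == v)%:R).

Lemma ptrail_cat p1 p2 u v : ptrail (p1 ++ p2) u v = \sum_z ptrail p1 u z * ptrail p2 z v.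
Proof.
rewrite /ptrail psum_cat.
under [RHS]eq_bigr do rewrite mulrC -psumZ.
rewrite -psum_sum; apply: eq_psum => vs _.
rewrite (bigD1 (last u vs)) //= eqxx mulr1 big1 ?addr0 => [|z /negbTE zl]; last first.
  by rewrite eq_sym zl !mulr0.
rewrite mulrC -psumZ; apply: eq_psum => vs' _.
by rewrite vtrail_cat last_cat mulrA.
Qed.

Lemma ptrail_nseq i u v : ptrail (nseq i None) u v = q i u v * mu v.
Proof.
elim: i u => [|i IH] u.
  rewrite /ptrail /= mul1r; case: eqP => [->|_]; last by rewrite !mul0r.
  by rewrite mul1r mulVf.
rewrite /ptrail /= mulr_suml; apply: eq_bigr => z _.
rewrite -mulrA -IH -psumZ; apply: eq_psum => vs _; by rewrite mulrA.
Qed.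

Lemma ptrail_stop i w u v : ptrail (nseq i None ++ [:: Some w]) u v = q i.+1 u w * mu w * (w == v)%:R.
Proof.
rewrite ptrail_cat -[i.+1]addn1 kpowD // !mulr_suml; apply: eq_bigr => z _.
by rewrite ptrail_nseq kpow1 // /ptrail /=; ring.
Qed.

Lemma psum_closed_vtrail x0 p : (0 < size p)%N ->
  psum p (fun vs => vtrail (last x0 vs) vs) = \sum_u ptrail p u u.
Proof.
move=> p0; rewrite -psum_sum; apply: eq_psum => vs /pmatch_size vsz.
case: vs vsz => [E|v vs _]; first by rewrite -E in p0.
rewrite /= (bigD1 (last v vs)) //= eqxx mulr1 big1 ?addr0 // => u /negbTE ul.
by rewrite eq_sym ul mulr0.
Qed.

Lemma sum_closed_vtrail x0 k : (0 < k)%N ->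
  psum (nseq k None) (fun vs => vtrail (last x0 vs) vs) = W k.
Proof.
move=> k0; rewrite psum_closed_vtrail ?size_nseq //; apply: eq_bigr => u _.
by rewrite ptrail_nseq mulrC.
Qed.

(** Equal joints i and j split the closed walk into two closed walks through the common vertex. *)
Lemma revisit_sum x0 i j k : (i < j)%N -> (j < k)%N ->
  psum (nseq k None) (fun vs => vtrail (last x0 vs) vs * (nth x0 vs i == nth x0 vs j)%:R)
  = \sum_w mu w ^+ 2 * (q (j - i) w w * q (k - (j - i)) w w).
Proof.
move=> ij jk.
rewrite (_ : nseq k None = nseq i None ++ None :: (nseq (j - i).-1 None ++ None :: nseq (k - j).-1 None));
  last first.
  rewrite -[None :: nseq _ _]/(nseq (k - j).-1.+1 None) (nseq_cat (k := k - i - 1)%N); last by lia.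
  rewrite -[None :: nseq _ _]/(nseq (k - i - 1).+1 None) (nseq_cat (k := k)) //; lia.
rewrite psum_split; apply: eq_bigr => w _.
pose p1 := nseq i None ++ Some w :: nseq (j - i).-1 None.
have sp1 : size p1 = j by rewrite size_cat /= !size_nseq; lia.
rewrite -cat_cons catA -/p1 psum_split.
rewrite (bigD1 w) //= big1 ?addr0 => [|w' w'w]; last first.
  rewrite -[RHS](@psum0 R T (p1 ++ Some w' :: nseq (k - j).-1 None)); apply: eq_psum => vs m.
  have e2 := pmatch_nth x0 m; rewrite sp1 in e2.
  have e1 : nth x0 vs i = w.
    by move: m; rewrite /p1 -catA => /(pmatch_nth x0); rewrite size_nseq.
  by rewrite e1 e2 eq_sym (negbTE w'w) mulr0.
rewrite (_ : psum _ _ = psum (p1 ++ Some w :: nseq (k - j).-1 None) (fun vs => vtrail (last x0 vs) vs));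
  last first.
  apply: eq_psum => vs m; have e2 := pmatch_nth x0 m; rewrite sp1 in e2.
  have e1 : nth x0 vs i = w.
    by move: m; rewrite /p1 -catA => /(pmatch_nth x0); rewrite size_nseq.
  by rewrite e1 e2 eqxx mulr1.
rewrite psum_closed_vtrail; last by rewrite size_cat addnS.
rewrite (_ : p1 ++ Some w :: nseq (k - j).-1 None = (nseq i None ++ [:: Some w]) ++
  ((nseq (j - i).-1 None ++ [:: Some w]) ++ nseq (k - j).-1 None)); last first.
  by rewrite /p1 -!catA.
have e u : ptrail ((nseq i None ++ [:: Some w]) ++
    ((nseq (j - i).-1 None ++ [:: Some w]) ++ nseq (k - j).-1 None)) u u =
    (mu w ^+ 2 * q (j - i) w w) * (q (k - j).-1 w u * mu u * q i.+1 u w).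
  have pick (f : T -> R) : \sum_z (w == z)%:R * f z = f w.
    by rewrite (bigD1 w) //= eqxx mul1r big1 ?addr0 // => z /negbTE; rewrite eq_sym => ->; rewrite mul0r.
  rewrite ptrail_cat; under eq_bigr do rewrite ptrail_stop -mulrA.
  rewrite -mulr_sumr pick ptrail_cat; under eq_bigr do rewrite ptrail_stop -mulrA.
  rewrite -mulr_sumr pick ptrail_nseq prednK; last by rewrite subn_gt0.
  ring.
under eq_bigr do rewrite e.
rewrite -mulr_sumr -mulrA; congr (_ * (_ * _)).
rewrite (_ : (k - (j - i)) = (k - j).-1 + i.+1)%N; last by lia.
by rewrite kpowD.
Qed.

(** For fixed joints the weight is a product over the edges, so a condition on one edge costs only
    its share among the edges with the same ends. *)
Lemma trail_event x0 p1 p2 u vs (P : pred X) eps : 0 <= eps -> (size p1 < size vs)%N ->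
  (forall v0 v1, v0 = nth u (u :: vs) (size p1) -> v1 = nth u vs (size p1) ->
    #|[pred e | ends e v0 v1 && P e]|%:R <= eps * #|[pred e | ends e v0 v1]|%:R) ->
  psum (p1 ++ None :: p2) (fun es => trail u es vs * (P (nth x0 es (size p1)))%:R)
    <= eps * psum (p1 ++ None :: p2) (fun es => trail u es vs).
Proof.
move=> eps0; elim: p1 u vs => [|a p1 IH] u [//|v vs] sv h.
- rewrite /=; set Z := psum p2 (fun es => trail v es vs).
  have Z0 : 0 <= Z by apply: psum_ge0 => x; apply: trail_ge0.
  rewrite (_ : \sum_e _ = #|[pred e | ends e u v && P e]|%:R * (Z / mu u)).
    rewrite (_ : \sum_e psum p2 (fun es => _ * trail v es vs) = #|[pred e | ends e u v]|%:R * (Z / mu u)).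
      by rewrite [leRHS]mulrA ler_wpM2r ?divr_ge0 //; apply: h.
    rewrite -sum1_card natr_sum mulr_suml [RHS]big_mkcond; apply: eq_bigr => e _.
    by rewrite psumZ inE; case: ifP => _; rewrite ?mul0r // !mul1r mulrC.
  rewrite -sum1_card natr_sum mulr_suml [RHS]big_mkcond; apply: eq_bigr => e _.
  rewrite inE; case: (ends e u v) => /=; case: (P e) => /=.
  + by rewrite [RHS]mul1r [RHS]mulrC /Z -psumZ; apply: eq_psum => x _; rewrite mulr1 mul1r.
  + by under eq_psum => x _ do rewrite mulr0; rewrite psum0.
  + by under eq_psum => x _ do rewrite !mul0r; rewrite psum0.
  + by under eq_psum => x _ do rewrite mulr0; rewrite psum0.
have IH' e : psum (p1 ++ None :: p2) (fun es => (ends e u v)%:R / mu u * trail v es vs *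
    (P (nth x0 es (size p1)))%:R) <=
    eps * psum (p1 ++ None :: p2) (fun es => (ends e u v)%:R / mu u * trail v es vs).
  rewrite psumZ mulrCA; under eq_psum => x _ do rewrite -mulrA.
  rewrite psumZ; apply: ler_wpM2l; first by rewrite divr_ge0.
  apply: IH => // v0 v1 e0 e1; apply: h; rewrite ?e0 ?e1 /=; apply: set_nth_default => //.
  by rewrite ltnS ltnW.
case: a h sv => [e|] h sv /=; first exact: IH'.
by rewrite mulr_sumr; apply: ler_sum => e _; apply: IH'.
Qed.

End Degenerate.

(** * Chains whose edges intersect outside the prescribed joints *)

Section Events.
Variables (R : realFieldType) (T : finType) (mu : T -> R) (b : T -> T -> R).
Local Notation X := {set T}.
Variables (act : pred X) (s t : X -> T) (x0 : T) (r : nat) (eps : R).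
Hypothesis mu0 : forall u, 0 < mu u.
Hypothesis st : forall e, act e -> s e != t e.
Local Notation ends := (ends act s t).
Hypothesis bE : forall u v, b u v = #|[pred e | ends e u v]|%:R / (mu u * mu v).
Hypothesis eps0 : 0 <= eps.
Hypothesis codegree3 : forall u v z, z != u -> z != v ->
  #|[pred e | ends e u v && (z \in e)]|%:R <= eps * #|[pred e | ends e u v]|%:R.
Local Notation q := (kpow b mu).
Local Notation trail := (trail mu act s t).
Local Notation vtrail := (vtrail mu b).
Local Notation closed_chain := (closed_chain mu act s t).
Local Notation W k := (closed_walks b mu k).
Local Notation nil0 := (set0 : X).

(** The list headed by the last joint gives the joint before edge i, so edge 0 starts where the walk
    ends. *)
Definition hits_joint (vs : seq T) (i m : nat) (es : seq X) : bool :=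
  [&& nth x0 vs m \in nth nil0 es i, nth x0 vs m != nth (last x0 vs) (last x0 vs :: vs) i
    & nth x0 vs m != nth x0 vs i].

(** With i < j, edge i can be fixed while edge j varies; its size bounds the number of possible
    meeting vertices. *)
Definition meets_off (vs : seq T) (i j : nat) (es : seq X) : bool :=
  [&& (i < j)%N, (#|nth nil0 es i| <= r)%N &
    ~~ [forall z in nth nil0 es i :&: nth nil0 es j, z \in vs]].

Lemma hits_joint_le k vs i m : size vs = k -> (i < k)%N ->
  psum (nseq k None) (fun es => trail (last x0 vs) es vs * (hits_joint vs i m es)%:R)
    <= eps * vtrail (last x0 vs) vs.
Proof.
move=> vk ik; rewrite -(sum_trail mu0 bE) vk.
rewrite -(nseq_cat (j := (k - i)%N) (i := i)) ?subnKC ?(ltnW ik) //.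
have [j ->] : exists j, (k - i)%N = j.+1 by exists (k - i).-1; lia.
have := @trail_event R X T mu act s t mu0 nil0 (nseq i None) (nseq j None) (last x0 vs) vs
  (fun e => [&& nth x0 vs m \in e, nth x0 vs m != nth (last x0 vs) (last x0 vs :: vs) i
    & nth x0 vs m != nth x0 vs i]) eps eps0.
rewrite size_nseq vk => /(_ ik); apply => v0 v1 -> v1E.
have -> : nth x0 vs i = v1 by rewrite v1E; apply: set_nth_default; rewrite vk.
set z := nth x0 vs m; set w := nth _ _ i.
have [zw|_] := boolP ((z != w) && (z != v1)); last first.
  rewrite (eq_card0 (A := [pred e | _])) ?mulr_ge0 // => e.
  by rewrite !inE !andbF.
have /andP[zw0 zw1] := zw; apply: le_trans (codegree3 zw0 zw1).
by rewrite ler_nat; apply: subset_leq_card; apply/subsetP => e; rewrite !inE andbT.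
Qed.

(** With edge i fixed, a union bound over its vertices off the joints applies [codegree3] to edge
    j. *)
Lemma meets_off_le k vs i j : size vs = k -> (i < k)%N -> (j < k)%N ->
  psum (nseq k None) (fun es => trail (last x0 vs) es vs * (meets_off vs i j es)%:R)
    <= r%:R * eps * vtrail (last x0 vs) vs.
Proof.
move=> vk ik jk; have re0 : 0 <= r%:R * eps by rewrite mulr_ge0.
have [ij|ji] := ltnP i j; last first.
  rewrite (eq_psum (w2 := fun=> 0)); first by rewrite psum0 mulr_ge0 // (vtrail_ge0 mu0 bE).
  by move=> es _; rewrite /meets_off ltnNge ji mulr0.
rewrite -(sum_trail mu0 bE) vk.
rewrite (_ : nseq k None = nseq i None ++ None :: (nseq (j - i).-1 None ++ None :: nseq (k - j).-1 None));
  last first.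
  rewrite -[None :: nseq _ _]/(nseq (k - j).-1.+1 None) (nseq_cat (k := k - i - 1)%N); last by lia.
  rewrite -[None :: nseq _ _]/(nseq (k - i - 1).+1 None) (nseq_cat (k := k)) //; lia.
rewrite !psum_split mulr_sumr; apply: ler_sum => e _.
pose p1 := nseq i None ++ Some e :: nseq (j - i).-1 None.
have sp1 : size p1 = j by rewrite size_cat /= !size_nseq; lia.
rewrite -cat_cons catA -/p1.
pose P e' := (#|e| <= r)%N && ~~ [forall z in e :&: e', z \in vs].
rewrite (_ : psum _ _ = psum (p1 ++ None :: nseq (k - j).-1 None) (fun es =>
   trail (last x0 vs) es vs * (P (nth nil0 es (size p1)))%:R)); last first.
  apply: eq_psum => es m; congr (_ * _%:R); rewrite /meets_off ij /= sp1.
  have -> // : nth nil0 es i = e.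
  by move: m; rewrite /p1 -catA => /(pmatch_nth nil0); rewrite size_nseq.
apply: (trail_event (s := s) (t := t) mu0); rewrite ?sp1 ?vk // => v0 v1 v0E v1E.
have [er|er] := boolP (#|e| <= r)%N; last first.
  rewrite (eq_card0 (A := [pred e' | _])) ?mulr_ge0 // => e'.
  by rewrite !inE /P (negbTE er) andbF.
have v0v : v0 \in vs.
  rewrite v0E; case: (j) jk vk => [|j'] jk vk /=; last by rewrite mem_nth // vk ltnW.
  by rewrite -nth_last mem_nth // vk ltn_predL.
have v1v : v1 \in vs by rewrite v1E mem_nth // vk.
apply: (@le_trans _ _ (\sum_(z in e | z \notin vs) #|[pred e' | ends e' v0 v1 && (z \in e')]|%:R)).
  rewrite -natr_sum ler_nat.
  have -> : (\sum_(z in e | z \notin vs) #|[pred e' | ends e' v0 v1 && (z \in e')]| =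
    \sum_(e' | ends e' v0 v1) #|[pred z | [&& z \in e, z \notin vs & z \in e']]|)%N.
    under eq_bigr do rewrite -sum1_card.
    under [RHS]eq_bigr do rewrite -sum1_card.
    rewrite (exchange_big_dep (fun e' => ends e' v0 v1)) /=; last first.
      by move=> z e' _; rewrite inE => /andP[].
    apply: eq_bigr => e' ee'; apply: eq_bigl => z.
    by rewrite !inE ee' /= -andbA.
  rewrite -sum1_card big_mkcond [leqRHS]big_mkcond; apply: leq_sum => e' _.
  rewrite inE; case: (ends e' v0 v1) => //=.
  rewrite /P er /=; case: ifP => // /forall_inPn[z]; rewrite inE => /andP[ze ze'] zv.
  by apply/card_gt0P; exists z; rewrite inE ze zv.
apply: (@le_trans _ _ (\sum_(z in e | z \notin vs) eps * #|[pred e' | ends e' v0 v1]|%:R)).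
  apply: ler_sum => z /andP[_ zv]; apply: codegree3.
    by apply: contraNneq zv => ->.
  by apply: contraNneq zv => ->.
rewrite sumr_const -[leLHS]mulr_natl -mulrA ler_wpM2r ?mulr_ge0 // ler_nat.
apply: leq_trans er; apply: subset_leq_card; apply/subsetP => z.
by rewrite unfold_in => /andP[].
Qed.

(** A chain outside [cp] repeats a joint or shows one of the two intersection events for some pair
    of indices. Repeats at cyclic distance 1 have no weight because ends are distinct; the others
    cost [D]. *)
Lemma degenerate_le k D (cp : pred (seq X)) : (0 < k)%N -> 0 <= D ->
  (forall g, (2 <= g)%N -> (g + 2 <= k)%N ->
     \sum_w mu w ^+ 2 * (q g w w * q (k - g) w w) <= D) ->
  (forall vs es, size vs = k -> size es = k -> trail (last x0 vs) es vs != 0 -> uniq vs ->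
     (forall i m, (i < k)%N -> (m < k)%N -> ~~ hits_joint vs i m es) ->
     (forall i j, (i < k)%N -> (j < k)%N -> ~~ meets_off vs i j es) -> cp es) ->
  psum (nseq k None) (fun es => closed_chain es * (~~ cp es)%:R)
    <= k%:R ^+ 2 * (D + (r.+1)%:R * eps * W k).
Proof.
move=> k0 D0 hD hcp.
have qdiag w : q 1 w w = 0.
  rewrite kpow1 // bE (eq_card0 (A := [pred e | _])) ?mul0r // => e.
  rewrite !inE; apply/negP => /andP[ae /orP h]; have := st ae.
  by case: h => /andP[/eqP <- /eqP <-]; rewrite eqxx.
have t0 := trail_ge0 act s t mu0.
have rep w : 0 <= w -> \sum_(i < k) \sum_(m < k) w = k%:R ^+ 2 * w :> R.
  move=> w0; under eq_bigr do rewrite sumr_const card_ord.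
  by rewrite sumr_const card_ord -mulrnA -[LHS]mulr_natl natrM expr2.
have W0 : 0 <= W k.
  by apply: sumr_ge0 => u _; rewrite mulr_ge0 ?kpow_ge0 ?(ltW (mu0 _)) //; apply: chain_b_ge0 bE.
apply: (@le_trans _ _ (psum (nseq k None) (fun es => psum (nseq k None) (fun vs =>
  trail (last x0 vs) es vs * (~~ uniq vs)%:R +
  \sum_(i < k) \sum_(m < k) (trail (last x0 vs) es vs * (hits_joint vs i m es)%:R +
     trail (last x0 vs) es vs * (meets_off vs i m es)%:R))))).
  apply: le_psum => es /pmatch_size; rewrite size_nseq => esk.
  rewrite (closed_chainE act s t mu0 x0) ?esk // mulrC -psumZ; apply: le_psum => vs /pmatch_size.
  rewrite size_nseq => vsk.
  have R0 i m : 0 <= trail (last x0 vs) es vs * (hits_joint vs i m es)%:R +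
     trail (last x0 vs) es vs * (meets_off vs i m es)%:R by rewrite addr_ge0 ?mulr_ge0.
  have S0 : 0 <= \sum_(i < k) \sum_(m < k) (trail (last x0 vs) es vs * (hits_joint vs i m es)%:R +
     trail (last x0 vs) es vs * (meets_off vs i m es)%:R).
    by apply: sumr_ge0 => i _; apply: sumr_ge0 => m _.
  case: (boolP (cp es)) => [_|ncp] /=; first by rewrite mul0r addr_ge0 ?mulr_ge0.
  rewrite mul1r; case: (boolP (uniq vs)) => [uvs|_] /=; last by rewrite mulr1 lerDl.
  rewrite mulr0 add0r.
  have [->|tn] := eqVneq (trail (last x0 vs) es vs) 0.
    by rewrite big1 // => i _; rewrite big1 // => m _; rewrite !mul0r addr0.
  have [/existsP[i /existsP[m him]]|none] :=
    boolP [exists i : 'I_k, exists m : 'I_k, hits_joint vs i m es || meets_off vs i m es].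
    rewrite (bigD1 i) //= (bigD1 m) //= -addrA; apply: ler_wpDr.
      apply: addr_ge0; first by apply: sumr_ge0 => m' _.
      by apply: sumr_ge0 => i' _; apply: sumr_ge0 => m' _.
    by case/orP: him => ->; rewrite mulr1 ?lerDl ?lerDr mulr_ge0.
  case/negP: ncp; apply: (hcp vs es) => // i j ik jk; apply/negP => h; case/negP: none.
    by apply/existsP; exists (Ordinal ik); apply/existsP; exists (Ordinal jk); rewrite h.
  by apply/existsP; exists (Ordinal ik); apply/existsP; exists (Ordinal jk); rewrite h orbT.
rewrite psum_exchange.
apply: (@le_trans _ _ (psum (nseq k None) (fun vs => 
  \sum_(i < k) \sum_(j < k) (i < j)%N%:R * (vtrail (last x0 vs) vs * (nth x0 vs i == nth x0 vs j)%:R)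
   + k%:R ^+ 2 * ((r.+1)%:R * eps * vtrail (last x0 vs) vs)))).
  apply: le_psum => vs /pmatch_size; rewrite size_nseq => vsk.
  have v0 := vtrail_ge0 mu0 bE (last x0 vs) vs.
  rewrite psumD; apply: lerD.
    rewrite (eq_psum (w2 := fun es => (~~ uniq vs)%:R * trail (last x0 vs) es vs)); last first.
      by move=> es _; rewrite mulrC.
    rewrite psumZ -vsk (sum_trail mu0 bE) vsk.
    have I0 (i j : 'I_k) : 0 <= (i < j)%N%:R *
      (vtrail (last x0 vs) vs * (nth x0 vs i == nth x0 vs j)%:R) by rewrite !mulr_ge0.
    case: (boolP (uniq vs)) => [_|/(uniqPn x0)[i [j [ij jv nij]]]] /=.
      by rewrite mul0r; apply: sumr_ge0 => i _; apply: sumr_ge0 => j _.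
    rewrite vsk in jv; have ik := ltn_trans ij jv.
    rewrite (bigD1 (Ordinal ik)) //= (bigD1 (Ordinal jv)) //= ij nij eqxx mulr1 -addrA lerDl.
    apply: addr_ge0; first by apply: sumr_ge0 => j' _; rewrite !mulr_ge0.
    by apply: sumr_ge0 => i' _; apply: sumr_ge0 => j' _; rewrite !mulr_ge0.
  rewrite psum_sum -rep ?mulr_ge0 //; apply: ler_sum => i _.
  rewrite psum_sum; apply: ler_sum => m _; rewrite psumD.
  have := lerD (hits_joint_le m vsk (ltn_ord i)) (meets_off_le vsk (ltn_ord i) (ltn_ord m)).
  by move/le_trans; apply; rewrite -natr1 !mulrDl mul1r addrC.
rewrite psumD psumZ psumZ (sum_closed_vtrail b mu0) // mulrDr; apply: lerD => //.
rewrite psum_sum -rep //; apply: ler_sum => i _; rewrite psum_sum; apply: ler_sum => j _.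
rewrite psumZ; case: ltnP => ij; last by rewrite mul0r.
rewrite mul1r (revisit_sum b mu0) //.
have [g1|g1] := leqP (j - i) 1.
  have -> : (j - i = 1)%N by lia.
  by rewrite big1 // => w _; rewrite qdiag mul0r mulr0.
have [g2|g2] := leqP (j - i + 2) k; first exact: hD.
have -> : (k - (j - i) = 1)%N by have := ltn_ord j; lia.
by rewrite big1 // => w _; rewrite qdiag !mulr0.
Qed.

End Events.

(** * From a nondegenerate chain to a copy of the linear cycle *)

Section Copy.
Variables (R : realFieldType) (T : finType) (mu : T -> R).
Local Notation X := {set T}.
Variables (act : pred X) (s t : X -> T) (x0 : T) (r k : nat).
Hypothesis st : forall e, act e -> s e != t e.
Hypothesis s_in : forall e, act e -> s e \in e.
Hypothesis t_in : forall e, act e -> t e \in e.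
Hypothesis act_card : forall e, act e -> #|e| = r.
Local Notation nil0 := (set0 : X).

Lemma trail_ends u es vs i : trail mu act s t u es vs != 0 -> (i < size vs)%N ->
  ends act s t (nth nil0 es i) (nth u (u :: vs) i) (nth u vs i).
Proof.
elim: es u vs i => [|e es IH] u [|v vs] i //=; first by rewrite eqxx.
case: i => [|i] /=; first by case: (ends act s t e u v) => //; rewrite !mul0r eqxx.
rewrite mulf_eq0 negb_or => /andP[_ h]; rewrite ltnS => iv.
have := IH v vs i h iv; rewrite (set_nth_default u v) ?(set_nth_default u v iv) //=.
by rewrite ltnS ltnW.
Qed.

Variables (vs : seq T) (es : seq X).
Hypothesis vs_size : size vs = k.
Hypothesis es_size : size es = k.
Hypothesis trail_n0 : trail mu act s t (last x0 vs) es vs != 0.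
Hypothesis vs_uniq : uniq vs.
Hypothesis no_hit : forall i m, (i < k)%N -> (m < k)%N -> ~~ hits_joint x0 vs i m es.
Hypothesis no_meet : forall i j, (i < k)%N -> (j < k)%N -> ~~ meets_off r vs i j es.

Let a i := nth (last x0 vs) (last x0 vs :: vs) i.
Let v i := nth x0 vs i.
Let e i := nth nil0 es i.
Let rest i := e i :\: [set a i; v i].

Let lastE : last x0 vs = v k.-1. Proof. by rewrite -nth_last vs_size. Qed.

Let aE i : (i < k)%N -> exists2 m, (m < k)%N & a i = v m.
Proof.
case: i => [|i] ik; first by exists k.-1; rewrite ?ltn_predL // /a /= lastE.
exists i; first exact: ltnW.
by rewrite /a /=; apply: set_nth_default; rewrite vs_size ltnW.
Qed.

Let a_inj i j : (i < k)%N -> (j < k)%N -> a i = a j -> i = j.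
Proof.
have vinj m m' : (m < k)%N -> (m' < k)%N -> v m = v m' -> m = m'.
  by move=> mk mk' /eqP; rewrite nth_uniq ?vs_size // => /eqP.
have aS m : (m.+1 < k)%N -> a m.+1 = v m.
  by move=> mk; rewrite /a /=; apply: set_nth_default; rewrite vs_size ltnW.
have a0 : a 0 = v k.-1 by rewrite /a /= lastE.
case: i j => [|i] [|j] // ik jk; rewrite ?a0 ?aS //.
- by move/vinj => h; have := h ltac:(lia) ltac:(lia); lia.
- by move/vinj => h; have := h ltac:(lia) ltac:(lia); lia.
- by move/vinj => ->//; apply: ltnW.
Qed.

Let ends_i i : (i < k)%N -> [/\ act (e i), a i \in e i, v i \in e i & a i != v i].
Proof.
move=> ik; have := trail_ends trail_n0 (i := i); rewrite vs_size => /(_ ik).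
rewrite -/(e i) -/(a i) (_ : nth (last x0 vs) vs i = v i); last first.
  by apply: set_nth_default; rewrite vs_size.
case/andP=> ae /orP[] /andP[/eqP -> /eqP ->]; split; rewrite ?s_in ?t_in ?st //.
by rewrite eq_sym st.
Qed.

Let rest_card i : (i < k)%N -> #|rest i| = (r - 2)%N.
Proof.
move=> ik; have [ae ai vi av] := ends_i ik.
rewrite cardsDS; last by apply/subsetP => z; rewrite !inE => /orP[] /eqP ->.
by rewrite cards2 av (act_card ae).
Qed.

Let joint_notin i m : (i < k)%N -> (m < k)%N -> v m \notin rest i.
Proof.
move=> ik mk; rewrite !inE negb_and negbK.
have := no_hit ik mk; rewrite /hits_joint -/(v m) -/(e i) -/(a i) -/(v i).
by case: (v m \in e i); rewrite ?orbT //= negb_and !negbK => ->.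
Qed.

Let rest_disj i j z : (i < k)%N -> (j < k)%N -> z \in rest i -> z \in rest j -> i = j.
Proof.
have main i' j' : (i' < j')%N -> (j' < k)%N -> z \in rest i' -> z \in rest j' -> False.
  move=> ij jk zi zj; have ik := ltn_trans ij jk.
  have := no_meet ik jk; rewrite /meets_off ij /= -/(e i') -/(e j').
  have [ae _ _ _] := ends_i ik; rewrite (act_card ae) leqnn negbK => /forall_inP /(_ z).
  have ze : z \in e i' :&: e j' by move: zi zj; rewrite !inE => /andP[_ ->] /andP[_ ->].
  move=> /(_ ze) /(nthP x0)[m]; rewrite vs_size => mk mz.
  by have := joint_notin ik mk; rewrite /v mz zi.
move=> ik jk zi zj; case: (ltngtP i j) => // h; first by case: (main _ _ h jk zi zj).
by case: (main _ _ h ik zj zi).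
Qed.

(** Cycle vertex i goes to the joint before edge i, and the new vertices of cycle edge i enumerate
    the vertices of edge i off its two joints. *)
Lemma copy_of_chain : contains_copy [set z in es] (linear_cycle k r).
Proof.
pose f (x : linear_cycle_vertex k r) : T :=
  match x with inl i => a i | inr (i, j) => nth x0 (enum (rest i)) j end.
have f_rest i j : f (inr (i, j)) \in rest i.
  rewrite /f -mem_enum mem_nth // -cardE rest_card ?ltn_ord //.
have joint_rest (i i' : 'I_k) z : z \in rest i' -> a i <> z.
  have [m mk ->] := aE (ltn_ord i) => zi vz.
  by have := joint_notin (ltn_ord i') mk; rewrite vz zi.
have f_inj : injective f.
  move=> [i|[i j]] [i'|[i' j']].
  - by move=> /a_inj h; congr inl; apply: val_inj; apply: h.
  - by move=> /(joint_rest _ _ _ (f_rest i' j')).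
  - by move=> /esym /(joint_rest _ _ _ (f_rest i j)).
  move=> fE; have ii : i = i'.
    have h : f (inr (i, j)) \in rest i' by rewrite fE f_rest.
    by apply: val_inj; apply: (rest_disj _ _ (f_rest i j) h).
  move: fE; rewrite ii /f => /eqP; rewrite nth_uniq ?enum_uniq -?cardE ?rest_card // => /eqP jj.
  by congr (inr (_, _)); apply: val_inj.
apply/existsP; exists [ffun x => f x]; apply/andP; split.
  by apply/injectiveP => x y; rewrite !ffunE => /f_inj.
apply/forall_inP => _ /imsetP[i _ ->].
have [ae ai vi av] := ends_i (ltn_ord i).
have aS : a (ordS i) = v i.
  rewrite /a /=; have [ik|ik] := ltnP i.+1 k.
    by rewrite modn_small //=; apply: set_nth_default; rewrite vs_size.
  have -> : i.+1 = k by apply/eqP; rewrite eqn_leq ik andbT ltn_ord.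
  rewrite modnn /= lastE; congr (nth _ _ _); have := ltn_ord i; lia.
suff -> : [ffun x => f x] @: linear_cycle_edge r i = e i by rewrite inE mem_nth ?es_size.
apply/setP => z; apply/imsetP/idP.
  move=> [x xE ->]; rewrite ffunE; move: xE; rewrite !inE => /orP[/orP[]/eqP->|].
  - exact: ai.
  - by rewrite /f aS.
  - by move=> /imsetP[j _ ->]; have := f_rest i j; rewrite inE => /andP[].
move=> ze; have [zr|] := boolP (z \in rest i).
  have jr : (index z (enum (rest i)) < r - 2)%N.
    by rewrite -(rest_card (ltn_ord i)) cardE index_mem mem_enum.
  exists (inr (i, Ordinal jr)).
    by rewrite !inE; apply/orP; right; apply/imsetP; exists (Ordinal jr).
  by rewrite ffunE /= nth_index // mem_enum.
rewrite !inE ze andbT negbK => /orP[] /eqP ->.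
  by exists (inl i); rewrite ?ffunE // !inE eqxx.
by exists (inl (ordS i)); rewrite ?ffunE /f ?aS // !inE eqxx orbT.
Qed.

End Copy.

(** * Designated pairs and supersaturation *)

Lemma leq_bin_exp n k : ('C(n, k) <= n ^ k)%N.
Proof.
apply: (@leq_trans (n ^_ k)); first by rewrite -bin_ffact leq_pmulr // fact_gt0.
elim: k n => [|k IH] n; first by rewrite ffactn0.
by rewrite ffactnSr expnSr leq_mul // leq_subr.
Qed.

Lemma card_extensions (T : finType) (S H : {set T}) r :
  (#|[set f : {set T} | [&& #|f| == r, S \subset f & f :\: S \subset H]]| <= #|H| ^ (r - #|S|))%N.
Proof.
apply: leq_trans (leq_bin_exp _ _); rewrite -cards_draws.
rewrite -(card_in_imset (f := fun f => f :\: S)).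
  apply: subset_leq_card; apply/subsetP => _ /imsetP[f + ->].
  rewrite !inE => /and3P[/eqP fr Sf fH]; rewrite fH /=.
  by rewrite cardsD (setIidPr Sf) fr.
move=> f g; rewrite !inE => /and3P[_ Sf _] /and3P[_ Sg _] fg.
by rewrite -(setID f S) -(setID g S) (setIidPr Sf) (setIidPr Sg) fg.
Qed.

Section Designated.
Variables (R : realFieldType) (T : finType) (G : {set {set T}}) (r : nat) (x0 : T) (h : R).
Hypothesis Gr : G \subset complete_rgraph T r.
Hypothesis r4 : (4 <= r)%N.
Hypothesis h0 : 0 < h.
Local Notation n := (#|T|).
Hypothesis h3 : h ^+ 3 = n%:R ^+ 2.
Hypothesis n0 : (0 < n)%N.
Hypothesis G_large : (4 * n ^ r.-1 <= #|G|)%N.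

Definition deg u := #|[set f in G | u \in f]|.
Definition codeg u v := #|[set f in G | (u \in f) && (v \in f)]|.
(** With h = n^(2/3), a light codegree may exceed the average (r-1) deg(u) / n by a factor
    n^(1/3). *)
Definition light u v : bool := (codeg u v)%:R * h <= (r.-1)%:R * (deg u)%:R.
Definition low (f : {set T}) : T := [arg min_(u < odflt x0 [pick u in f] in f) deg u].
Definition mate (f : {set T}) : T := odflt x0 [pick v in f | (v != low f) && light (low f) v].
Definition good f := [&& f \in G, mate f \in f, mate f != low f & light (low f) (mate f)].

Let Gcard f : f \in G -> #|f| = r.
Proof. by move=> /(subsetP Gr); rewrite inE => /eqP. Qed.

Lemma lowP f : f \in G -> low f \in f /\ forall u, u \in f -> (deg (low f) <= deg u)%N.
Proof.
move=> fG; rewrite /low; case: pickP => [u uf|f0] /=.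
  by case: arg_minnP => // v vf vmin; split.
have : (0 < #|f|)%N by rewrite Gcard //; apply: leq_trans r4.
by case/card_gt0P=> u uf; have := f0 u; rewrite uf.
Qed.

Lemma deg_sum : (\sum_u deg u = r * #|G|)%N.
Proof.
under eq_bigr do rewrite /deg -sum1_card.
under eq_bigr do under eq_bigl do rewrite inE.
rewrite (exchange_big_dep (mem G)) /=; last by move=> u f _ /andP[].
rewrite (eq_bigr (fun=> r)); last first.
  by move=> f fG; under eq_bigl do rewrite fG; rewrite sum1_card Gcard.
by rewrite sum_nat_const mulnC.
Qed.

Lemma codeg_sum u : (\sum_(v | v != u) codeg u v = r.-1 * deg u)%N.
Proof.
under eq_bigr do rewrite /codeg -sum1_card.
under eq_bigr do under eq_bigl do rewrite inE.
rewrite (exchange_big_dep (fun f => (f \in G) && (u \in f))) /=; last by move=> v f _ /and3P[-> ->].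
rewrite (eq_bigr (fun=> r.-1)); last first.
  move=> f /andP[fG uf]; rewrite fG uf /= -(Gcard fG) (cardsD1 u) uf add1n /= -sum1_card.
  by apply: eq_bigl => v; rewrite !inE.
by rewrite sum_nat_const mulnC /deg; congr (_ * _)%N; apply: eq_card => f; rewrite inE.
Qed.

Definition heavy u := [set v | (v != u) && ~~ light u v].

Lemma heavy_card u : #|heavy u|%:R <= h.
Proof.
have [d0|d0] := posnP (deg u).
  rewrite (_ : heavy u = set0) ?cards0 ?ltW //; apply/setP => v; rewrite !inE.
  apply/negbTE; rewrite negb_and negbK; apply/orP; right.
  rewrite /light d0 (_ : codeg u v = 0%N); first by rewrite mulr0n mul0r mulr0 lexx.
  apply/eqP; rewrite -leqn0 -d0; apply: subset_leq_card; apply/subsetP => f.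
  by rewrite !inE => /and3P[-> ->].
have w0 : 0 < (r.-1)%:R * (deg u)%:R :> R by rewrite -natrM ltr0n muln_gt0 d0 andbT; lia.
rewrite -(ler_pM2r w0); apply: (@le_trans _ _ (\sum_(v in heavy u) (codeg u v)%:R * h)).
  rewrite (_ : #|heavy u|%:R * _ = \sum_(v in heavy u) (r.-1)%:R * (deg u)%:R);
    last by rewrite sumr_const mulr_natl.
  apply: ler_sum => v.
  by rewrite inE /light -ltNge => /andP[_ /ltW].
rewrite -mulr_suml mulrC ler_pM2l // -natrM -codeg_sum -natr_sum ler_nat.
rewrite [leqRHS](bigID (fun v => light u v)) /= addnC -[leqLHS]addn0 leq_add //.
by rewrite (eq_bigl (fun v => (v != u) && ~~ light u v)) // => v; rewrite inE.
Qed.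

(** In a bad edge all vertices other than [low] are heavy for it, so there are at most n h^(r-1) bad
    edges. Here r >= 4 enters: h^(r-1) = n^2 h^(r-4) <= n^(r-2). *)
Lemma bad_card : (#|[set f in G | ~~ good f]| <= n ^ r.-1)%N.
Proof.
rewrite -(ler_nat R); apply: (@le_trans _ _ (\sum_(u : T) h ^+ r.-1)).
  apply: (@le_trans _ _ (\sum_(u : T) #|heavy u|%:R ^+ r.-1)); last first.
    by apply: ler_sum => u _; rewrite lerXn2r ?nnegrE ?heavy_card ?(ltW h0).
  under eq_bigr do rewrite -natrX; rewrite -natr_sum ler_nat.
  rewrite -sum1_card (partition_big low xpredT) //=; apply: leq_sum => u _.
  rewrite sum1_card -[X in (_ ^ X)%N]subn1 -(cards1 u).
  apply: leq_trans (card_extensions [set u] (heavy u) r).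
  apply: subset_leq_card; apply/subsetP => f.
  rewrite unfold_in !inE => /andP[/andP[fG nf] /eqP lu].
  have [lf lmin] := lowP fG.
  rewrite (Gcard fG) eqxx sub1set -lu lf /=; apply/subsetP => v; rewrite !inE => /andP[vl vf].
  rewrite vl /=; apply: contra nf => lv; rewrite /good fG /mate.
  case: pickP => [w /and3P[-> -> ->] //|none] /=.
  by have := none v; rewrite /= vf vl lv.
rewrite sumr_const -[leLHS]mulr_natl natrX.
have n1 : 1 <= n%:R :> R by rewrite ler1n.
have hn : h <= n%:R.
  rewrite leNgt; apply/negP => hn.
  have : n%:R ^+ 3 < h ^+ 3 by rewrite ltrXn2r // ltW.
  by rewrite h3 ltNge ler_weXn2l.
have -> : r.-1 = (r - 4 + 3)%N by lia.
have -> : (r - 4 + 3 = (r - 4 + 2).+1)%N by lia.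
rewrite [leRHS]exprS ler_wpM2l // (_ : (r - 4 + 2).+1 = (r - 4 + 3))%N; last by lia.
by rewrite exprD h3 exprD ler_wpM2r ?exprn_ge0 // lerXn2r ?nnegrE // ltW.
Qed.

Lemma good_card : (3 * #|G| <= 4 * #|[set f | good f]|)%N.
Proof.
have : (#|G| = #|[set f | good f]| + #|[set f in G | ~~ good f]|)%N.
  rewrite -(cardsID [set f | good f] G); congr (_ + _)%N; apply: eq_card => f; rewrite !inE.
    by rewrite andbC; case g: (good f) => //; case/and4P: g.
  by rewrite andbC.
have := bad_card; have := G_large; lia.
Qed.

(** This is why [low] has minimum degree: lightness seen from [low] then also holds seen from
    [mate]. *)
Lemma good_codeg f : good f -> (codeg (low f) (mate f))%:R * h <= (r.-1)%:R * (deg (low f))%:R /\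
  (codeg (low f) (mate f))%:R * h <= (r.-1)%:R * (deg (mate f))%:R.
Proof.
case/and4P=> fG mf ml li; split=> //; apply: le_trans li _.
by rewrite ler_wpM2l // ler_nat; case: (lowP fG) => _; apply.
Qed.

Definition pair_count u v :=
  #|[set f | good f && (((u == low f) && (v == mate f)) || ((u == mate f) && (v == low f)))]|.

(** Sparse pairs lose at most a quarter of [G] in total. The count runs over good edges, so the
    condition depends on the pair alone and all good edges of a pair are kept or dropped
    together. *)
Definition kept f := good f && (#|G| <= 4 * n ^ 2 * pair_count (low f) (mate f))%N.

Lemma kept_card : (#|G| <= 2 * #|[set f | kept f]|)%N.
Proof.
have lost : (4 * #|[set f | good f && ~~ kept f]| <= #|G|)%N.
  suff : (4 * n ^ 2 * #|[set f | good f && ~~ kept f]| <= n ^ 2 * #|G|)%N.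
    by rewrite mulnAC [leqLHS]mulnC leq_pmul2l // expn_gt0 n0.
  rewrite -sum1_card (partition_big (fun f => (low f, mate f)) xpredT) //= big_distrr /=.
  rewrite (_ : n ^ 2 * #|G| = \sum_(uv : T * T) #|G|)%N; last first.
    by rewrite sum_nat_const card_prod expnS expn1.
  apply: leq_sum => -[u v] _; rewrite sum1_card.
  set c := (X in (_ * X <= _)%N); have [c0|] := posnP c; first by rewrite c0 muln0.
  case/card_gt0P=> f; rewrite unfold_in inE xpair_eqE => /andP[/andP[gf nk] /andP[/eqP uE /eqP vE]].
  move: nk; rewrite /kept gf /= -ltnNge => /ltnW; apply: leq_trans.
  rewrite leq_mul2l; apply/orP; right; apply: subset_leq_card; apply/subsetP => f'.
  rewrite unfold_in !inE xpair_eqE => /andP[/andP[-> _] /andP[/eqP -> /eqP ->]].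
  by rewrite uE vE !eqxx.
have : (#|[set f | good f]| = #|[set f | kept f]| + #|[set f | good f && ~~ kept f]|)%N.
  rewrite -(cardsID [set f | kept f] [set f | good f]); congr (_ + _)%N; apply: eq_card => f.
    by rewrite !inE /kept; case: (good f).
  by rewrite !inE andbC.
have := good_card; lia.
Qed.

End Designated.

Lemma endsE (R : realFieldType) (X T : finType) (act : pred X) (s t : X -> T) f u v :
  (act f -> s f != t f) ->
  (ends act s t f u v)%:R = (act f)%:R * (((u == s f) && (v == t f))%:R + ((u == t f) && (v == s f))%:R) :> R.
Proof.
rewrite /ends; case: (act f) => [/(_ isT) st|_]; last by rewrite mul0r.
rewrite mul1r; case: (eqVneq u (s f)) => [->|_] /=; last by rewrite add0r.
by rewrite (negbTE st) orbF addr0.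
Qed.

Lemma pred_subn3 r : (4 <= r)%N -> r.-1 = (r - 3 + 2)%N.
Proof. by lia. Qed.

Lemma cycle_exponent k j : (0 < j <= k)%N -> (k.-1 * j = k - j + k * j.-1)%N.
Proof. by case: k j => [|k] [|j] //=; nia. Qed.

Lemma eighths_le_half (R : realFieldType) (a c w : R) :
  a <= w / 16 -> c <= 1 / 8 -> 1 <= w -> w / 8 + c + a <= w / 2.
Proof. by move=> *; lra. Qed.

(** * Balanced supersaturation *)

Section Supersaturation.
Variables (R : realFieldType) (T : finType) (G : {set {set T}}) (r l d : nat) (x0 : T) (h y : R).
Local Notation n := (#|T|).
Local Notation e := (#|G|%:R : R).
Hypothesis root_ex : forall w : R, 1 <= w -> exists2 V, 1 <= V & V ^+ l.*2 = w.
Hypothesis Gr : G \subset complete_rgraph T r.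
Hypothesis l2 : (2 <= l)%N.
Hypothesis r4 : (4 <= r)%N.
Hypothesis h1 : 1 <= h.
Hypothesis h3 : h ^+ 3 = n%:R ^+ 2.
Hypothesis y1 : 1 <= y.
Hypothesis yE : y ^+ l.*2.-1 = n%:R.
Hypothesis G_large : (64 * l.*2 ^ 2 * r.+1 * n ^ r.-1 <= #|G|)%N.
(** The degrees sum to r e and the summands e / n to e, so this value makes the total of [mu] equal
    to e / 2. *)
Definition sigma : R := (2 * r.+1)%:R.
Hypothesis d_large : n%:R * sigma ^+ l.*2 <= 2 ^+ d.
(** The factors that the last part of the budget in [half_good] has to absorb. *)
Definition revisit_const : R :=
  8 * l.*2%:R ^+ 2 * (r.-1%:R * sigma ^+ 2) ^+ l * (8 * l.*2%:R ^+ 2) ^+ l.-2.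
Hypothesis n_large : revisit_const * n%:R <= h ^+ 2.

(** The constant k1 sg^2 L behind [kpow_gap_le], with k1 = (r-1) sigma and L = 2 (d + 2l) from
    [edge_balanced]. *)
Definition gap_const : R := r.-1%:R * sigma * sigma ^+ 2 * (2 * (d + l.*2)%:R).
Definition spread_const : R := 2 * (2 * gap_const) ^+ l.*2.

Let h0 : 0 < h. Proof. exact: lt_le_trans h1. Qed.
Let y0 : 0 < y. Proof. exact: lt_le_trans y1. Qed.
Let n0 : (0 < n)%N. Proof. by apply/card_gt0P; exists x0. Qed.
Let n0' : 0 < n%:R :> R. Proof. by rewrite ltr0n. Qed.
Let k1 : (1 <= l.*2)%N. Proof. by rewrite double_gt0; nlia. Qed.
Let G4 : (4 * n ^ r.-1 <= #|G|)%N.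
Proof.
apply: leq_trans G_large; rewrite leq_mul2r; apply/orP; right.
have p0 : (0 < l.*2 ^ 2 * r.+1)%N by rewrite muln_gt0 expn_gt0 k1.
by rewrite -mulnA; apply: (@leq_trans (64 * 1)); rewrite // leq_mul2l.
Qed.
Let e0 : 0 < e.
Proof. by rewrite ltr0n; apply: leq_trans G4; rewrite muln_gt0 expn_gt0 n0. Qed.
Let sg1 : 1 <= sigma. Proof. by rewrite /sigma ler1n. Qed.
Let sg0 : 0 < sigma. Proof. exact: lt_le_trans sg1. Qed.

Local Notation low := (low G x0).
Local Notation mate := (mate G r x0 h).
Local Notation kept := (kept G r x0 h).
Local Notation good := (good G r x0 h).

(** The added e / n bounds the weights 1 / mu at vertices of small degree. *)
Let mu u : R := ((deg G u)%:R + e / n%:R) / sigma.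
Let B u v : R := #|[pred f | ends kept low mate f u v]|%:R.

Let mu0 u : 0 < mu u.
Proof. by rewrite divr_gt0 // ltr_wpDl // divr_gt0. Qed.
Let deg_mu u : (deg G u)%:R <= sigma * mu u.
Proof. by rewrite /mu mulrC divfK ?gt_eqF // lerDl divr_ge0 // ltW. Qed.
Let kept_good f : kept f -> good f. Proof. by case/andP. Qed.
Let good_ne f : good f -> low f != mate f. Proof. by case/and4P=> _ _ ml _; rewrite eq_sym. Qed.
Let good_in f : good f -> [/\ f \in G, low f \in f & mate f \in f].
Proof. by case/and4P=> fG mf _ _; split=> //; case: (lowP x0 Gr r4 fG). Qed.
Let kept_ne f : kept f -> low f != mate f. Proof. by move/kept_good/good_ne. Qed.

Let BE u v : B u v = \sum_f (ends kept low mate f u v)%:R.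
Proof.
rewrite /B -sum1_card natr_sum big_mkcond; apply: eq_bigr => f _.
by rewrite inE; case: ifP.
Qed.

Let ends_in f u v : ends kept low mate f u v -> [/\ f \in G, u \in f & v \in f].
Proof. by case/andP=> /kept_good/good_in[fG lf mf] /orP[] /andP[/eqP -> /eqP ->]. Qed.

Let B_sym u v : B u v = B v u.
Proof. by rewrite /B; congr (_%:R); apply: eq_card => f; rewrite !inE ends_sym. Qed.

Let B_irr u : B u u = 0.
Proof.
rewrite /B (eq_card0 (A := [pred f | _])) // => f; rewrite !inE; apply/negP => /andP[/kept_ne kf].
by case/orP => /andP[/eqP e1 /eqP e2]; move: kf; rewrite -e1 -e2 eqxx.
Qed.

Let row u : \sum_v B u v <= sigma * mu u.
Proof.
apply: le_trans (deg_mu u); under eq_bigr do rewrite BE.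
rewrite exchange_big /deg -sum1_card natr_sum [leRHS]big_mkcond; apply: ler_sum => f _ /=.
have pick (w : T) (c : bool) : \sum_v (c && (v == w))%:R = c%:R :> R.
  by rewrite (bigD1 w) //= eqxx andbT big1 ?addr0 // => v /negbTE ->; rewrite andbF.
under eq_bigr do rewrite (endsE _ _ _ (@kept_ne f)).
rewrite -mulr_sumr big_split /= !pick.
have [kf|_] := boolP (kept f); last by rewrite mul0r; case: ifP.
have [fG lf mf] := good_in (kept_good kf); rewrite inE fG mul1r.
have [->|ul] := eqVneq u (low f); first by rewrite lf (negbTE (kept_ne kf)) addr0.
by rewrite add0r; have [->|_] := eqVneq u (mate f); rewrite ?mf //=; case: ifP.
Qed.

Let mu_sum : \sum_u mu u <= e / 2.
Proof.
rewrite -mulr_suml big_split /= -natr_sum (deg_sum Gr) sumr_const.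
rewrite (_ : e / n%:R *+ _ = e); last first.
  by rewrite -[LHS]mulr_natr mulfVK // gt_eqF.
have rr : r.+1%:R = r%:R + 1 :> R by rewrite natr1.
rewrite /sigma !natrM rr le_eqVlt; apply/orP; left; apply/eqP.
by field; rewrite natr1 pnatr_eq0.
Qed.

Let B_sum : e <= \sum_u \sum_v B u v.
Proof.
have -> : \sum_u \sum_v B u v = 2 * #|[set f | kept f]|%:R.
  under eq_bigr do under eq_bigr do rewrite BE.
  under eq_bigr do rewrite exchange_big; rewrite exchange_big /=.
  rewrite -sum1_card natr_sum mulr_sumr [RHS]big_mkcond; apply: eq_bigr => f _; rewrite inE.
  under eq_bigr do under eq_bigr do rewrite (endsE _ _ _ (@kept_ne f)).
  have pick (a c : T) : \sum_u \sum_v ((u == a) && (v == c))%:R = 1 :> R.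
    rewrite (bigD1 a) //= (bigD1 c) //= !eqxx !big1 ?addr0 //.
      by move=> u /negbTE ua; rewrite big1 // => v _; rewrite ua.
    by move=> v /negbTE ->; rewrite andbF.
  under eq_bigr do rewrite -mulr_sumr big_split /=.
  rewrite -mulr_sumr big_split /= !pick; case: (kept f); rewrite ?mul0r //.
  by rewrite mul1r mulr1.
rewrite -natrM ler_nat; exact: (kept_card x0 Gr r4 h0 h3 n0 G4).
Qed.

Let kap : R := r.-1%:R * sigma / h.

Let codegC u v : codeg G u v = codeg G v u.
Proof. by apply: eq_card => f; rewrite !inE [(u \in f) && _]andbC. Qed.

Let B_le u v : B u v <= kap * mu u.
Proof.
have [z|] := posnP #|[pred f | ends kept low mate f u v]|.
  rewrite /B z mulr0n mulr_ge0 ?(ltW (mu0 u)) // /kap.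
  by rewrite divr_ge0 ?mulr_ge0 ?(ltW sg0) ?(ltW h0).
case/card_gt0P=> f; rewrite inE => fe.
have Bc : B u v <= (codeg G u v)%:R.
  rewrite ler_nat; apply: subset_leq_card; apply/subsetP => f'; rewrite !inE.
  by case/ends_in=> -> -> ->.
have ch : (codeg G u v)%:R * h <= r.-1%:R * (deg G u)%:R.
  case/andP: fe => /kept_good gf /orP[] /andP[/eqP -> /eqP ->].
    by case: (good_codeg Gr r4 gf).
  by rewrite codegC; case: (good_codeg Gr r4 gf).
apply: le_trans Bc _; rewrite /kap mulrAC ler_pdivlMr //; apply: le_trans ch _.
by rewrite -mulrA ler_wpM2l.
Qed.

Section Chosen.
Variable H : {set T * T}.
Let b := density B mu H.
Let act f := kept f && (((low f, mate f) \in H) && ((mate f, low f) \in H)).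
Let W := closed_walks b mu l.*2.
Hypothesis W1 : 1 <= W.
Hypothesis balanced : forall u v, 0 < restrict B H u v ->
  kpow b mu l.*2.-1 u v <= 2 * (d + l.*2)%:R * W / e.

Let act_ne f : act f -> low f != mate f. Proof. by case/andP=> /kept_ne. Qed.

Let bE u v : b u v = #|[pred f | ends act low mate f u v]|%:R / (mu u * mu v).
Proof.
rewrite /b /density /restrict; congr (_ / _).
case: ifP => [/andP[uv vu]|nuv].
  rewrite /B; congr (_%:R); apply: eq_card => f; rewrite !inE /ends /act.
  case: (kept f) => //=.
  have [/andP[/eqP <- /eqP <-]|n1] /= := boolP ((u == low f) && _); first by rewrite uv vu.
  have [/andP[/eqP <- /eqP <-]|n2] /= := boolP ((u == mate f) && _); first by rewrite uv vu.
  by rewrite andbF.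
rewrite (eq_card0 (A := [pred f | _])) // => f; rewrite !inE /ends /act.
apply/negP => /andP[/andP[_ /andP[lm ml]] /orP[]] /andP[/eqP e1 /eqP e2].
  by move: nuv; rewrite e1 e2 lm ml.
by move: nuv; rewrite e1 e2 lm ml.
Qed.

Let eps : R := 4 * n%:R ^+ r.-1 / e.

Let pair_countC u v : pair_count G r x0 h u v = pair_count G r x0 h v u.
Proof.
apply: eq_card => f; rewrite !inE; congr (_ && _).
by rewrite orbC [(u == mate f) && _]andbC [(u == low f) && _]andbC.
Qed.

Let codegree3 u v z : z != u -> z != v ->
  #|[pred f | ends act low mate f u v && (z \in f)]|%:R <= eps * #|[pred f | ends act low mate f u v]|%:R.
Proof.
move=> zu zv; have [N0|] := posnP #|[pred f | ends act low mate f u v]|.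
  rewrite N0 mulr0 (_ : #|_| = 0%N) //; apply/eqP; rewrite -leqn0 -N0.
  by apply: subset_leq_card; apply/subsetP => f; rewrite !inE => /andP[].
case/card_gt0P=> f; rewrite inE => /andP[/andP[kf Hf] fuv].
have uv : u != v.
  by case/orP: fuv => /andP[/eqP -> /eqP ->]; rewrite 1?eq_sym ?kept_ne // eq_sym kept_ne.
have pc : pair_count G r x0 h u v = pair_count G r x0 h (low f) (mate f).
  by case/orP: fuv => /andP[/eqP -> /eqP ->] //; apply: pair_countC.
(* Being kept and lying over [H] depend on the pair only, so all good edges over an active pair are
   active: at least e / (4n^2), against at most n^(r-3) through a third vertex. *)
have cnt : (pair_count G r x0 h u v <= #|[pred f' | ends act low mate f' u v]|)%N.
  apply: subset_leq_card; apply/subsetP => f'; rewrite !inE => /andP[gf' f'uv].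
  rewrite /ends f'uv andbT /act /kept gf' /=.
  have -> : pair_count G r x0 h (low f') (mate f') = pair_count G r x0 h (low f) (mate f).
    by rewrite -pc; case/orP: f'uv => /andP[/eqP -> /eqP ->] //; apply: pair_countC.
  case/andP: kf => _ -> /=; case/andP: Hf => H1 H2.
  case/orP: fuv f'uv => /andP[/eqP -> /eqP ->] /orP[] /andP[/eqP <- /eqP <-];
    by rewrite ?H1 ?H2.
have ext : (#|[pred f' | ends act low mate f' u v && (z \in f')]| <= n ^ (r - 3))%N.
  have := card_extensions [set u; v; z] [set: T] r; rewrite cardsT.
  have -> : #|[set u; v; z]| = 3%N.
    by rewrite setUC cardsU1 cards2 uv !inE negb_or zu zv.
  apply: leq_trans; apply: subset_leq_card; apply/subsetP => f'; rewrite !inE.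
  move=> /andP[/andP[/andP[kf' _] f'uv] zf'].
  have /ends_in[f'G uf vf] : ends kept low mate f' u v by rewrite /ends kf' f'uv.
  have := fintype.subsetP Gr f' f'G; rewrite inE => ->; rewrite subsetT andbT /=.
  by apply/subsetP => x; rewrite !inE => /orP[/orP[]|] /eqP ->.
apply: (@le_trans _ _ (n ^ (r - 3))%:R); first by rewrite ler_nat.
rewrite /eps mulrAC ler_pdivlMr // natrX.
have [_ kc] := andP kf; rewrite -pc in kc.
have {}kc : e <= 4 * n%:R ^+ 2 * #|[pred f' | ends act low mate f' u v]|%:R.
  rewrite -natrX -!natrM ler_nat; apply: leq_trans kc _; by rewrite leq_mul2l cnt orbT.
rewrite (pred_subn3 r4).
rewrite exprD; apply: (@le_trans _ _ (n%:R ^+ (r - 3) * (4 * n%:R ^+ 2 * #|[pred f' | ends act low mate f' u v]|%:R))).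
  by rewrite ler_wpM2l ?exprn_ge0.
by rewrite le_eqVlt; apply/orP; left; apply/eqP; ring.
Qed.

Let b0 u v : 0 <= b u v. Proof. exact: (chain_b_ge0 mu0 bE). Qed.
Let b_sym u v : b u v = b v u. Proof. exact: chain_b_sym bE u v. Qed.

Let b_mu u v : b u v * mu v = restrict B H u v / mu u.
Proof. by rewrite /b /density; field; rewrite !gt_eqF. Qed.

Let b_row u : \sum_v b u v * mu v <= sigma.
Proof.
under eq_bigr do rewrite b_mu; rewrite -mulr_suml ler_pdivrMr //.
apply: le_trans (row u); apply: ler_sum => v _.
by rewrite /restrict; case: ifP => // _; rewrite BE sumr_ge0.
Qed.

Let b_le u v : b u v * mu v <= kap.
Proof.
rewrite b_mu ler_pdivrMr //; apply: le_trans (B_le u v).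
by rewrite /restrict; case: ifP => // _; rewrite BE sumr_ge0.
Qed.

Let kap0 : 0 <= kap. Proof. by rewrite divr_ge0 ?mulr_ge0 ?(ltW sg0) ?(ltW h0). Qed.

(** Amounts to n^(1/3) <= n^((l-1)/(2l-1)), with equality of exponents at l = 2. *)
Let kap_small : kap * n%:R <= r.-1%:R * sigma * y ^+ l.-1.
Proof.
rewrite /kap mulrAC -mulrA ler_wpM2l ?mulr_ge0 ?(ltW sg0) //.
rewrite -(@ler_pXn2r _ 3) ?nnegrE ?divr_ge0 ?exprn_ge0 ?(ltW h0) ?(ltW y0) //.
rewrite expr_div_n h3 exprSr mulrAC divff ?mul1r ?expf_neq0 ?gt_eqF // -yE -exprM.
by rewrite ler_weXn2l //; nlia.
Qed.

Let mu_low u : e <= sigma * n%:R * mu u.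
Proof.
rewrite mulrAC mulrC [sigma * _]mulrC divfK ?gt_eqF // mulrDr mulrCA divff ?gt_eqF // mulr1.
by rewrite lerDr mulr_ge0.
Qed.

Let L : R := 2 * (d + l.*2)%:R.
Let L1 : 1 <= L. Proof. by rewrite /L -natrM ler1n muln_gt0 addn_gt0 k1 orbT. Qed.
Let k11 : 1 <= r.-1%:R * sigma.
Proof. by rewrite mulr_ege1 // ler1n; nlia. Qed.

Let balanced' u v : 0 < b u v -> kpow b mu l.*2.-1 u v <= L * W / e.
Proof.
move=> buv; apply: balanced.
by rewrite -(pmulr_rgt0 _ (mulr_gt0 (mu0 u) (mu0 v))) in buv *; move: buv;
  rewrite /b densityK // => h'; rewrite pmulr_rgt0 ?mulr_gt0.
Qed.

Let cp (es : seq {set T}) := contains_copy [set z in es] (linear_cycle l.*2 r) && all (mem G) es.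
Let cc := closed_chain mu act low mate.

(** The budget: repeated joints cost W/8 + 1/8, where 1/8 comes from [n_large], and intersections
    cost W/16 by [G_large]. *)
Let half_good : psum (nseq l.*2 None) (fun es => cc es * (~~ cp es)%:R) <= W / 2.
Proof.
pose del : R := (8 * l.*2%:R ^+ 2)^-1.
have kk0 : 0 < l.*2%:R ^+ 2 :> R by rewrite exprn_gt0 // ltr0n.
have del0 : 0 < del by rewrite invr_gt0 mulr_gt0.
have W0 : 0 <= W by apply: le_trans W1.
pose D := del * W + n%:R * ((kap * sigma) ^+ l / del ^+ l.-2).
have D0 : 0 <= D.
  apply: addr_ge0; first by rewrite mulr_ge0 ?(ltW del0).
  apply: mulr_ge0 => //; apply: divr_ge0; apply: exprn_ge0; last exact: ltW.
  by apply: mulr_ge0 => //; apply: ltW.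
have eps0 : 0 <= eps by rewrite divr_ge0 ?mulr_ge0 ?exprn_ge0.
have hD g : (2 <= g)%N -> (g + 2 <= l.*2)%N ->
    \sum_w mu w ^+ 2 * (kpow b mu g w w * kpow b mu (l.*2 - g) w w) <= D.
  by move=> g2 gl; apply: revisit_le.
have dl := @degenerate_le R T mu b act low mate x0 r eps mu0 act_ne bE eps0 codegree3
  l.*2 D cp k1 D0 hD.
apply: le_trans (dl _) _.
  move=> vs es vk ek tn uv nh nm.
  have Gin f : act f -> f \in G by case/andP=> /kept_good/good_in[].
  apply/andP; split.
    apply: (copy_of_chain (x0 := x0) act_ne _ _ _ vk ek tn uv nh nm).
    - by move=> f /andP[/kept_good/good_in[]].
    - by move=> f /andP[/kept_good/good_in[]].
    - by move=> f /Gin fG; have := fintype.subsetP Gr f fG; rewrite inE => /eqP.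
  apply/(all_nthP set0) => i; rewrite ek -vk => iv; apply: Gin.
  by have /andP[] := trail_ends tn iv.
rewrite -/W; set k2 : R := l.*2%:R ^+ 2.
have e1 : k2 * (del * W) = W / 8.
  by rewrite /del -/k2; field; rewrite gt_eqF.
have e2 : k2 * (r.+1%:R * eps * W) <= W / 16.
  rewrite !mulrA [W / 16]mulrC ler_wpM2r // ler_pdivrMr // ler_pdivlMl //.
  by move: G_large; rewrite -(ler_nat R) !natrM !natrX; apply: le_trans; rewrite /k2 le_eqVlt;
    apply/orP; left; apply/eqP; ring.
have e3 : k2 * (n%:R * ((kap * sigma) ^+ l / del ^+ l.-2)) <= 1 / 8.
  have -> : kap * sigma = (r.-1%:R * sigma ^+ 2) / h by rewrite /kap; field; rewrite gt_eqF.
  rewrite expr_div_n (_ : (del ^+ l.-2)^-1 = (8 * k2) ^+ l.-2); last by rewrite /del exprVn invrK.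
  have hl : h ^+ 2 <= h ^+ l by rewrite ler_weXn2l.
  have := le_trans n_large hl; rewrite /revisit_const -/k2 => c1.
  rewrite ler_pdivlMr //; set P := (r.-1%:R * sigma ^+ 2) ^+ l in c1 *.
  rewrite (_ : k2 * _ * 8 = (8 * k2 * P * (8 * k2) ^+ l.-2 * n%:R) / h ^+ l); last by ring.
  by rewrite ler_pdivrMr ?exprn_gt0 // mul1r.
rewrite /D !mulrDr e1; exact: eighths_le_half e2 e3 W1.
Qed.

Lemma chosen_spread V : 1 <= V -> V ^+ l.*2 = W ->
  exists w, spread G (y ^+ l.*2 / e) l.*2 spread_const w /\
    forall I : {set {set T}}, I \subset G -> ~~ contains_copy I (linear_cycle l.*2 r) -> independent l.*2 w I.
Proof.
move=> V1 VE.
have W0 : 0 < W by apply: lt_le_trans W1.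
have W2 : 0 <= 2 / W by rewrite divr_ge0 // ltW.
have cc0 es : 0 <= cc es by apply: closed_chain_ge0.
exists (fun es => 2 / W * (cc es * (cp es)%:R)); split; last first.
  move=> I IG nI es ek esI; rewrite (_ : cp es = false) ?mulr0 //.
  apply: contraNF nI => /andP[/existsP[f /andP[fi /forall_inP fc]] _].
  apply/existsP; exists f; rewrite fi /=; apply/forall_inP => x /fc.
  by rewrite inE => /(allP esI).
split.
- by move=> es; apply: mulr_ge0 => //; apply: mulr_ge0.
- by move=> es nes; rewrite /cp (negbTE nes) andbF mulr0 mulr0.
- rewrite psumZ.
  have := sum_closed_chain mu0 bE l.*2; rewrite -/W -/cc.
  rewrite (eq_psum (w2 := fun es => cc es * (cp es)%:R + cc es * (~~ cp es)%:R)); last first.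
    by move=> es _; case: (cp es); rewrite !(mulr1, mulr0, addr0, add0r).
  rewrite psumD => WE; have hg := half_good.
  rewrite mulrAC ler_pdivlMr //; lra.
move=> p pk p0; rewrite psumZ.
have C1 : 1 <= gap_const.
  exact: mulr_ege1 (mulr_ege1 k11 (exprn_ege1 2 sg1)) L1.
have C0 : 0 < gap_const := lt_le_trans ltr01 C1.
have V0 : 0 < V := lt_le_trans ltr01 V1.
have LC : L <= gap_const.
  rewrite /gap_const -/L -[leLHS]mul1r ler_wpM2r ?(le_trans ler01 L1) //.
  exact: mulr_ege1 k11 (exprn_ege1 2 sg1).
pose F0 := gap_const / e * n%:R * V.
have F00 : 0 <= F0 by rewrite !mulr_ge0 ?invr_ge0 ?(ltW C0) ?(ltW V0).
have rho0 : 0 <= V / y by rewrite divr_ge0 ?ltW.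
have Q0 : 0 <= L * W / e by rewrite divr_ge0 ?mulr_ge0 ?(le_trans ler01 L1) ?(ltW W0).
have gap g u v : (g < l.*2.-1)%N -> kpow b mu g u v <= F0 * (V / y) ^+ g.
  by apply: (kpow_gap_le mu0 b0 b_sym l2 e0 sg1 k11 L1 y1 V1 kap0 b_row b_le mu_low yE VE kap_small balanced').
have K1 (j : nat) : (j <= l.*2)%N -> 2 * (2 * gap_const) ^+ j <= spread_const.
  move=> jk; rewrite /spread_const ler_wpM2l // ler_weXn2l //.
  by rewrite -[leLHS]mul1r ler_pM // ler1n.
have := psum_closed_le mu0 act_ne bE F00 rho0 gap balanced' Q0 pk p0.
rewrite -/cc; set S := psum p cc => S_le.
have fk : (nfixed p <= l.*2)%N by rewrite -pk; apply: count_size.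
apply: (@le_trans _ _ (2 / W * S)).
  rewrite ler_wpM2l //; apply: le_psum => es _.
  by case: (cp es); rewrite ?mulr1 // mulr0.
have [f1|f1] := eqVneq (nfixed p) 1%N.
  rewrite f1 /= in S_le *; rewrite expr0 mulr1.
  apply: (@le_trans _ _ (2 / W * (2 * (L * W / e)))); first by rewrite ler_wpM2l.
  rewrite (_ : 2 / W * (2 * (L * W / e)) = 2 * (2 * L) / e); last by field; rewrite !gt_eqF.
  rewrite ler_wpM2r ?invr_ge0 ?(ltW e0) //; apply: le_trans (K1 1%N k1).
  by rewrite expr1 !ler_wpM2l.
rewrite (negbTE f1) in S_le.
apply: (@le_trans _ _ (2 / W * (2 ^+ nfixed p * F0 ^+ nfixed p * (V / y) ^+ (l.*2 - nfixed p)))).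
  by rewrite ler_wpM2l.
set j := nfixed p in p0 f1 fk S_le *.
(* The powers of V multiply to W and cancel, and n^j / y^(2l-j) = (y^(2l))^(j-1) because n =
   y^(2l-1). *)
rewrite (_ : 2 / W * _ = 2 * (2 * gap_const) ^+ j * (y ^+ l.*2 / e) ^+ j.-1 / e).
  rewrite ler_wpM2r ?invr_ge0 ?(ltW e0) // ler_wpM2r ?K1 //.
  by rewrite exprn_ge0 // divr_ge0 ?exprn_ge0 // ltW.
have jE : j = j.-1.+1 by rewrite prednK.
have VV : V ^+ j * V ^+ (l.*2 - j) = W by rewrite -exprD subnKC.
have yy : n%:R ^+ j = y ^+ (l.*2 - j) * (y ^+ l.*2) ^+ j.-1.
  rewrite -yE -!exprM -exprD; congr (_ ^+ _).
  by apply: cycle_exponent; rewrite p0 fk.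
have Fj : F0 ^+ j = gap_const ^+ j * (e ^+ j)^-1 * n%:R ^+ j * V ^+ j by rewrite /F0 !exprMn exprVn.
have ej : e ^+ j = e * e ^+ j.-1 by rewrite {1}jE exprS.
rewrite Fj yy ej -VV (expr_div_n V) (expr_div_n (y ^+ l.*2)) [(2 * gap_const) ^+ j]exprMn.
by field; rewrite !expf_neq0 ?gt_eqF.
Qed.

End Chosen.

Theorem supersaturation : exists w, spread G (y ^+ l.*2 / e) l.*2 spread_const w /\
  forall I : {set {set T}}, I \subset G -> ~~ contains_copy I (linear_cycle l.*2 r) -> independent l.*2 w I.
Proof.
have B0 u v : 0 <= B u v by [].
have l0 : (0 < l)%N by apply: leq_trans l2.
have [H [_ W1 bal]] := edge_balanced mu0 B0 B_sym B_irr (ltW sg0) e0 row mu_sum B_sum l0 d_large.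
have [V V1 VE] := root_ex W1.
exact: chosen_spread W1 bal V V1 VE.
Qed.

End Supersaturation.

(** * Repeating the container step until few edges remain *)

Section Iterate.
Variables (R : realFieldType) (X : finType) (F : {set X} -> Prop) (q : R) (c0 B : nat) (K : {set X}).
Hypothesis q0 : 0 <= q.
Hypothesis B0 : (0 < B)%N.

Definition container_family (G : {set X}) (m : nat) (bound : {set X} -> Prop) : Prop :=
  exists C : seq {set X}, [/\ (size C <= m)%N, forall c, c \in C -> c \subset G /\ bound c &
    forall I : {set X}, I \subset G -> F I -> exists2 c, c \in C & I \subset c].

Hypothesis round : forall G : {set X}, G \subset K -> (c0 <= #|G|)%N ->
  container_family G B (fun c => #|c|%:R <= q * #|G|%:R).

Lemma container_family_cat (s : seq {set X}) m (bound : {set X} -> Prop) :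
  (forall c, c \in s -> container_family c m bound) ->
  exists C : seq {set X}, [/\ (size C <= size s * m)%N,
    forall c, c \in C -> bound c /\ exists2 d, d \in s & c \subset d &
    forall I c : {set X}, c \in s -> I \subset c -> F I -> exists2 c', c' \in C & I \subset c'].
Proof.
elim: s => [|d s IH] hs; first by exists [::]; split=> // I c; rewrite in_nil.
have [C1 [s1 b1 f1]] := hs d (mem_head _ _).
have [|C2 [s2 b2 f2]] := IH; first by move=> c cs; apply: hs; rewrite inE cs orbT.
exists (C1 ++ C2); split.
- by rewrite size_cat mulSn leq_add.
- move=> c; rewrite mem_cat => /orP[/b1[cd bc]|/b2[bc [d' d's cd']]]; split=> //.
    by exists d; rewrite ?mem_head.
  by exists d'; rewrite // inE d's orbT.
- move=> I c; rewrite inE => /orP[/eqP ->|cs] Ic FI.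
    by have [c' c'C Ic'] := f1 I Ic FI; exists c'; rewrite // mem_cat c'C.
  by have [c' c'C Ic'] := f2 I c cs Ic FI; exists c'; rewrite // mem_cat c'C orbT.
Qed.

Lemma iterate_containers j (G : {set X}) : G \subset K ->
  container_family G (B ^ j) (fun c => (#|c| <= c0)%N \/ #|c|%:R <= q ^+ j * #|G|%:R).
Proof.
elim: j G => [|j IH] G GK.
  exists [:: G]; split=> //; last by move=> I IG _; exists G; rewrite ?mem_head.
  by move=> c; rewrite inE => /eqP ->; split=> //; right; rewrite mul1r.
have [small|big] := ltnP #|G| c0.
  exists [:: G]; split; last by move=> I IG _; exists G; rewrite ?mem_head.
    by rewrite expn_gt0 B0.
  by move=> c; rewrite inE => /eqP ->; split=> //; left; apply: ltnW.
have [C1 [s1 b1 f1]] := round GK big.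
have [|C2 [s2 b2 f2]] := @container_family_cat C1 (B ^ j)
  (fun c => (#|c| <= c0)%N \/ #|c|%:R <= q ^+ j.+1 * #|G|%:R).
  move=> c /b1[cG cq]; have [C [sC bC fC]] :=
    IH c (subset_trans cG GK); exists C; split=> // c' /bC[c'c bc'].
  split=> //; case: bc' => [|h]; [by left | right].
  by apply: le_trans h _; rewrite exprSr -mulrA ler_wpM2l ?exprn_ge0.
exists C2; split.
- by apply: leq_trans s2 _; rewrite expnS leq_mul2r s1 orbT.
- move=> c /b2[bc [d dC1 cd]]; split=> //; apply: subset_trans cd _.
  by case: (b1 d dC1).
- move=> I IG FI; have [c cC1 Ic] := f1 I IG FI; exact: f2 cC1 Ic FI.
Qed.

End Iterate.

Section CycleContainers.
Variables (R : realFieldType) (T : finType) (r l d m0 J : nat) (x0 : T) (h y : R).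
Local Notation n := (#|T|).
Hypothesis root_ex : forall w : R, 1 <= w -> exists2 V, 1 <= V & V ^+ l.*2 = w.
Hypothesis l2 : (2 <= l)%N.
Hypothesis r4 : (4 <= r)%N.
Hypothesis h1 : 1 <= h.
Hypothesis h3 : h ^+ 3 = n%:R ^+ 2.
Hypothesis y1 : 1 <= y.
Hypothesis yE : y ^+ l.*2.-1 = n%:R.
Hypothesis d_large : n%:R * sigma R r ^+ l.*2 <= 2 ^+ d.
Hypothesis n_large : revisit_const R r l * n%:R <= h ^+ 2.
Hypothesis m0_ge : y ^+ l.*2 <= m0%:R.
Hypothesis m0_le : m0%:R <= 2 * y ^+ l.*2.
Let Lam := 4 * shrink_const l.*2 (spread_const R r l d).
Hypothesis J_large : (1 - Lam^-1) ^+ J * n%:R ^+ r < 1.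

(** Since tau |G| = y^(2l) for every [G], the same [m0] serves in all rounds. *)
Lemma cycle_containers : exists C : seq {set {set T}},
  [/\ (size C <= (n ^ r).+1 ^ (l.*2 * m0 * J))%N,
      forall c, c \in C -> (#|c| <= 64 * l.*2 ^ 2 * r.+1 * n ^ r.-1)%N &
      forall F : {set {set T}}, F \subset complete_rgraph T r ->
        ~~ contains_copy F (linear_cycle l.*2 r) -> exists2 c, c \in C & F \subset c].
Proof.
pose K := complete_rgraph T r.
have n0 : (0 < n)%N by apply/card_gt0P; exists x0.
have Kn : (#|K| <= n ^ r)%N by rewrite card_draws; apply: leq_bin_exp.
have k0 : (0 < l.*2)%N by rewrite double_gt0; apply: leq_trans l2.
have r1 : (0 < r.-1)%N by case: (r) r4 => [|[|r']].
have gc1 : 1 <= gap_const R r l d.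
  by rewrite /gap_const /sigma -!natrX -!natrM ler1n !muln_gt0 r1 /= addn_gt0 k0 orbT.
have sc1 : 1 <= spread_const R r l d.
  rewrite /spread_const -[leLHS]mul1r ler_pM ?ler1n // exprn_ege1 //.
  by rewrite -[leLHS]mul1r ler_pM ?ler1n.
have Lam1 : 1 <= Lam.
  rewrite /Lam -[leLHS]mul1r ler_pM ?ler1n //.
  exact: le_trans sc1 (shrink_const_ge _ sc1).
have q0 : 0 <= 1 - Lam^-1 by rewrite subr_ge0 invf_le1 // (lt_le_trans ltr01).
have B0 : (0 < (n ^ r).+1 ^ (l.*2 * m0))%N by rewrite expn_gt0.
pose c0 := (64 * l.*2 ^ 2 * r.+1 * n ^ r.-1)%N.
have round (G : {set {set T}}) : G \subset K -> (c0 <= #|G|)%N ->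
    container_family (fun I : {set {set T}} => ~~ contains_copy I (linear_cycle l.*2 r)) G ((n ^ r).+1 ^ (l.*2 * m0))
      (fun c => #|c|%:R <= (1 - Lam^-1) * #|G|%:R).
  move=> GK Gc.
  have [w [w_sp w_ind]] := supersaturation x0 root_ex GK l2 r4 h1 h3 y1 yE Gc d_large n_large.
  have G0 : (0 < #|G|)%N by apply: leq_trans Gc; rewrite !muln_gt0 !expn_gt0 k0 n0.
  have e0 : 0 < #|G|%:R :> R by rewrite ltr0n.
  have t0 : 0 < y ^+ l.*2 / #|G|%:R by rewrite divr_gt0 // exprn_gt0 // (lt_le_trans ltr01).
  have tN : y ^+ l.*2 / #|G|%:R * #|G|%:R = y ^+ l.*2 by rewrite divfK // gt_eqF.
  have := container t0 G0 (m0 := m0) _ _ sc1 w_sp; rewrite tN => /(_ m0_ge m0_le).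
  case=> C [sC bC fC]; exists C; split.
  - apply: leq_trans sC _; rewrite leq_exp2r ?muln_gt0 ?k0 //.
      by rewrite ltnS (leq_trans _ Kn) // subset_leq_card.
    rewrite lt0n; apply/eqP => m00; move: m0_ge; rewrite m00 leNgt.
    by rewrite exprn_gt0 // (lt_le_trans ltr01).
  - by move=> c /bC.
  - by move=> I IG FI; apply: fC; split=> //; apply: w_ind.
have [C [sC bC fC]] := iterate_containers q0 B0 round J (subxx K).
exists C; split.
- by rewrite expnM.
(* A container that shrank in all J rounds has size below 1 by [J_large]. *)
- move=> c /bC[_ [//|h']]; suff -> : #|c| = 0%N by [].
  apply/eqP; rewrite -leqn0 -ltnS -(ltr_nat R); apply: le_lt_trans h' _.
  apply: le_lt_trans J_large; rewrite ler_wpM2l ?exprn_ge0 //.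
  by rewrite -natrX ler_nat.
- by move=> F FK nF; apply: fC.
Qed.

End CycleContainers.

(** * Binomial random subsets *)

Section Bernoulli.
Variables (R : realFieldType) (X : finType) (K : {set X}) (p : R).

Definition bern_weight (S : {set X}) : R := \prod_(e in K) (if e \in S then p else 1 - p).
Definition bern_E (f : {set X} -> R) : R := \sum_(S : {set X} | S \subset K) bern_weight S * f S.
Definition bern_Pr (A : pred {set X}) : R := \sum_(S : {set X} | (S \subset K) && A S) bern_weight S.

(** Expand a product with factor p + 0 on [A], p + (1 - p) on the rest of [K] and 0 + 1 elsewhere.
    The case of empty [A] says that the weights sum to 1. *)
Lemma bern_sub (A : {set X}) : A \subset K -> bern_Pr (fun S => A \subset S) = p ^+ #|A|.
Proof.
move=> AK.
have := @bigA_distr R 0 1 *%R +%R X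
  (fun e => if e \in K then p else 0)
  (fun e => if e \in K then if e \in A then 0 else 1 - p else 1).
rewrite (bigID (mem A)) /= [X in _ * X]big1 => [|e eA]; last first.
  by rewrite (negbTE eA); case: ifP => _; rewrite ?subrKC ?add0r.
rewrite mulr1 (eq_bigr (fun=> p)) => [|e eA]; last first.
  by rewrite eA (fintype.subsetP AK) // addr0.
rewrite prodr_const => ->; rewrite /bern_Pr [RHS](bigID (fun S : {set X} => (S \subset K) && (A \subset S))) /=.
rewrite [X in _ = _ + X]big1 ?addr0 => [|S]; last first.
  rewrite negb_and => /orP[] /subsetPn[e eS eK]; rewrite (bigD1 e) //=.
    by rewrite eS (negbTE eK) mul0r.
  by rewrite (negbTE eK) eS (fintype.subsetP AK) // mul0r.
apply: eq_bigr => S /andP[SK AS]; rewrite /bern_weight big_mkcond /=; apply: eq_bigr => e _.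
case: (boolP (e \in S)) => eS; first by rewrite (fintype.subsetP SK).
by rewrite (negbTE (contraNN (fintype.subsetP AS e) eS)).
Qed.

Lemma bern_PrE (A : pred {set X}) : bern_Pr A = bern_E (fun S => (A S)%:R).
Proof.
rewrite /bern_E /bern_Pr big_mkcondr /=; apply: eq_bigr => S _.
by case: (A S); rewrite ?mulr1 ?mulr0.
Qed.

Lemma bern_E1 : bern_E (fun=> 1) = 1.
Proof.
have := bern_sub (sub0set K); rewrite cards0 expr0 bern_PrE => h1; rewrite -[RHS]h1.
by apply: eq_bigr => S _ /=; rewrite sub0set.
Qed.

Lemma bern_ED f g : bern_E (fun S => f S + g S) = bern_E f + bern_E g.
Proof. by rewrite -big_split; apply: eq_bigr => S _; rewrite mulrDr. Qed.

Lemma bern_EZ c f : bern_E (fun S => c * f S) = c * bern_E f.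
Proof. by rewrite /bern_E mulr_sumr; apply: eq_bigr => S _; rewrite mulrCA. Qed.

Lemma bern_E_sum (I : Type) (s : seq I) (P : pred I) (f : I -> {set X} -> R) :
  bern_E (fun S => \sum_(i <- s | P i) f i S) = \sum_(i <- s | P i) bern_E (f i).
Proof. by rewrite /bern_E exchange_big; apply: eq_bigr => S _; rewrite mulr_sumr. Qed.

Lemma eq_bern_E f g : (forall S : {set X}, S \subset K -> f S = g S) -> bern_E f = bern_E g.
Proof. by move=> fg; apply: eq_bigr => S /fg ->. Qed.

Hypothesis p01 : 0 <= p <= 1.

Lemma bern_weight_ge0 S : 0 <= bern_weight S.
Proof. by case/andP: p01 => *; apply: prodr_ge0 => e _; case: ifP; rewrite ?subr_ge0. Qed.

Lemma le_bern_E f g : (forall S : {set X}, S \subset K -> f S <= g S) -> bern_E f <= bern_E g.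
Proof. by move=> fg; apply: ler_sum => S /fg; apply: ler_wpM2l; apply: bern_weight_ge0. Qed.

Lemma bern_Pr_ge0 A : 0 <= bern_Pr A.
Proof. by apply: sumr_ge0 => S _; apply: bern_weight_ge0. Qed.

Lemma le_bern_Pr (A B : pred {set X}) : (forall S : {set X}, S \subset K -> A S -> B S) ->
  bern_Pr A <= bern_Pr B.
Proof.
move=> AB; rewrite !bern_PrE; apply: le_bern_E => S SK; rewrite ler_nat.
by case: (boolP (A S)) => // /(AB S SK) ->.
Qed.

Lemma bern_PrC A : bern_Pr (fun S => ~~ A S) = 1 - bern_Pr A.
Proof.
rewrite -bern_E1 !bern_PrE -[RHS]addr0 -[X in X - _](_ : bern_E (fun S => (A S)%:R + (~~ A S)%:R) = _).
  by rewrite bern_ED; ring.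
by apply: eq_bern_E => S _; case: (A S); rewrite ?addr0 ?add0r.
Qed.

Lemma bern_Pr_le1 A : bern_Pr A <= 1.
Proof. by rewrite -subr_ge0 -bern_PrC bern_Pr_ge0. Qed.

Lemma bern_PrU (A B : pred {set X}) : bern_Pr (fun S => A S || B S) <= bern_Pr A + bern_Pr B.
Proof.
rewrite !bern_PrE -bern_ED; apply: le_bern_E => S _.
by case: (A S) => /=; rewrite ?add0r // lerDl.
Qed.

Lemma bern_Pr_has (I : eqType) (s : seq I) (A : I -> pred {set X}) :
  bern_Pr (fun S => has (A^~ S) s) <= \sum_(i <- s) bern_Pr (A i).
Proof.
elim: s => [|i s IH]; first by rewrite big_nil /bern_Pr big1 // => S; rewrite andbF.
rewrite big_cons; apply: le_trans (bern_PrU _ _) _; by rewrite lerD2l.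
Qed.

Lemma bern_markov f a : (forall S, 0 <= f S) -> 0 < a ->
  bern_Pr (fun S => a <= f S) <= bern_E f / a.
Proof.
move=> f0 a0; rewrite ler_pdivlMr // mulrC bern_PrE -bern_EZ; apply: le_bern_E => S _.
by case: (boolP (a <= f S)); rewrite ?mulr1 // mulr0.
Qed.

Lemma card_interE (S A : {set X}) : #|S :&: A|%:R = \sum_(e in A) (e \in S)%:R :> R.
Proof.
rewrite -sum1_card natr_sum big_mkcond [RHS]big_mkcond; apply: eq_bigr => e _.
by rewrite inE andbC; case: (e \in A); case: (e \in S).
Qed.

Lemma bern_mem e : e \in K -> bern_E (fun S => (e \in S)%:R) = p.
Proof.
move=> eK; have := @bern_sub [set e]; rewrite sub1set eK cards1 expr1 => /(_ isT) <-.
by rewrite bern_PrE; apply: eq_bern_E => S _; rewrite sub1set.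
Qed.

Lemma bern_mem2 e f : e \in K -> f \in K -> e != f ->
  bern_E (fun S => (e \in S)%:R * (f \in S)%:R) = p ^+ 2.
Proof.
move=> eK fK ef; have := @bern_sub [set e; f]; rewrite subUset !sub1set eK fK cards2 ef => /(_ isT) <-.
rewrite bern_PrE; apply: eq_bern_E => S _; rewrite subUset !sub1set.
by rewrite -natrM mulnb.
Qed.

Lemma bern_mean (A : {set X}) : A \subset K -> bern_E (fun S => #|S :&: A|%:R) = p * #|A|%:R.
Proof.
move=> AK; rewrite (eq_bern_E (g := fun S => \sum_(e in A) (e \in S)%:R)) => [|S _];
  last exact: card_interE.
rewrite bern_E_sum (eq_bigr (fun=> p)) => [|e eA]; last by rewrite bern_mem // (fintype.subsetP AK).
by rewrite sumr_const mulr_natr.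
Qed.

(** Distinct elements have covariance 0, and each variance p - p^2 is at most p. *)
Lemma bern_variance (A : {set X}) : A \subset K ->
  bern_E (fun S => (#|S :&: A|%:R - p * #|A|%:R) ^+ 2) <= p * #|A|%:R.
Proof.
move=> AK; case/andP: (p01) => p0 p1.
have cov e f : e \in A -> f \in A ->
    bern_E (fun S => ((e \in S)%:R - p) * ((f \in S)%:R - p)) <= if e == f then p else 0.
  move=> eA fA; have eK := fintype.subsetP AK e eA; have fK := fintype.subsetP AK f fA.
  rewrite (eq_bern_E (g := fun S => (e \in S)%:R * (f \in S)%:R +
     ((- p) * (e \in S)%:R + ((- p) * (f \in S)%:R + p ^+ 2 * 1)))) => [|S _]; last by ring.
  rewrite !bern_ED !bern_EZ bern_E1 !bern_mem //.
  case: eqVneq => [<-|ef]; last by rewrite bern_mem2 //; nra.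
  rewrite (eq_bern_E (g := fun S => (e \in S)%:R)) => [|S _];
    last by case: (e \in S); rewrite ?mulr1 ?mulr0.
  by rewrite bern_mem //; nra.
rewrite (eq_bern_E (g := fun S => \sum_(e in A) \sum_(f in A) ((e \in S)%:R - p) * ((f \in S)%:R - p))) => [|S _];
  last first.
  have -> : #|S :&: A|%:R - p * #|A|%:R = \sum_(e in A) ((e \in S)%:R - p).
    by rewrite sumrB -card_interE sumr_const mulr_natr.
  by rewrite expr2 mulr_suml; apply: eq_bigr => e _; rewrite mulr_sumr.
rewrite bern_E_sum; apply: (@le_trans _ _ (\sum_(e in A) p)); last by rewrite sumr_const mulr_natr.
apply: ler_sum => e eA; rewrite bern_E_sum.
apply: (@le_trans _ _ (\sum_(f in A) if e == f then p else 0)).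
  by apply: ler_sum => f fA; apply: cov.
rewrite (bigD1 e) //= eqxx big1 ?addr0 // => f /andP[_ /negbTE].
by rewrite eq_sym => ->.
Qed.

Lemma bern_chebyshev (A : {set X}) t : A \subset K -> 0 < t ->
  bern_Pr (fun S => t <= `|#|S :&: A|%:R - p * #|A|%:R|) <= p * #|A|%:R / t ^+ 2.
Proof.
move=> AK t0.
apply: (@le_trans _ _ (bern_Pr (fun S => t ^+ 2 <= (#|S :&: A|%:R - p * #|A|%:R) ^+ 2))).
  apply: le_bern_Pr => S _ h; rewrite -[leRHS]real_normK ?num_real //.
  by rewrite lerXn2r ?nnegrE ?normr_ge0 ?(ltW t0).
apply: le_trans (bern_markov _ _) _ => [S||]; [exact: sqr_ge0|exact: exprn_gt0|].
by rewrite ler_wpM2r ?invr_ge0 ?exprn_ge0 ?bern_variance // ltW.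
Qed.

Lemma bern_upper_tail (C : {set X}) M : C \subset K ->
  bern_Pr (fun S => (M <= #|S :&: C|)%N) <= 'C(#|C|, M)%:R * p ^+ M.
Proof.
move=> CK.
pose D := [set A : {set X} | A \subset C & #|A| == M].
apply: (@le_trans _ _ (bern_E (fun S => \sum_(A in D) (A \subset S)%:R))).
  rewrite bern_PrE; apply: le_bern_E => S SK.
  have [MS|_] := leqP M #|S :&: C|; last exact: sumr_ge0.
  have : (0 < #|[set A : {set X} | A \subset S :&: C & #|A| == M]|)%N.
    by rewrite cards_draws bin_gt0.
  case/card_gt0P=> A; rewrite inE subsetI => /andP[/andP[AS AC] AM].
  by rewrite (bigD1 A) ?inE ?AC ?AM //= AS lerDl sumr_ge0.
rewrite bern_E_sum (eq_bigr (fun=> p ^+ M)) => [|A].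
  by rewrite sumr_const cards_draws mulr_natl.
rewrite inE => /andP[AC /eqP <-]; rewrite -bern_sub ?bern_PrE //.
exact: subset_trans AC CK.
Qed.

(** If f < c throughout, all weights would have to vanish, although they sum to 1. *)
Lemma bern_exists f c : c <= bern_E f -> exists2 S : {set X}, S \subset K & c <= f S.
Proof.
move=> cE; have [/existsP[S /andP[SK cS]]|none] := boolP [exists S : {set X}, (S \subset K) && (c <= f S)].
  by exists S.
have lt (S : {set X}) : S \subset K -> f S < c.
  by move=> SK; have := existsPn none S; rewrite SK /= ltNge.
have E0 : bern_E (fun S => c - f S) <= 0.
  rewrite (eq_bern_E (g := fun S => c * 1 + (-1) * f S)) => [|S _]; last by ring.
  by rewrite bern_ED !bern_EZ bern_E1; lra.
have W0 (S : {set X}) : S \subset K -> bern_weight S = 0.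
  move=> SK; have h (S' : {set X}) : S' \subset K -> 0 <= bern_weight S' * (c - f S').
    by move=> S'K; rewrite mulr_ge0 ?bern_weight_ge0 // subr_ge0 ltW // lt.
  have : bern_weight S * (c - f S) <= 0.
    apply: le_trans E0; rewrite /bern_E (bigD1 S) //= lerDl.
    by apply: sumr_ge0 => S' /andP[S'K _]; apply: h.
  have := lt S SK; have := bern_weight_ge0 S; rewrite -subr_gt0; nra.
have := bern_E1; rewrite /bern_E big1 => [/eqP|S SK]; first by rewrite eq_sym oner_eq0.
by rewrite W0 // mul0r.
Qed.

End Bernoulli.

(** * Bounds for the random r-graph *)

Section Copies.
Variables (T : finType) (k r : nat).
Hypothesis k4 : (4 <= k)%N.
Hypothesis r3 : (3 <= r)%N.
Local Notation LC := (linear_cycle k r).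
Implicit Types (G F A : {set {set T}}).

Lemma card_linear_cycle : #|LC| = k.
Proof.
rewrite card_imset ?card_ord // => i i' /setP E.
have r2 : (0 < r - 2)%N by rewrite subn_gt0.
have := E (inr (i, Ordinal r2)); rewrite !inE /=.
rewrite (imset_f (fun j => inr (i, j) : linear_cycle_vertex k r)) ?inE // => /esym /imsetP[j _].
by case.
Qed.

Definition copies : {set {set {set T}}} :=
  [set [set (f : {ffun linear_cycle_vertex k r -> T}) @: (e : {set _}) | e in LC]
    | f in [pred f : {ffun linear_cycle_vertex k r -> T} | injectiveb f]].

Lemma copies_card A : A \in copies -> #|A| = k.
Proof.
case/imsetP => f; rewrite inE => /injectiveP fi ->.
by rewrite card_imset ?card_linear_cycle //; apply: imset_inj.
Qed.

Lemma contains_copiesP G : reflect (exists2 A, A \in copies & A \subset G) (contains_copy G LC).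
Proof.
apply: (iffP existsP) => [[f /andP[fi /forall_inP fG]]|[A /imsetP[f fi ->] /subsetP AG]].
  exists [set f @: (e : {set _}) | e in LC]; first by apply/imsetP; exists f.
  by apply/subsetP => _ /imsetP[e eL ->]; apply: fG.
exists f; rewrite inE in fi; rewrite fi /=; apply/forall_inP => e eL.
by apply: AG; apply: imset_f.
Qed.

(** The linear cycle has k + k (r - 2) = k (r - 1) vertices. *)
Lemma card_copies : (#|copies| <= #|T| ^ (k * r.-1))%N.
Proof.
apply: leq_trans (leq_imset_card _ _) _; apply: leq_trans (max_card _) _.
rewrite card_ffun card_sum card_prod !card_ord -{1}(muln1 k) -mulnDr.
by rewrite (_ : 1 + (r - 2) = r.-1)%N //; lia.
Qed.

Lemma leq_ex G F : F \subset G -> ~~ contains_copy F LC -> (#|F| <= ex G LC)%N.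
Proof. by move=> FG nF; apply: (leq_bigmax_cond (F := fun F : {set {set T}} => #|F|)); rewrite FG. Qed.

Lemma ex_le_card G : (ex G LC <= #|G|)%N.
Proof. by apply/bigmax_leqP => F /andP[FG _]; apply: subset_leq_card. Qed.

Lemma ex_cover (K : {set {set T}}) (C : seq {set {set T}}) G M : (0 < M)%N -> G \subset K ->
  (forall F, F \subset K -> ~~ contains_copy F LC -> exists2 c, c \in C & F \subset c) ->
  (M <= ex G LC)%N -> has (fun c => (M <= #|G :&: c|)%N) C.
Proof.
move=> M0 GK cov; apply: contraTT => /hasPn none; rewrite -ltnNge -(prednK M0) ltnS.
apply/bigmax_leqP => F /andP[FG nF]; rewrite -ltnS prednK //.
have [c cC Fc] := cov F (subset_trans FG GK) nF.
have := none c cC; rewrite -ltnNge; apply: leq_ltn_trans.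
by rewrite subset_leq_card // subsetI FG.
Qed.

(** Since k >= 4, the edges 0 and 2 of the cycle are disjoint. *)
Lemma star_no_copy v F : (forall e, e \in F -> v \in e) -> ~~ contains_copy F LC.
Proof.
move=> Fv; apply/negP => /existsP[f /andP[/injectiveP fi /forall_inP fF]].
have i0 : (0 < k)%N by lia.
have i2 : (2 < k)%N by lia.
pose e0 := linear_cycle_edge r (Ordinal i0); pose e2 := linear_cycle_edge r (Ordinal i2).
have /Fv/imsetP[x xe vx] : f @: e0 \in F by apply: fF; apply: imset_f.
have /Fv/imsetP[y ye vy] : f @: e2 \in F by apply: fF; apply: imset_f.
have xy : x = y by apply: fi; rewrite -vx.
move: xe ye; rewrite -xy !inE; case: x {vx xy} => [i|[i j]].
  have nin (m : 'I_k) : (inl i : linear_cycle_vertex k r) \in [set inr (m, j) | j : 'I_(r - 2)] = false.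
    by apply/negP => /imsetP[].
  rewrite !nin !orbF.
  have inlI : injective (inl : 'I_k -> linear_cycle_vertex k r) by move=> ? ? [].
  rewrite !(inj_eq inlI) -!val_eqE /= !modn_small //; last by lia.
  by move=> h1 h2; lia.
rewrite /= => /imsetP[j1 _ E1] /imsetP[j2 _ E2].
by case: E1 => E1 _; case: E2 => E2 _; move: E2; rewrite E1 => /(congr1 val).
Qed.

Lemma ex_star (v : T) G : (#|G :&: [set e : {set T} | v \in e]| <= ex G LC)%N.
Proof.
apply: leq_ex; first exact: subsetIl.
by apply: (@star_no_copy v) => e; rewrite !inE => /andP[].
Qed.

(** In a q-random subset of [G], delete one edge from each surviving copy; some outcome reaches the
    expectation. *)
Lemma ex_deletion (R : realFieldType) (q : R) G : 0 <= q <= 1 ->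
  q * #|G|%:R - q ^+ k * #|[set A in copies | A \subset G]|%:R <= (ex G LC)%:R.
Proof.
move=> q01; pose Y := [set A in copies | A \subset G].
pose f (S : {set {set T}}) : R := #|S :&: G|%:R + (- 1) * \sum_(A in Y) (A \subset S)%:R.
have fE : bern_E G q f = q * #|G|%:R - q ^+ k * #|Y|%:R.
  rewrite /f bern_ED bern_EZ bern_mean // bern_E_sum (eq_bigr (fun=> q ^+ k)) => [|A].
    by rewrite sumr_const mulN1r !mulr_natr.
  rewrite inE => /andP[Ac AG]; rewrite -(copies_card Ac) -bern_PrE bern_sub //.
have [|S SG] := @bern_exists R _ G q q01 f (q * #|G|%:R - q ^+ k * #|Y|%:R); first by rewrite fE.
move=> /le_trans; apply.
pose del A := odflt set0 [pick e in A].
pose D := [set del A | A in [set A in Y | A \subset S]].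
have sub : S :\: D \subset G by apply: subset_trans SG; apply: subsetDl.
have free : ~~ contains_copy (S :\: D) LC.
  apply/negP => /contains_copiesP[A Ac AS].
  have AS' : A \subset S by apply: subset_trans AS _; apply: subsetDl.
  have AY : A \in [set A in Y | A \subset S].
    by rewrite !inE Ac AS' (subset_trans AS' SG).
  have dA : del A \in A.
    rewrite /del; case: pickP => [e //|A0]; have := copies_card Ac.
    by rewrite (eq_card0 A0) => k0; move: k4; rewrite -k0.
  have := fintype.subsetP AS _ dA; rewrite in_setD => /andP[/negP nD _]; apply: nD.
  exact: imset_f.
have := leq_ex sub free; rewrite -(ler_nat R); apply: le_trans.
rewrite /f (setIidPl SG) mulN1r lerBlDr -natr_sum -natrD ler_nat.
rewrite -(cardsID D S) addnC leq_add2l; apply: leq_trans (subset_leq_card (subsetIr _ _)) _.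
apply: leq_trans (leq_imset_card _ _) _.
rewrite -sum1_card [leqRHS]big_mkcond [leqLHS]big_mkcond; apply: leq_sum => A _.
by rewrite !inE; case: ifP => [/andP[/andP[-> ->] ->]|].
Qed.

End Copies.

(** Factor by factor: n (r - i) <= r (n - i). *)
Lemma expn_le_bin n r : (r <= n)%N -> (n ^ r <= r ^ r * 'C(n, r))%N.
Proof.
move=> rn; rewrite -(leq_pmul2r (fact_gt0 r)) -mulnA bin_ffact -[r`!]ffactnn !ffact_prod.
have e m : (m ^ r = \prod_(i < r) m)%N by rewrite prod_nat_const card_ord.
rewrite !e -!big_split /=; apply: leq_prod => i _.
by rewrite !mulnBr [(n * r)%N]mulnC leq_sub2l // leq_mul2r rn orbT.
Qed.

(** * Probability bounds at a fixed n *)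

Section FiniteBounds.
Variables (R : realFieldType) (n r k : nat) (p : R).
Hypothesis p01 : 0 <= p <= 1.
Hypothesis k4 : (4 <= k)%N.
Hypothesis r3 : (3 <= r)%N.
Local Notation LC := (linear_cycle k r).
Local Notation K := (complete_rgraph 'I_n r).
Local Notation Pr := (bern_Pr K p).
Local Notation N := ('C(n, r)%:R : R).
Hypothesis rn : (r <= n)%N.
Hypothesis p0 : 0 < p.

Let N0 : 0 < N. Proof. by rewrite ltr0n bin_gt0. Qed.

Lemma card_complete : #|K| = 'C(n, r).
Proof. by rewrite card_draws card_ord. Qed.

Lemma edges_concentrate del : 0 < del ->
  Pr (fun G => del * (p * N) <= `|#|G|%:R - p * N|) <= (del ^+ 2 * (p * N))^-1.
Proof.
move=> d0; have pN : 0 < p * N by rewrite mulr_gt0.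
have := bern_chebyshev p01 (subxx K) (mulr_gt0 d0 pN); rewrite card_complete.
rewrite (_ : p * N / _ = (del ^+ 2 * (p * N))^-1); last first.
  by field; rewrite !gt_eqF.
apply: le_trans; apply: le_bern_Pr => // G GK.
by rewrite (setIidPl GK).
Qed.

Lemma copies_markov a : 0 < a ->
  Pr (fun G => a <= #|[set A in copies 'I_n k r | A \subset G]|%:R)
    <= n%:R ^+ (k * r.-1) * p ^+ k / a.
Proof.
move=> a0; pose f (G : {set {set 'I_n}}) : R := #|[set A in copies 'I_n k r | A \subset G]|%:R.
have f0 G : 0 <= f G by [].
apply: le_trans (bern_markov K p01 f0 a0) _.
rewrite ler_wpM2r ?invr_ge0 ?(ltW a0) //.
apply: (@le_trans _ _ (\sum_(A in copies 'I_n k r) p ^+ k)).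
  have fE S : f S = \sum_(A in copies 'I_n k r) (A \subset S)%:R.
    rewrite /f -sum1_card natr_sum big_mkcond [RHS]big_mkcond; apply: eq_bigr => A _.
    by rewrite inE; case: (A \in copies _ _ _); case: (A \subset S).
  rewrite (@eq_bern_E R _ K p f _ (fun S _ => fE S)).
  rewrite bern_E_sum; apply: ler_sum => A Ac; rewrite -bern_PrE.
  have [AK|nAK] := boolP (A \subset K); first by rewrite bern_sub // (copies_card r3 Ac).
  rewrite /bern_Pr big1 ?exprn_ge0 ?(ltW p0) // => S /andP[SK AS].
  by case/negP: nAK; apply: subset_trans AS SK.
rewrite sumr_const -[leLHS]mulr_natl ler_wpM2r ?exprn_ge0 ?(ltW p0) //.
by rewrite -natrX ler_nat; have := card_copies 'I_n k4 r3; rewrite card_ord.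
Qed.

(** The two error terms are Chebyshev for the number of edges and Markov for the number of copies;
    either event would cost a share [del] of q p N in [ex_deletion]. *)
Lemma ex_lower q del : 0 < q <= 1 -> 0 < del ->
  1 - ((del ^+ 2 * (p * N))^-1 + (q * p) ^+ k.-1 * n%:R ^+ (k * r.-1) / (del * N))
    <= Pr (fun G => (1 - 2 * del) * (q * p * N) <= (ex G LC)%:R).
Proof.
case/andP=> q0 q1 d0; have pN : 0 < p * N by rewrite mulr_gt0.
pose A (G : {set {set 'I_n}}) := del * (p * N) <= `|#|G|%:R - p * N| :> R.
pose B (G : {set {set 'I_n}}) :=
  del * (q * p * N) / q ^+ k <= #|[set A in copies 'I_n k r | A \subset G]|%:R :> R.
have a0 : 0 < del * (q * p * N) / q ^+ k by rewrite divr_gt0 ?exprn_gt0 // !mulr_gt0.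
apply: (@le_trans _ _ (1 - Pr (fun G => A G || B G))).
  rewrite lerD2l lerN2; apply: le_trans (bern_PrU K p01 A B) _; apply: lerD.
    exact: edges_concentrate.
  apply: le_trans (copies_markov a0) _; rewrite le_eqVlt; apply/orP; left; apply/eqP.
  have kE : k = k.-1.+1 by rewrite prednK //; apply: leq_trans k4.
  rewrite {2 3}kE (exprS p) (exprS q) exprMn; field.
  by rewrite !gt_eqF ?exprn_gt0.
rewrite -bern_PrC //; apply: le_bern_Pr => // G GK; rewrite negb_or -!ltNge => /andP[a b].
have := ex_deletion (T := 'I_n) k4 r3 (q := q) G; rewrite (ltW q0) q1 => /(_ isT); apply: le_trans.
have b' : q ^+ k * #|[set A in copies 'I_n k r | A \subset G]|%:R <= del * (q * p * N).
  by rewrite mulrC -ler_pdivlMr ?exprn_gt0 // ltW.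
have a' : p * N - del * (p * N) <= #|G|%:R.
  by move: a; rewrite ltr_norml => /andP[h _]; lra.
have : q * (p * N - del * (p * N)) <= q * #|G|%:R by rewrite ler_pM2l.
rewrite (_ : (1 - 2 * del) * (q * p * N) = q * (p * N - del * (p * N)) - del * (q * p * N)); last by ring.
by move: b'; lra.
Qed.

Lemma ex_upper_edges del : 0 < del ->
  1 - (del ^+ 2 * (p * N))^-1 <= Pr (fun G => (ex G LC)%:R <= (1 + del) * (p * N)).
Proof.
move=> d0; apply: (@le_trans _ _ (1 - Pr (fun G => del * (p * N) <= `|#|G|%:R - p * N|))).
  by rewrite lerD2l lerN2 edges_concentrate.
rewrite -bern_PrC //; apply: le_bern_Pr => // G GK; rewrite -ltNge ltr_norml => /andP[_ h].
apply: (@le_trans _ _ #|G|%:R); first by rewrite ler_nat ex_le_card.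
by move: h; lra.
Qed.

(** Chebyshev with half the mean, for the edges through one vertex; at least n^(r-1) / r^r of the
    possible edges contain it. *)
Lemma ex_lower_star :
  1 - 4 * (r ^ r)%:R / (p * n%:R ^+ r.-1)
    <= Pr (fun G => p * n%:R ^+ r.-1 / (2 * (r ^ r)%:R) <= (ex G LC)%:R).
Proof.
have n0 : (0 < n)%N by apply: leq_trans rn; apply: leq_trans r3.
pose v := Ordinal n0; pose S := K :&: [set e : {set 'I_n} | v \in e].
have SK : S \subset K by apply: subsetIl.
have r0 : (0 < r)%N by apply: leq_trans r3.
have CS : ('C(n.-1, r.-1) <= #|S|)%N.
  have -> : n.-1 = #|[set~ v]| by rewrite cardsC1 card_ord.
  rewrite -cards_draws -(card_in_imset (f := fun e : {set 'I_n} => v |: e)); last first.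
    move=> e f; rewrite !inE => /andP[/subsetP ev _] /andP[/subsetP fv _] ef.
    have nv (g : {set 'I_n}) : {subset g <= [set~ v]} -> v \notin g.
      by move=> gv; apply/negP => /gv; rewrite !inE eqxx.
    by rewrite -(setU1K (nv e ev)) ef setU1K // nv.
  apply: subset_leq_card; apply/subsetP => _ /imsetP[e + ->].
  rewrite !inE eqxx andbT => /andP[/subsetP ev /eqP er].
  rewrite cardsU1 er (_ : v \notin e) ?add1n ?prednK ?eqxx //.
  by apply/negP => /ev; rewrite !inE eqxx.
have cS : (n ^ r.-1 <= r ^ r * #|S|)%N.
  apply: (@leq_trans (r ^ r * 'C(n.-1, r.-1))); last by rewrite leq_mul2l CS orbT.
  rewrite -(leq_pmul2l n0) -expnS prednK // mulnCA mul_bin_diag prednK // mulnCA.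
  by apply: leq_trans (expn_le_bin rn) _; rewrite leq_pmull.
have rr0 : 0 < (r ^ r)%:R :> R by rewrite ltr0n expn_gt0 r0.
have nr0 : 0 < n%:R ^+ r.-1 :> R by rewrite exprn_gt0 // ltr0n.
have cS' : n%:R ^+ r.-1 / (r ^ r)%:R <= #|S|%:R :> R.
  by rewrite ler_pdivrMr // mulrC -natrX -natrM ler_nat.
have S0 : 0 < #|S|%:R :> R by apply: lt_le_trans cS'; rewrite divr_gt0.
have pS : 0 < p * #|S|%:R by rewrite mulr_gt0.
have t0 : 0 < p * #|S|%:R / 2 by rewrite divr_gt0.
apply: (@le_trans _ _ (1 - Pr (fun G => p * #|S|%:R / 2 <= `|#|G :&: S|%:R - p * #|S|%:R|))).
  rewrite lerD2l lerN2; apply: le_trans (bern_chebyshev p01 SK t0) _.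
  rewrite (_ : p * #|S|%:R / (p * #|S|%:R / 2) ^+ 2 = 4 / (p * #|S|%:R)); last by field; rewrite !gt_eqF.
  rewrite -[leRHS]mulrA ler_wpM2l // -[leRHS]invrK lef_pV2 ?posrE ?invr_gt0 ?divr_gt0 ?mulr_gt0 //.
  by rewrite invf_div -mulrA ler_wpM2l // ltW.
rewrite -bern_PrC //; apply: le_bern_Pr => // G GK; rewrite -ltNge ltr_norml => /andP[h _].
have SG : (#|G :&: S| <= ex G LC)%N.
  apply: leq_trans (ex_star k4 r3 v G); apply: subset_leq_card.
  by rewrite setIS // subsetIr.
apply: (@le_trans _ _ #|G :&: S|%:R); last by rewrite ler_nat.
have : p * n%:R ^+ r.-1 / (2 * (r ^ r)%:R) <= p * #|S|%:R / 2.
  rewrite invfM mulrACA [leRHS]mulrAC -[X in X <= _]mulrA mulrC.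
  by rewrite [leRHS]mulrAC mulrC; move: cS'; nra.
by move: h; lra.
Qed.

End FiniteBounds.

From mathcomp Require Import all_classical all_reals all_analysis.
Import Order.TTheory GRing.Theory Num.Theory.
Import numFieldNormedType.Exports.
Local Open Scope classical_set_scope.
Local Open Scope ring_scope.

(** The left side is at most (N p)^M / M!, where N p <= M / e^2 and M^M / M! <= e^M. *)
Lemma bin_pow_le (R : realType) (N M : nat) (p : R) : (0 < M)%N -> 0 <= p ->
  expR 2 * N%:R * p <= M%:R -> 'C(N, M)%:R * p ^+ M <= expR (- M%:R).
Proof.
move=> M0 p0 NM.
have M0' : 0 < M%:R :> R by rewrite ltr0n.
have F0 : 0 < (M`!)%:R :> R by rewrite ltr0n fact_gt0.
have h1 : 'C(N, M)%:R <= N%:R ^+ M / (M`!)%:R :> R.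
  rewrite ler_pdivlMr // -natrM -natrX ler_nat bin_ffact.
  elim: (M) => [|m IH]; first by rewrite ffactn0.
  by rewrite ffactnSr expnSr leq_mul // leq_subr.
have h2 : M%:R ^+ M / (M`!)%:R <= expR (M%:R : R).
  have := expR_ge1Dxn M.-1 (ltW M0'); rewrite prednK //; lra.
have h3 : (N%:R * p) ^+ M <= (expR (-2) * M%:R) ^+ M.
  rewrite lerXn2r ?nnegrE ?mulr_ge0 ?expR_ge0 // expRN [leRHS]mulrC ler_pdivlMr ?expR_gt0 //.
  by rewrite mulrC mulrA.
apply: (@le_trans _ _ (N%:R ^+ M / (M`!)%:R * p ^+ M)); first by rewrite ler_wpM2r // exprn_ge0.
rewrite mulrAC -exprMn; apply: (@le_trans _ _ ((expR (-2) * M%:R) ^+ M / (M`!)%:R)).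
  by rewrite ler_wpM2r // invr_ge0 ltW.
rewrite exprMn -mulrA; apply: (@le_trans _ _ (expR (-2) ^+ M * expR M%:R)).
  by rewrite ler_wpM2l // exprn_ge0 // expR_ge0.
by rewrite -expRM_natl -expRD ler_expR; lra.
Qed.

(** Each of the e^Z containers receives M > Y random edges with probability at most e^(-M), and Z <=
    Y / 2. *)
Lemma ex_upper_containers (R : realType) (n r k N : nat) (p Z Y : R) (C : seq {set {set 'I_n}}) :
  0 <= p <= 1 ->
  (forall c, c \in C -> (#|c| <= N)%N) ->
  (forall F : {set {set 'I_n}}, F \subset complete_rgraph 'I_n r ->
     ~~ contains_copy F (linear_cycle k r) -> exists2 c, c \in C & F \subset c) ->
  (size C)%:R <= expR Z -> 2 * Z <= Y -> expR 2 * N%:R * p <= Y -> 0 <= Y ->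
  1 - expR (- (Y / 2)) <= bern_Pr (complete_rgraph 'I_n r) p
    (fun G => (ex G (linear_cycle k r))%:R <= Y).
Proof.
move=> p01 cN cov CZ ZY NY Y0; have [p0 p1] := andP p01.
pose K := complete_rgraph 'I_n r; pose M := (Num.truncn Y).+1.
have YM : Y < M%:R by rewrite /M; have /andP[_] := truncn_itv Y0.
have tail c : c \in C -> bern_Pr K p (fun G => (M <= #|G :&: c|)%N) <= expR (- M%:R).
  move=> cC; apply: (@le_trans _ _ (bern_Pr K p (fun G => (M <= #|G :&: (c :&: K)|)%N))).
    apply: le_bern_Pr => // G GK; by rewrite finset.setIA (finset.setIC _ K) finset.setIA (finset.setIidPr GK).
  apply: le_trans (bern_upper_tail p01 _ (finset.subsetIr c K)) _.
  apply: le_trans (bin_pow_le (N := #|c :&: K|) _ p0 _) => //.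
  apply: le_trans (ltW YM); apply: le_trans NY.
  rewrite ler_wpM2r // ler_wpM2l ?expR_ge0 // ler_nat.
  by apply: leq_trans (cN c cC); apply: subset_leq_card; apply: finset.subsetIl.
apply: (@le_trans _ _ (1 - bern_Pr K p (fun G => has (fun c => (M <= #|G :&: c|)%N) C))).
  rewrite lerD2l lerN2.
  apply: le_trans (bern_Pr_has K p01 C (fun c G => (M <= #|G :&: c|)%N)) _.
  apply: (@le_trans _ _ (\sum_(c <- C) expR (- M%:R))).
    by rewrite big_seq [leRHS]big_seq; apply: ler_sum => c /tail.
  rewrite big_const_seq count_predT iter_addr_0 -[leLHS]mulr_natl.
  apply: (@le_trans _ _ (expR Z * expR (- M%:R))); first by rewrite ler_wpM2r // expR_ge0.
  by rewrite -expRD ler_expR; lra.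
rewrite -bern_PrC //; apply: le_bern_Pr => // G GK; apply: contraR; rewrite -ltNge => h.
apply: (ex_cover (T := 'I_n) (k := k) (r := r) (M := M) _ GK cov) => //.
rewrite /M ltnNge; apply/negP => exY; move: h; rewrite ltNge => /negP; apply.
by have /andP[tY _] := truncn_itv Y0; apply: le_trans tY; rewrite ler_nat.
Qed.

(** * Asymptotics *)

Lemma ln_nat_large (R : realType) (B : R) : \forall n \near \oo, B <= ln (n%:R : R).
Proof.
near=> n.
have h : expR B <= n%:R by near: n; apply: nbhs_infty_ger.
by rewrite -[B]expRK ler_ln ?posrE ?expR_gt0 // (lt_le_trans (expR_gt0 B)).
Unshelve. all: by end_near. Qed.

(** The spread constant is polynomial in d, hence in log n; polynomial growth here keeps the number
    of rounds polylogarithmic. *)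
Lemma shrink_const_poly (R : realType) k : exists A : R, exists m,
  0 <= A /\ forall K : R, 1 <= K -> shrink_const k K <= A * K ^+ m.
Proof.
elim: k => [|k [A [m [A0 H]]]].
  by exists 1, 1%N; split => // K _ /=; rewrite mul1r.
exists (A * (2 ^+ (k + 6)) ^+ m), (2 * m)%N; split; first by rewrite mulr_ge0 ?exprn_ge0.
move=> K K1 /=; apply: le_trans (H _ _) _.
  by apply: mulr_ege1; apply: exprn_ege1; rewrite ?ler1n.
by rewrite exprMn (exprM K) mulrA.
Qed.

Lemma trunc_log_le_ln (R : realType) n : (0 < n)%N ->
  (trunc_log 2 n)%:R <= (ln 2)^-1 * ln (n%:R : R).
Proof.
move=> n0; have l2 : 0 < ln (2 : R) by rewrite ln_gt0 // ltr1n.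
rewrite mulrC ler_pdivlMr // mulr_natl -lnXn //.
rewrite ler_ln ?posrE ?exprn_gt0 ?ltr0n // -natrX ler_nat.
exact: trunc_logP.
Qed.

Lemma polylog_containers (R : realType) (l r : nat) : (2 <= l)%N -> (4 <= r)%N ->
  exists A : R, exists c, 0 < A /\ \forall n \near \oo,
    exists C : seq {set {set 'I_n}},
    [/\ (size C)%:R <= expR (A * n%:R `^ (1 + (2 * l%:R - 1)^-1) * ln n%:R ^+ c),
      forall e, e \in C -> (#|e| <= 64 * l.*2 ^ 2 * r.+1 * n ^ r.-1)%N &
      forall F : {set {set 'I_n}}, F \subset complete_rgraph 'I_n r ->
        ~~ contains_copy F (linear_cycle l.*2 r) -> exists2 e, e \in C & F \subset e].
Proof.
move=> l2 r4.
have [A1 [m1 [A10 HA]]] := shrink_const_poly R l.*2.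
pose sg : R := sigma R r; pose c0 := ((2 * r.+1) ^ l.*2)%N.
pose B0 : R := (ln 2)^-1 + (c0 + l.*2).+1%:R.
have ln20 : 0 < ln (2 : R) by rewrite ln_gt0 // ltr1n.
have B00 : 0 <= B0 by rewrite addr_ge0 ?invr_ge0 // ltW.
pose B1 : R := 2 * (2 * (r.-1%:R * sg * sg ^+ 2 * (2 * B0))) ^+ l.*2.
pose A2 := 4 * (A1 * B1 ^+ m1).
have sg0 : 0 <= sg by rewrite /sg /sigma ler0n.
have B10 : 0 <= B1 by rewrite !(mulr_ge0, exprn_ge0) ?ler0n.
have A20 : 0 <= A2 by rewrite !(mulr_ge0, exprn_ge0) ?ler0n.
pose A3 : R := (r.+1%:R * (l.*2%:R * 2)) * (A2 * r%:R + 1).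
exists (A3 + 1), (1 + (l.*2 * m1 + 1))%N; split.
  by rewrite ltr_pwDr // /A3 mulr_ge0 ?mulr_ge0 // addr_ge0 // mulr_ge0.
near=> n.
have x1 : 1 <= ln (n%:R : R) by near: n; apply: ln_nat_large.
have xr : 3 * revisit_const R r l <= ln (n%:R : R) by near: n; apply: ln_nat_large.
have n2 : (2 <= n)%N by near: n; apply: nbhs_infty_ge.
set x := ln (n%:R : R) in x1 xr *.
have n0 : (0 < n)%N by apply: leq_trans n2.
have nx : n%:R = expR x by rewrite lnK // posrE ltr0n.
have x0 : 0 <= x by apply: le_trans x1.
pose al : R := (2 * l%:R - 1)^-1.
have l2' : 2 <= l%:R :> R by rewrite ler_nat.
have al0 : 0 < al by rewrite invr_gt0; lra.
pose y := expR (al * x); pose h := expR (2 / 3 * x).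
(* Both n < 2^(trunc_log + 1) and sigma^(2l) = c0 < 2^c0 go into [d_large]. *)
pose d := ((trunc_log 2 n).+1 + c0)%N.
pose Lam := 4 * shrink_const l.*2 (spread_const R r l d).
(* Enough rounds for (1 - 1/Lam)^J <= exp(-J / Lam) to beat n^r = exp(r x). *)
pose J := (Num.truncn (Lam * (r%:R * x))).+1.
pose m0 := (Num.truncn (y ^+ l.*2)).+1.
have y1 : 1 <= y by rewrite -[leLHS]expR0 ler_expR mulr_ge0 // ltW.
have yk1 : 1 <= y ^+ l.*2 by apply: exprn_ege1.
have kE : l.*2%:R = 2 * l%:R :> R by rewrite -mul2n natrM.
have k0 : (0 < l.*2)%N by rewrite double_gt0; apply: leq_trans l2.
have al1 : l.*2.-1%:R * al = 1.
  by rewrite -subn1 natrB // kE mulfV //; apply: lt0r_neq0; lra.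
have al2 : l.*2%:R * al = 1 + al.
  by rewrite -[l.*2]prednK // -natr1 mulrDl al1 mul1r.
have yE : y ^+ l.*2.-1 = n%:R by rewrite -expRM_natl mulrA al1 mul1r nx.
have ykE : y ^+ l.*2 = n%:R `^ (1 + al).
  by rewrite nx -expRM_natl /powR gt_eqF ?expR_gt0 // expRK mulrA al2.
have d_bd : (d + l.*2)%:R <= B0 * x.
  rewrite /d /B0 -addnA addSnnS natrD mulrDl.
  apply: lerD; first exact: trunc_log_le_ln.
  by rewrite -[leLHS]mulr1 ler_wpM2l.
have gap_bd : gap_const R r l d <= r.-1%:R * sg * sg ^+ 2 * (2 * B0) * x.
  rewrite /gap_const -/sg -[leRHS]mulrA ler_wpM2l ?mulr_ge0 ?exprn_ge0 //.
  by rewrite -mulrA ler_wpM2l.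
have gc1 : 1 <= gap_const R r l d.
  have r1 : (0 < r.-1)%N by clear -r4; case: r r4 => [|[|]].
  by rewrite /gap_const /sigma -!natrX -!natrM ler1n !muln_gt0 r1 /= addn_gt0 k0 orbT.
have gc0 := le_trans ler01 gc1.
have sp_bd : spread_const R r l d <= B1 * x ^+ l.*2.
  rewrite /spread_const /B1 -[leRHS]mulrA -exprMn ler_wpM2l // lerXn2r ?nnegrE //.
  - by rewrite mulr_ge0.
  - by rewrite !(mulr_ge0, exprn_ge0).
  by rewrite -[leRHS]mulrA ler_wpM2l.
have sc1 : 1 <= spread_const R r l d.
  rewrite /spread_const -[leLHS]mul1r ler_pM ?ler1n // exprn_ege1 //.
  by rewrite -[leLHS]mul1r ler_pM ?ler1n.
have Lam1 : 1 <= Lam.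
  rewrite /Lam -[leLHS]mul1r ler_pM ?ler1n //.
  exact: le_trans sc1 (shrink_const_ge _ sc1).
have Lam0 := lt_le_trans ltr01 Lam1.
have Lam_bd : Lam <= A2 * x ^+ (l.*2 * m1).
  rewrite /Lam /A2 -[leRHS]mulrA ler_wpM2l // -[leRHS]mulrA; apply: le_trans (HA _ sc1) _.
  rewrite ler_wpM2l // exprM -exprMn lerXn2r ?nnegrE ?(le_trans ler01 sc1) //.
  by rewrite mulr_ge0 ?exprn_ge0.
have J_lt : Lam * (r%:R * x) < J%:R by rewrite /J; apply: truncnS_gt.
have J_bd : J%:R <= (A2 * r%:R + 1) * x ^+ (l.*2 * m1 + 1).
  rewrite /J -natr1 mulrDl mul1r lerD ?exprn_ege1 //.
  have Z0 : 0 <= Lam * (r%:R * x) by rewrite mulr_ge0 ?(ltW Lam0) ?mulr_ge0.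
  apply: (le_trans (y := Lam * (r%:R * x))); first by rewrite truncn_le.
  rewrite [leRHS](_ : _ = A2 * x ^+ (l.*2 * m1) * (r%:R * x)); last by rewrite exprD expr1; ring.
  by rewrite ler_wpM2r ?mulr_ge0.
have m0_ge : y ^+ l.*2 <= m0%:R by apply: ltW; apply: truncnS_gt.
have m0_le : m0%:R <= 2 * y ^+ l.*2.
  rewrite /m0 -natr1 mulr_natl mulr2n lerD // truncn_le // (le_trans ler01) //.
have d_large : #|'I_n|%:R * sigma R r ^+ l.*2 <= 2 ^+ d.
  rewrite card_ord /sigma -!natrX -natrM ler_nat expnD leq_mul //.
    by apply: ltnW; apply: trunc_log_ltn.
  by apply: ltnW; apply: ltn_expl.
have J_large : (1 - Lam^-1) ^+ J * #|'I_n|%:R ^+ r < 1.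
  rewrite card_ord nx -expRM_natl.
  apply: (@le_lt_trans _ _ (expR (- (Lam^-1)) ^+ J * expR (r%:R * x))).
    rewrite ler_wpM2r ?expR_ge0 // lerXn2r ?nnegrE ?expR_ge0 //.
      by rewrite subr_ge0 invf_le1.
    exact: expR_ge1Dx.
  rewrite -expRM_natl -expRD -[ltRHS]expR0 ltr_expR mulrN addrC subr_lt0.
  by rewrite ltr_pdivlMr // mulrC.
have [|||||C [C1 C2 C3]] :=
  @cycle_containers R 'I_n r l d m0 J (Ordinal n0) h y _ l2 r4 _ _ y1 _ d_large _ m0_ge m0_le J_large.
- move=> w w1; exists (expR (ln w / l.*2%:R)).
    by rewrite -[leLHS]expR0 ler_expR divr_ge0 // ln_ge0.
  rewrite -expRM_natl mulrC divfK ?lnK ?posrE //; first exact: lt_le_trans w1.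
  by rewrite pnatr_eq0 -lt0n.
- by rewrite -[leLHS]expR0 ler_expR mulr_ge0 // divr_ge0.
- rewrite card_ord nx -!expRM_natl; congr expR; clear -x0; lra.
- by rewrite card_ord yE.
- rewrite card_ord nx -expRM_natl.
  apply: (@le_trans _ _ (expR (x / 3) * expR x)).
    rewrite ler_wpM2r ?expR_ge0 //; apply: le_trans (expR_ge1Dx _); clear -xr x0; lra.
  by rewrite -expRD ler_expR; clear -x0; lra.
exists C; split=> //; last by move=> e /C2; rewrite card_ord.
apply: (@le_trans _ _ ((n ^ r.+1)%:R ^+ (l.*2 * m0 * J))).
  rewrite -natrX ler_nat; apply: leq_trans C1 _; rewrite card_ord leq_exp2r.
    rewrite expnS; apply: (@leq_trans (2 * n ^ r)); last by rewrite leq_mul2r n2 orbT.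
    by rewrite mul2n -addnn -addn1 leq_add2l expn_gt0 n0.
  by rewrite !muln_gt0 k0.
rewrite -ykE natrX nx -[X in X ^+ (_ * _ * _)]expRM_natl -[X in X <= _]expRM_natl ler_expR.
apply: (@le_trans _ _ (A3 * y ^+ l.*2 * x ^+ (1 + (l.*2 * m1 + 1)))); last first.
  by rewrite ler_wpM2r ?exprn_ge0 // ler_wpM2r ?(le_trans ler01 yk1) // lerDl.
rewrite !natrM; rewrite [leLHS](_ : _ = r.+1%:R * l.*2%:R * x * (m0%:R * J%:R)); last by ring.
rewrite exprD expr1.
rewrite [leRHS](_ : _ = r.+1%:R * l.*2%:R * x * ((2 * y ^+ l.*2) * ((A2 * r%:R + 1) * x ^+ (l.*2 * m1 + 1))));
  last by rewrite /A3; ring.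
by rewrite ler_wpM2l ?mulr_ge0 // ler_pM.
Unshelve. all: by end_near. Qed.

(** * Events of probability tending to one *)

Section Asymptotics.
Variables (R : realType) (r : nat) (p : nat -> R).
Hypothesis p01 : forall n, 0 <= p n <= 1.
Local Notation Pr n := (bern_Pr (complete_rgraph 'I_n r) (p n)).

Definition likely (A : forall n, pred {set {set 'I_n}}) :=
  forall eps : R, 0 < eps -> \forall n \near \oo, 1 - eps <= Pr n (A n).

Lemma aas_likely A : likely A -> aas r p A.
Proof.
move=> H; apply/cvgrPdist_le => eps e0; near=> n.
have h : 1 - eps <= Pr n (A n) by near: n; apply: H.
rewrite ger0_norm; first by rewrite lerBlDr addrC -lerBlDr.
by rewrite subr_ge0; apply: bern_Pr_le1.
Unshelve. all: by end_near. Qed.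

Lemma likely_and A B : likely A -> likely B -> likely (fun n G => A n G && B n G).
Proof.
move=> HA HB eps e0; have e2 : 0 < eps / 2 by rewrite divr_gt0.
near=> n.
have hA : 1 - eps / 2 <= Pr n (A n) by near: n; apply: HA.
have hB : 1 - eps / 2 <= Pr n (B n) by near: n; apply: HB.
have h1 := bern_PrC (complete_rgraph 'I_n r) (p n) (A n).
have h2 := bern_PrC (complete_rgraph 'I_n r) (p n) (B n).
have h3 := bern_PrC (complete_rgraph 'I_n r) (p n) (fun G => A n G && B n G).
have h4 := bern_PrU (complete_rgraph 'I_n r) (p01 n) (fun G => ~~ A n G) (fun G => ~~ B n G).
have h5 : Pr n (fun G => ~~ (A n G && B n G)) <= Pr n (fun G => ~~ A n G || ~~ B n G).
  by apply: le_bern_Pr => // G _; rewrite negb_and.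
move: hA hB h4 h5; rewrite h1 h2 h3; move: (Pr n _) (Pr n _) (Pr n _) => a b c; clear; lra.
Unshelve. all: by end_near. Qed.

Lemma likely_mono (A B : forall n, pred {set {set 'I_n}}) :
  (\forall n \near \oo, forall G : {set {set 'I_n}}, A n G -> B n G) -> likely A -> likely B.
Proof.
move=> AB HA eps e0; near=> n.
apply: (@le_trans _ _ (Pr n (A n))); first by near: n; apply: HA.
by apply: le_bern_Pr => // G _; move: G; near: n.
Unshelve. all: by end_near. Qed.

End Asymptotics.

Local Notation al l := ((2 * l%:R - 1)^-1).

Lemma powR_nat_expR (R : realType) n (a : R) : (0 < n)%N -> n%:R `^ a = expR (a * ln n%:R).
Proof. by move=> n0; rewrite /powR pnatr_eq0 gt_eqF. Qed.

Lemma powR_natD (R : realType) n (a b : R) : (0 < n)%N ->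
  n%:R `^ (a + b) = n%:R `^ a * n%:R `^ b.
Proof. by move=> n0; rewrite powRD // pnatr_eq0 -lt0n n0 implybT. Qed.

Lemma powR_pred (R : realType) n r : (0 < r)%N -> n%:R `^ (r%:R - 1) = n%:R ^+ r.-1 :> R.
Proof.
move=> r0; by rewrite -powR_mulrn // -subn1 natrB.
Qed.

Lemma alpha_gt0 (R : realType) l : (2 <= l)%N -> 0 < al l :> R.
Proof.
move=> l2; have l2' : 2 <= l%:R :> R by rewrite ler_nat.
by rewrite invr_gt0; lra.
Qed.

(** The power [kap] of log n is chosen before p, which makes the final error exponents independent
    of p. *)
Lemma likely_upper (R : realType) (l r : nat) : (2 <= l)%N -> (4 <= r)%N ->
  exists kap : nat, forall p Y : nat -> R,
  (forall n, 0 <= p n <= 1) ->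
  (\forall n \near \oo,
     (n%:R `^ (1 + al l) + p n * n%:R `^ (r%:R - 1)) * ln n%:R ^+ kap <= Y n) ->
  likely r p (fun n G => (ex G (linear_cycle (2 * l) r))%:R <= Y n).
Proof.
move=> l2 r4; have al0 := alpha_gt0 R l2; have r0 : (0 < r)%N by apply: leq_trans r4.
have [A [c [A0 HC]]] := polylog_containers R l2 r4.
pose c2 := (64 * l.*2 ^ 2 * r.+1)%N.
exists c.+1 => p Y p01 HY eps e0; near=> n.
have hY : (n%:R `^ (1 + al l) + p n * n%:R `^ (r%:R - 1)) * ln n%:R ^+ c.+1 <= Y n by near: n.
have x1 : 1 <= ln (n%:R : R) by near: n; apply: ln_nat_large.
have xA : 2 * A <= ln (n%:R : R) by near: n; apply: ln_nat_large.
have xc : expR 2 * c2%:R <= ln (n%:R : R) by near: n; apply: ln_nat_large.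
have xe : 2 * eps^-1 <= ln (n%:R : R) by near: n; apply: ln_nat_large.
have n1 : (1 <= n)%N by near: n; apply: nbhs_infty_ge.
have [C [C1 C2 C3]] : exists C : seq {set {set 'I_n}},
    [/\ (size C)%:R <= expR (A * n%:R `^ (1 + al l) * ln n%:R ^+ c),
      forall e, e \in C -> (#|e| <= c2 * n ^ r.-1)%N &
      forall F : {set {set 'I_n}}, F \subset complete_rgraph 'I_n r ->
        ~~ contains_copy F (linear_cycle l.*2 r) -> exists2 e, e \in C & F \subset e].
  by near: n.
set x := ln n%:R in hY x1 xA xc xe C1 *.
have x0 : 0 <= x by apply: le_trans x1.
have [p0 p1] := andP (p01 n).
have P0 : 1 <= n%:R `^ (1 + al l) :> R.
  by rewrite powR_nat_expR // -[leLHS]expR0 ler_expR mulr_ge0 // addr_ge0 // ltW.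
move: hY; rewrite powR_pred // mulrDl => hY.
have t1 : 0 <= p n * n%:R ^+ r.-1 by rewrite mulr_ge0 // exprn_ge0.
have t2 : 0 <= n%:R `^ (1 + al l) * x ^+ c.+1 by rewrite mulr_ge0 ?powR_ge0 ?exprn_ge0.
have t3 : 0 <= p n * n%:R ^+ r.-1 * x ^+ c.+1 by rewrite mulr_ge0 ?exprn_ge0.
have xS : x <= x ^+ c.+1 by rewrite exprS ler_peMr // exprn_ege1.
have Yx : x <= Y n.
  apply: le_trans hY; apply: le_trans xS _; apply: (@le_trans _ _ (n%:R `^ (1 + al l) * x ^+ c.+1)).
    by rewrite ler_peMl ?exprn_ge0.
  by rewrite lerDl.
have Y0 : 0 <= Y n by apply: le_trans Yx.
rewrite mul2n; apply: le_trans (ex_upper_containers (p01 n) C2 C3 C1 _ _ Y0).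
- rewrite lerD2l lerN2 expRN -[leRHS]invrK lef_pV2 ?posrE ?invr_gt0 ?expR_gt0 //.
  apply: le_trans (expR_ge1Dx _); clear -xe Yx e0; lra.
- apply: le_trans hY; apply: (@le_trans _ _ (n%:R `^ (1 + al l) * x ^+ c.+1)); last by rewrite lerDl.
  rewrite exprS [leLHS](_ : _ = n%:R `^ (1 + al l) * ((2 * A) * x ^+ c)); last by ring.
  by rewrite ler_wpM2l ?powR_ge0 // ler_wpM2r ?exprn_ge0.
- apply: le_trans hY; apply: (@le_trans _ _ (p n * n%:R ^+ r.-1 * x ^+ c.+1)); last by rewrite lerDr.
  rewrite natrM natrX [leLHS](_ : _ = p n * n%:R ^+ r.-1 * (expR 2 * c2%:R)); last by ring.
  by rewrite ler_wpM2l // (le_trans xc).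
Unshelve. all: by end_near. Qed.

Lemma pow_le_bin (R : realType) n r : (0 < r)%N -> (r <= n)%N ->
  n%:R `^ r%:R / (r ^ r)%:R <= 'C(n, r)%:R :> R.
Proof.
move=> r0 rn; rewrite ler_pdivrMr ?ltr0n ?expn_gt0 ?r0 // powR_mulrn // -natrX -natrM ler_nat mulnC.
exact: expn_le_bin.
Qed.

Lemma likely_star (R : realType) (l r : nat) (p eta : nat -> R) :
  (2 <= l)%N -> (4 <= r)%N -> (forall n, 0 <= p n <= 1) ->
  (\forall n \near \oo, 0 <= eta n <= 1 /\
     n%:R `^ (- (r%:R - 2) + al l - eta n) <= p n) ->
  likely r p (fun n G =>
    p n * n%:R `^ (r%:R - 1) / (2 * (r ^ r)%:R) <= (ex G (linear_cycle (2 * l) r))%:R).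
Proof.
move=> l2 r4 p01 Hp eps e0; have al0 := alpha_gt0 R l2.
have k4 : (4 <= 2 * l)%N by rewrite (@leq_mul 2 2).
have r3 : (3 <= r)%N by apply: leq_trans r4.
have r0 : (0 < r)%N by apply: leq_trans r4.
have rr0 : 0 < (r ^ r)%:R :> R by rewrite ltr0n expn_gt0 r0.
near=> n.
have [/andP[s0 s1] hp] : 0 <= eta n <= 1 /\
     n%:R `^ (- (r%:R - 2) + al l - eta n) <= p n by near: n.
have xB : (al l)^-1 * (4 * (r ^ r)%:R / eps) <= ln (n%:R : R) by near: n; apply: ln_nat_large.
have x1 : 1 <= ln (n%:R : R) by near: n; apply: ln_nat_large.
have rn : (r <= n)%N by near: n; apply: nbhs_infty_ge.
have n0 : (0 < n)%N by apply: leq_trans rn; apply: leq_trans r4.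
have p0 : 0 < p n by apply: lt_le_trans hp; rewrite powR_gt0 // ltr0n.
rewrite powR_pred //; apply: le_trans (ex_lower_star (p01 n) k4 r3 rn p0).
set x := ln n%:R in x1 xB *.
rewrite lerD2l lerN2 -powR_pred //.
(* As eta <= 1, the right side is at least n^al = exp(al x). *)
have pn : al l * x <= p n * n%:R `^ (r%:R - 1).
  apply: (@le_trans _ _ (n%:R `^ (- (r%:R - 2) + al l - eta n) * n%:R `^ (r%:R - 1))); last first.
    by rewrite ler_wpM2r ?powR_ge0.
  rewrite !powR_nat_expR // -expRD -mulrDl.
  apply: (@le_trans _ _ (expR (al l * x))).
    by apply: le_trans (expR_ge1Dx _); rewrite lerDr.
  rewrite ler_expR ler_wpM2r ?(le_trans ler01 x1) //.
  by clear -s1; lra.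
have ax : 0 < al l * x by rewrite mulr_gt0 // (lt_le_trans ltr01).
rewrite ler_pdivrMr ?(lt_le_trans ax) // -ler_pdivrMl //; apply: le_trans pn.
by rewrite -ler_pdivrMl // [eps^-1 * _]mulrC.
Unshelve. all: by end_near. Qed.

Lemma likely_thinned (R : realType) (l r : nat) (p eta : nat -> R) :
  (2 <= l)%N -> (4 <= r)%N -> (forall n, 0 <= p n <= 1) ->
  (\forall n \near \oo, 0 <= eta n <= 1 /\
     n%:R `^ (- (r%:R - 1) + al l - eta n) <= p n) ->
  likely r p (fun n G =>
    n%:R `^ (1 + al l - eta n) / (2 * (r ^ r)%:R * ln n%:R) <= (ex G (linear_cycle (2 * l) r))%:R).
Proof.
move=> l2 r4 p01 Hp eps e0; have al0 := alpha_gt0 R l2.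
have k4 : (4 <= 2 * l)%N by rewrite (@leq_mul 2 2).
have r3 : (3 <= r)%N by apply: leq_trans r4.
have r0 : (0 < r)%N by apply: leq_trans r4.
have rr0 : 0 < (r ^ r)%:R :> R by rewrite ltr0n expn_gt0 r0.
near=> n.
have [/andP[s0 s1] hp] : 0 <= eta n <= 1 /\
     n%:R `^ (- (r%:R - 1) + al l - eta n) <= p n by near: n.
have xB : (al l)^-1 * ((r ^ r)%:R * (2 * 16 / eps)) <= ln (n%:R : R) by near: n; apply: ln_nat_large.
have xC : (r ^ r)%:R * (4 * 2 / eps) <= ln (n%:R : R) by near: n; apply: ln_nat_large.
have x1 : 1 <= ln (n%:R : R) by near: n; apply: ln_nat_large.
have rn : (r <= n)%N by near: n; apply: nbhs_infty_ge.
have n0 : (0 < n)%N by apply: leq_trans rn; apply: leq_trans r4.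
have p0 : 0 < p n by apply: lt_le_trans hp; rewrite powR_gt0 // ltr0n.
set x := ln n%:R in x1 xB xC *.
have x0 : 0 < x by apply: lt_le_trans x1.
pose g := n%:R `^ (- (r%:R - 1) + al l) : R.
have g0 : 0 < g by rewrite powR_gt0 // ltr0n.
(* At density g copies and edges balance: g^(2l-1) n^(2l(r-1)) = n^r. Dividing by log n makes the
   copies negligible, and the minimum with p keeps q at most 1. *)
pose s := Num.min (p n) (g / x); pose q := s / p n.
have s_gt0 : 0 < s by rewrite lt_min p0 divr_gt0.
have sp : s <= p n by rewrite ge_min lexx.
have sg : s <= g / x by rewrite ge_min lexx orbT.
have qp : q * p n = s by rewrite divfK // gt_eqF.
have q01 : 0 < q <= 1 by rewrite divr_gt0 //= ler_pdivrMr // mul1r.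
have N0 : 0 < 'C(n, r)%:R :> R by rewrite ltr0n bin_gt0.
have Nn := pow_le_bin R r0 rn.
have nr : 0 < n%:R `^ r%:R :> R by rewrite powR_gt0 // ltr0n.
have s_ge : n%:R `^ (- (r%:R - 1) + al l - eta n) / x <= s.
  rewrite le_min; apply/andP; split.
    apply: le_trans hp; rewrite ler_pdivrMr // ler_peMr ?powR_ge0 //.
  rewrite ler_wpM2r ?invr_ge0 ?(ltW x0) // /g !powR_nat_expR // ler_expR.
  rewrite ler_wpM2r ?(ltW x0) //; clear -s0; lra.
have := ex_lower (p01 n) k4 r3 rn p0 q01 (_ : 0 < 4^-1).
rewrite qp invr_gt0 ltr0n => /(_ isT) low.
apply: le_trans _ (le_trans low _).
- have pN : al l * x / (r ^ r)%:R <= p n * 'C(n, r)%:R.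
    apply: (@le_trans _ _ (n%:R `^ (- (r%:R - 1) + al l - eta n) * (n%:R `^ r%:R / (r ^ r)%:R)));
      last first.
      by rewrite ler_pM // ?powR_ge0 // divr_ge0 ?powR_ge0 ?(ltW rr0).
    rewrite mulrA ler_wpM2r ?invr_ge0 ?(ltW rr0) //.
    rewrite !powR_nat_expR // -expRD -mulrDl; apply: (@le_trans _ _ (expR (al l * x))).
      by apply: le_trans (expR_ge1Dx _); rewrite lerDr.
    rewrite ler_expR ler_wpM2r ?(ltW x0) //; clear -s1; lra.
  have pN0 : 0 < p n * 'C(n, r)%:R by rewrite mulr_gt0.
  rewrite lerD2l lerN2 [leRHS](splitr eps); apply: lerD.
    rewrite -[leRHS]invrK lef_pV2 ?posrE ?invr_gt0 ?divr_gt0 ?mulr_gt0 ?exprn_gt0 ?invr_gt0 //.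
    move: xB; rewrite ler_pdivrMl // => xB.
    have : (2 * 16 / eps) <= al l * x / (r ^ r)%:R by rewrite ler_pdivlMr // mulrC.
    rewrite invf_div; move/le_trans => /(_ _ pN); move: (p n * _) => u; clear; lra.
  apply: (@le_trans _ _ ((g / x) ^+ (2 * l).-1 * n%:R ^+ (2 * l * r.-1) / (4^-1 * (n%:R `^ r%:R / (r ^ r)%:R)))).
    apply: ler_pM; rewrite ?mulr_ge0 ?invr_ge0 ?mulr_ge0 ?invr_ge0 ?exprn_ge0 ?(ltW s_gt0) ?ler0n ?(ltW N0) //.
      by rewrite ler_wpM2r ?exprn_ge0 // lerXn2r ?nnegrE ?divr_ge0 ?(ltW s_gt0) ?(ltW g0) ?(ltW x0).
    by rewrite lef_pV2 ?posrE ?mulr_gt0 ?invr_gt0 // ler_wpM2l // invr_ge0.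
  have gk : g ^+ (2 * l).-1 * n%:R ^+ (2 * l * r.-1) = n%:R `^ r%:R.
    rewrite -!powR_mulrn ?(ltW g0) // -powRrM -powR_natD //.
    congr (_ `^ _); rewrite natrM -!subn1 !natrB ?(leq_trans _ k4) ?(leq_trans _ r4) // natrM.
    rewrite mulrDl mulVf; last by rewrite -invr_eq0 gt_eqF.
    ring.
  rewrite exprMn.
  rewrite [leLHS](_ : _ = g ^+ (2 * l).-1 * n%:R ^+ (2 * l * r.-1) / (4^-1 * (n%:R `^ r%:R / (r ^ r)%:R)) * x^-1 ^+ (2 * l).-1);
    last by ring.
  rewrite gk invfM invrK invf_div mulrCA [_ * (_ / _)]mulrCA mulfV ?gt_eqF // mulr1.
  have k0 : (2 * l).-1 = (2 * l).-2.+1 by clear -l2; lia.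
  apply: (@le_trans _ _ (4 * (r ^ r)%:R * x^-1)).
    rewrite ler_wpM2l ?mulr_ge0 // k0 exprS ler_piMr ?invr_ge0 ?(ltW x0) //.
    by rewrite exprn_ile1 ?invr_ge0 ?(ltW x0) // invf_le1.
  rewrite ler_pdivrMr // -ler_pdivrMl ?divr_gt0 //; apply: le_trans xC.
  by rewrite le_eqVlt; apply/orP; left; apply/eqP; field; rewrite gt_eqF.
apply: le_bern_Pr => // G _; apply: le_trans.
apply: (@le_trans _ _ ((1 - 2 * 4^-1) * (n%:R `^ (- (r%:R - 1) + al l - eta n) / x * (n%:R `^ r%:R / (r ^ r)%:R))));
  last first.
  rewrite ler_wpM2l //; first by clear; lra.
  by rewrite ler_pM // divr_ge0 ?powR_ge0 ?(ltW x0) ?(ltW rr0).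
rewrite [leRHS](_ : _ = n%:R `^ (- (r%:R - 1) + al l - eta n) * n%:R `^ r%:R * (2 * (r ^ r)%:R * x)^-1);
  last first.
  by field; rewrite !gt_eqF.
rewrite -powR_natD //.
rewrite le_eqVlt; apply/orP; left; apply/eqP; congr (_ `^ _ / _); ring.
Unshelve. all: by end_near. Qed.

Lemma cvg0_le (R : realType) (u : nat -> R) (eps : R) :
  u @ \oo --> (0 : R) -> 0 < eps -> \forall n \near \oo, u n <= eps.
Proof.
move=> /cvgrPdist_le/[apply]; apply: filterS => n.
by rewrite sub0r normrN; apply: le_trans; apply: ler_norm.
Qed.

Lemma cvg_sqrt0 (R : realType) (u : nat -> R) :
  u @ \oo --> (0 : R) -> (fun n => Num.sqrt (u n)) @ \oo --> (0 : R).
Proof.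
move=> u0; rewrite -[X in _ --> X]sqrtr0.
by apply: (cvg_comp _ _ u0); apply: sqrt_continuous.
Qed.

(** The two assumptions make the number of edges concentrate around its mean p C(n, r) and the
    copies too few to matter, so q = 1 suffices in [ex_lower]. *)
Lemma ex_concentrated (R : realType) (l r : nat) (p : nat -> R) :
  (2 <= l)%N -> (4 <= r)%N -> (forall n, 0 <= p n <= 1) ->
  much_less (fun n => (n%:R : R) `^ (- r%:R)) p ->
  much_less p (fun n => (n%:R : R) `^ (- (r%:R - 1) + al l)) ->
  exists d1 : nat -> R, d1 @ \oo --> (0 : R) /\
    likely r p (fun n G =>
      (1 - d1 n) * (p n * 'C(n, r)%:R)
        <= (ex G (linear_cycle (2 * l) r))%:R
        <= (1 + d1 n) * (p n * 'C(n, r)%:R)).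
Proof.
move=> l2 r4 p01 [pN0 F0] [_ G0].
have al0 := alpha_gt0 R l2.
have k4 : (4 <= 2 * l)%N by rewrite (@leq_mul 2 2).
have r3 : (3 <= r)%N by apply: leq_trans r4.
have r0 : (0 < r)%N by apply: leq_trans r4.
have rr0 : 0 < (r ^ r)%:R :> R by rewrite ltr0n expn_gt0 r0.
pose F n : R := n%:R `^ (- r%:R) / p n.
pose G n : R := p n / n%:R `^ (- (r%:R - 1) + al l).
pose z n : R := (r ^ r)%:R * (F n + G n).
(* A fourth root: both error quantities are at most z = del^4, so they stay small after division by
   del^2 and by del. *)
pose del n : R := Num.sqrt (Num.sqrt (z n)).
have z0 : z @ \oo --> (0 : R).
  rewrite -[X in _ --> X](mulr0 (r ^ r)%:R) -[X in _ * X](addr0 0).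
  by apply: cvgM; [exact: cvg_cst|apply: cvgD].
have del0 : del @ \oo --> (0 : R).
  by do 2 apply: cvg_sqrt0.
exists (fun n => 2 * del n); split.
  by rewrite -[X in _ --> X](mulr0 2); apply: cvgM => //; exact: cvg_cst.
pose good n := [/\ 0 < del n, (r <= n)%N, 0 < p n,
    (del n ^+ 2 * (p n * 'C(n, r)%:R))^-1 <= del n ^+ 2 &
    (1 * p n) ^+ (2 * l).-1 * n%:R ^+ (2 * l * r.-1) / (del n * 'C(n, r)%:R) <= del n ^+ 3].
have key : \forall n \near \oo, good n.
  near=> n.
  have rn : (r <= n)%N by near: n; apply: nbhs_infty_ge.
  have pn : p n != 0 by near: n.
  have G1 : G n <= 1 by near: n; apply: cvg0_le.
  have [p0 p1] := andP (p01 n).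
  have n0 : (0 < n)%N by apply: leq_trans rn.
  have {pn p0} p0 : 0 < p n by rewrite lt0r pn.
  have nr a : 0 < n%:R `^ a :> R by rewrite powR_gt0 // ltr0n.
  have Fn : 0 < F n by rewrite divr_gt0.
  have Gn : 0 < G n by rewrite divr_gt0.
  have zF : (r ^ r)%:R * F n <= z n by rewrite /z ler_wpM2l ?(ltW rr0) // lerDl ltW.
  have zG : (r ^ r)%:R * G n <= z n by rewrite /z ler_wpM2l ?(ltW rr0) // lerDr ltW.
  have zn : 0 < z n by apply: lt_le_trans zF; rewrite mulr_gt0.
  have dn : 0 < del n by rewrite !sqrtr_gt0.
  have d4 : del n ^+ 2 * del n ^+ 2 = z n by rewrite sqr_sqrtr ?sqrtr_ge0 // -expr2 sqr_sqrtr // ltW.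
  have N0 : 0 < 'C(n, r)%:R :> R by rewrite ltr0n bin_gt0.
  have Nn := pow_le_bin R r0 rn.
  have Ni : 'C(n, r)%:R^-1 <= (r ^ r)%:R * n%:R `^ (- r%:R) :> R.
    rewrite powRN -[leRHS]invrK invfM invrK lef_pV2 ?posrE ?mulr_gt0 ?invr_gt0 //.
    by rewrite mulrC.
  split => //.
    rewrite invfM ler_pdivrMl ?exprn_gt0 // d4; apply: le_trans zF.
    by rewrite invfM mulrC /F mulrA ler_wpM2r // invr_ge0 ltW.
  rewrite mul1r invfM mulrCA ler_pdivrMl //.
  rewrite -exprS (_ : del n ^+ 4 = z n); last by rewrite -d4 -exprD.
  apply: le_trans zG.
  apply: (@le_trans _ _ ((r ^ r)%:R * (p n ^+ (2 * l).-1 * (n%:R ^+ (2 * l * r.-1) * n%:R `^ (- r%:R))))).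
    rewrite -mulrA [leRHS](_ : _ = p n ^+ (2 * l).-1 * (n%:R ^+ (2 * l * r.-1) * ((r ^ r)%:R * n%:R `^ (- r%:R))));
      last by ring.
    by rewrite ler_wpM2l ?exprn_ge0 ?(ltW p0) // ler_wpM2l ?exprn_ge0.
  rewrite ler_wpM2l ?(ltW rr0) //.
  have -> : n%:R ^+ (2 * l * r.-1) * n%:R `^ (- r%:R) = (n%:R `^ (- (r%:R - 1) + al l) : R)^-1 ^+ (2 * l).-1.
    rewrite -powRN -!powR_mulrn ?powR_ge0 // -powRrM -powR_natD //.
    congr (_ `^ _); rewrite natrM -!subn1 !natrB ?(leq_trans _ k4) // natrM.
    have E : al l * (2 * l%:R - 1) = 1 :> R by rewrite mulVf // -invr_eq0 gt_eqF.
    rewrite [RHS](_ : _ = (r%:R - 1) * (2 * l%:R - 1) - al l * (2 * l%:R - 1)); last by ring.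
    by rewrite E; ring.
  rewrite -exprMn -/(G n) (_ : (2 * l).-1 = (2 * l).-2.+1); last by clear -l2; lia.
  by rewrite exprS ler_piMr ?(ltW Gn) // exprn_ile1 // ltW.
apply: likely_and => // eps e0.
  near=> n; have [dn rn pn a b] : good n by near: n.
  have d1 : del n <= 1 by near: n; apply: cvg0_le.
  have d2 : del n <= eps / 2 by near: n; apply: cvg0_le; rewrite // divr_gt0.
  apply: le_trans (le_trans (ex_lower (p01 n) k4 r3 rn pn (_ : 0 < 1 <= 1) dn) _).
  - have s2 : del n ^+ 2 <= del n by rewrite ler_iXnr // ltW.
    have s3 : del n ^+ 3 <= del n by rewrite ler_iXnr // ltW.
    move: a b s2 s3 d2; set A := (_ ^-1); set B := (_ / _); clear; lra.
  - by rewrite ltr01 lexx.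
  - by apply: le_bern_Pr => // H _; rewrite mul1r.
near=> n; have [dn rn pn a b] : good n by near: n.
have d1 : del n <= 1 by near: n; apply: cvg0_le.
have d2 : del n <= eps by near: n; apply: cvg0_le.
apply: le_trans (le_trans (ex_upper_edges (2 * l) (p01 n) rn pn dn) _).
- have s2 : del n ^+ 2 <= del n by rewrite ler_iXnr // ltW.
  by rewrite lerD2l lerN2 (le_trans a) // (le_trans s2).
- apply: le_bern_Pr => // H _ /le_trans; apply.
  rewrite ler_wpM2r ?mulr_ge0 ?(ltW pn) // lerD2l; clear -dn; lra.
Unshelve. all: by end_near. Qed.

(** * Exponents of order log log n / log n *)

Section LogLog.
Variable R : realType.
Local Notation g n := (ln (ln n%:R) / ln n%:R : R).

Lemma loglog_smallP (e : nat -> R) :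
  loglog_small e <-> exists2 c, 0 < c & \forall n \near \oo, `|e n| <= c * g n.
Proof.
have g0 : \forall n \near \oo, 0 <= g n.
  near=> n; have x1 : expR 1 <= ln (n%:R : R) by near: n; apply: ln_nat_large.
  have x0 := lt_le_trans (expR_gt0 1) x1.
  rewrite divr_ge0 ?(ltW x0) // ln_ge0 // (le_trans _ x1) //.
  by rewrite -[leLHS]expR0 ler_expR.
split=> [/eqO_exP[c c0 H]|[c c0 H]].
  exists c => //; near=> n; have g0n : 0 <= g n by near: n.
  by rewrite -(ger0_norm g0n); near: n.
apply/eqO_exP; exists c => //; near=> n; have g0n : 0 <= g n by near: n.
by rewrite /= (ger0_norm g0n); near: n.
Unshelve. all: by end_near. Qed.

Lemma loglog_smallD (a b : nat -> R) :
  loglog_small a -> loglog_small b -> loglog_small (fun n => `|a n| + `|b n|).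
Proof.
move=> /loglog_smallP[c c0 ha] /loglog_smallP[d d0 hb].
apply/loglog_smallP; exists (c + d); first exact: addr_gt0.
near=> n; rewrite ger0_norm ?addr_ge0 // mulrDl; apply: lerD; by near: n.
Unshelve. all: by end_near. Qed.

(** With u = log log n, the gauge is u / e^u, and e^u >= u^2 / 2. *)
Lemma loglog_small_le (e : nat -> R) (del : R) : loglog_small e -> 0 < del ->
  \forall n \near \oo, `|e n| <= del.
Proof.
move=> /loglog_smallP[c c0 H] d0; near=> n.
apply: (@le_trans _ _ (c * g n)); first by near: n.
have xB : expR (2 * c / del) <= ln (n%:R : R) by near: n; apply: ln_nat_large.
set x := ln n%:R in xB *.
have x0 : 0 < x := lt_le_trans (expR_gt0 _) xB.
have uB : 2 * c / del <= ln x by rewrite -ler_expR lnK.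
have u0 : 0 <= ln x by apply: le_trans uB; rewrite divr_ge0 ?(ltW d0) // mulr_ge0 // ltW.
rewrite mulrA ler_pdivrMr //.
have := expR_ge1Dxn 1 u0; rewrite lnK ?posrE // (_ : 2`! = 2)%N // => h.
move: uB; rewrite ler_pdivrMr // => uB.
apply: (@le_trans _ _ (del * (ln x ^+ 2 / 2))).
  rewrite expr2 [leRHS](_ : _ = ln x * del / 2 * ln x); last by ring.
  by rewrite ler_wpM2r // ler_pdivlMr // mulrC.
by rewrite ler_wpM2l ?(ltW d0) //; clear -h; lra.
Unshelve. all: by end_near. Qed.

Lemma loglog_small_gauge (c : R) : loglog_small (fun n => c * g n).
Proof.
apply/loglog_smallP; exists (`|c| + 1); first by rewrite ltr_wpDl.
near=> n.
have x1 : expR 1 <= ln (n%:R : R) by near: n; apply: ln_nat_large.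
have x0 := lt_le_trans (expR_gt0 1) x1.
have g0 : 0 <= g n.
  rewrite divr_ge0 ?(ltW x0) // ln_ge0 // (le_trans _ x1) //.
  by rewrite -[leLHS]expR0 ler_expR.
by rewrite normrM (ger0_norm g0) ler_wpM2r // lerDl.
Unshelve. all: by end_near. Qed.

(** Polylogarithmic factors are exactly such exponents, which is how they enter the o(1) terms. *)
Lemma powR_loglog n (a : R) (c : nat) : 0 < ln (n%:R : R) -> (0 < n)%N ->
  n%:R `^ (a + c%:R * g n) = n%:R `^ a * ln n%:R ^+ c.
Proof.
move=> x0 n0; rewrite powR_natD //; congr (_ * _).
rewrite powR_nat_expR // -mulrA divfK ?gt_eqF // expRM_natl lnK //.
Qed.

End LogLog.

Theorem theorem3p2 (R : realType) (l r : nat) (hl : (2 <= l)%N) (hr : (4 <= r)%N)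
    (e1 e2 e3 : nat -> R)
    (he1 : loglog_small e1) (he2 : loglog_small e2) (he3 : loglog_small e3) :
  exists d2 d3 : nat -> R,
    [/\ loglog_small d2, loglog_small d3 &
    forall p : nat -> R, (forall n, 0 <= p n <= 1) ->
    [/\ much_less (fun n => (n%:R : R) `^ (- r%:R)) p ->
        much_less p
          (fun n => (n%:R : R) `^ (- (r%:R - 1) + (2 * l%:R - 1)^-1)) ->
        exists d1 : nat -> R, d1 @ \oo --> (0 : R) /\
          aas r p (fun n G =>
            (1 - d1 n) * (p n * 'C(n, r)%:R)
              <= (ex G (linear_cycle (2 * l) r))%:R
              <= (1 + d1 n) * (p n * 'C(n, r)%:R)),
        (\forall n \near \oo,
          (n%:R : R) `^ (- (r%:R - 1) + (2 * l%:R - 1)^-1 + e1 n) <= p n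
            <= (n%:R : R) `^ (- (r%:R - 2) + (2 * l%:R - 1)^-1 + e2 n)) ->
        aas r p (fun n G =>
          (n%:R : R) `^ (1 + (2 * l%:R - 1)^-1 - d2 n)
            <= (ex G (linear_cycle (2 * l) r))%:R
            <= (n%:R : R) `^ (1 + (2 * l%:R - 1)^-1 + d2 n))
      & (\forall n \near \oo,
          (n%:R : R) `^ (- (r%:R - 2) + (2 * l%:R - 1)^-1 + e3 n) <= p n) ->
        aas r p (fun n G =>
          p n * (n%:R : R) `^ (r%:R - 1 - d3 n)
            <= (ex G (linear_cycle (2 * l) r))%:R
            <= p n * (n%:R : R) `^ (r%:R - 1 + d3 n))]].
Proof.
have [kap upper] := likely_upper R hl hr.
pose s n := `|(`|e1 n| + `|e2 n|)| + `|e3 n|.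
(* [s] dominates the given exponents. The extra kap + 2 logarithms pay for twice the kap-th power of
   log n in the upper bounds and for C0 log n in the lower ones. *)
pose D n : R := s n + kap.+2%:R * (ln (ln n%:R) / ln n%:R).
have hs : loglog_small s by apply: loglog_smallD => //; apply: loglog_smallD.
have hD : loglog_small D.
  have /loglog_smallP[a a0 Ha] := hs.
  have /loglog_smallP[b b0 Hb] := loglog_small_gauge (kap.+2%:R : R).
  apply/loglog_smallP; exists (a + b); first exact: addr_gt0.
  near=> n; apply: le_trans (ler_normD _ _) _; rewrite [leRHS]mulrDl.
  by apply: lerD; near: n.
have s0 n : 0 <= s n by rewrite addr_ge0.
have sE n : [/\ `|e1 n| <= s n, `|e2 n| <= s n & `|e3 n| <= s n].
  rewrite /s (ger0_norm (addr_ge0 (normr_ge0 _) (normr_ge0 _))).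
  by have [? [? ?]] := (normr_ge0 (e1 n), (normr_ge0 (e2 n), normr_ge0 (e3 n))); split; lra.
have s1 : \forall n \near \oo, 0 <= s n <= 1.
  near=> n; rewrite s0 /= -[s n]ger0_norm //.
  by near: n; apply: loglog_small_le.
have r0 : (0 < r)%N by apply: leq_trans hr.
pose C0 : R := 2 * (r ^ r)%:R.
have C00 : 0 < C0 by rewrite mulr_gt0 // ltr0n expn_gt0 r0.
pose regular n := [/\ (0 < n)%N, 0 < ln (n%:R : R),
    forall a : R, n%:R `^ (a + D n) = n%:R `^ (a + s n) * ln n%:R ^+ kap.+2,
    forall a : R, n%:R `^ (a - D n) <= n%:R `^ (a - s n) / (C0 * ln n%:R) &
    2 * ln n%:R ^+ kap <= ln (n%:R : R) ^+ kap.+2].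
have large : \forall n \near \oo, regular n.
  near=> n.
  have n0 : (0 < n)%N by near: n; apply: nbhs_infty_ge.
  have x2 : 2 <= ln (n%:R : R) by near: n; apply: ln_nat_large.
  have xC : C0 <= ln (n%:R : R) by near: n; apply: ln_nat_large.
  have x0 : 0 < ln (n%:R : R) by apply: lt_le_trans x2.
  have x1 : 1 <= ln (n%:R : R) by apply: le_trans x2; rewrite ler1n.
  have DE (a : R) : n%:R `^ (a + D n) = n%:R `^ (a + s n) * ln n%:R ^+ kap.+2.
    by rewrite /D addrA powR_loglog.
  split => // [a|].
    rewrite ler_pdivlMr ?(mulr_gt0 C00 x0) //.
    have -> : a - s n = a - D n + kap.+2%:R * (ln (ln n%:R) / ln n%:R) by rewrite /D; ring.
    rewrite powR_loglog // ler_wpM2l ?powR_ge0 // exprS.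
    apply: (@le_trans _ _ (ln n%:R * ln n%:R)); first by rewrite ler_wpM2r // ltW.
    by rewrite ler_wpM2l ?(ltW x0) // exprS ler_peMr ?(ltW x0) // exprn_ege1.
  rewrite [leRHS]exprS ler_pM ?exprn_ge0 ?(ltW x0) //.
  by rewrite exprS ler_peMl // exprn_ge0 // ltW.
have up2 n : (0 < n)%N -> 0 < ln (n%:R : R) -> forall A B C : R, 0 <= B -> A <= C -> B <= C ->
    2 * ln n%:R ^+ kap <= ln (n%:R : R) ^+ kap.+2 ->
    (A + B) * ln n%:R ^+ kap <= C * ln (n%:R : R) ^+ kap.+2.
  move=> n0 x0 A B C B0 AC BC hx; apply: (@le_trans _ _ (C * (2 * ln n%:R ^+ kap))).
    rewrite mulrA ler_wpM2r ?exprn_ge0 ?(ltW x0) //; clear -AC BC; lra.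
  by apply: ler_wpM2l => //; apply: le_trans BC.
exists D, D; split => // p p01; split.
- move=> h1 h2; have [d1 [d10 H]] := ex_concentrated hl hr p01 h1 h2.
  by exists d1; split => //; apply: aas_likely.
- move=> hp; apply: aas_likely => //; apply: likely_and => //.
    apply: likely_mono (likely_thinned (eta := s) hl hr p01 _) => //; near=> n.
      move=> G; apply: le_trans.
      have [n0 x0 _ DE _] : regular n by near: n.
      exact: DE.
    split; first by near: n.
    have n1 : (1 <= n)%N by near: n; apply: nbhs_infty_ge.
    have /andP[hn _] : n%:R `^ (- (r%:R - 1) + al l + e1 n) <= p n
            <= n%:R `^ (- (r%:R - 2) + al l + e2 n) by near: n.
    apply: le_trans hn; rewrite ler_powR ?ler1n // lerD2l.
    by have [+ _ _] := sE n; rewrite ler_norml => /andP[].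
  apply: upper => //; near=> n.
  have [n0 x0 DE _ xx] : regular n by near: n.
  have /andP[_ hn] : n%:R `^ (- (r%:R - 1) + al l + e1 n) <= p n
            <= n%:R `^ (- (r%:R - 2) + al l + e2 n) by near: n.
  have [p0 _] := andP (p01 n).
  rewrite DE; apply: up2 => //; first by rewrite mulr_ge0 ?powR_ge0.
    by rewrite ler_powR ?ler1n // lerDl.
  apply: (@le_trans _ _ (n%:R `^ (- (r%:R - 2) + al l + e2 n) * n%:R `^ (r%:R - 1))).
    by rewrite ler_wpM2r ?powR_ge0.
  rewrite -powR_natD // ler_powR ?ler1n //.
  have [_ + _] := sE n; rewrite ler_norml => /andP[_]; move: (e2 n) (s n) => u v; clear; lra.
- move=> hp; apply: aas_likely => //; apply: likely_and => //.
    apply: likely_mono (likely_star (eta := s) hl hr p01 _) => //; near=> n.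
      have [n0 x0 _ DE _] : regular n by near: n.
      have x1 : 1 <= ln (n%:R : R) by near: n; apply: ln_nat_large.
      have [p0 _] := andP (p01 n).
      move=> G; apply: le_trans; rewrite -mulrA ler_wpM2l //.
      apply: le_trans (DE _) _; apply: ler_pM; rewrite ?powR_ge0 ?invr_ge0 ?mulr_ge0 ?(ltW x0) ?(ltW C00) //.
        by rewrite ler_powR ?ler1n // gerBl.
      by rewrite lef_pV2 ?posrE ?(mulr_gt0 C00 x0) // ler_peMr // ltW.
    split; first by near: n.
    have n1 : (1 <= n)%N by near: n; apply: nbhs_infty_ge.
    have hn : n%:R `^ (- (r%:R - 2) + al l + e3 n) <= p n by near: n.
    apply: le_trans hn; rewrite ler_powR ?ler1n // lerD2l.
    by have [_ _] := sE n; rewrite ler_norml => /andP[].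
  apply: upper => //; near=> n.
  have [n0 x0 DE _ xx] : regular n by near: n.
  have hn : n%:R `^ (- (r%:R - 2) + al l + e3 n) <= p n by near: n.
  have [p0 _] := andP (p01 n).
  rewrite DE mulrA; apply: up2 => //; first by rewrite mulr_ge0 ?powR_ge0.
    (* In this range p n^(r-1+s) dominates the container term n^(1 + al), because e3 + s >= 0. *)
    apply: (@le_trans _ _ (n%:R `^ (- (r%:R - 2) + al l + e3 n) * n%:R `^ (r%:R - 1 + s n))).
      rewrite -powR_natD // ler_powR ?ler1n //.
      have [_ _] := sE n; rewrite ler_norml => /andP[+ _]; move: (e3 n) (s n) => u v; clear; lra.
    by rewrite ler_wpM2r ?powR_ge0.
  by rewrite ler_wpM2l // ler_powR ?ler1n // lerDl.
Unshelve. all: by end_near. Qed.
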